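(* Let $(l_j)_{j=1}^\infty$ be a summable sequence of positive numbers and $(\phi_j)_{j=1}^\infty$ a sequence of real numbers. Let $H$ be the Hamburger Hamiltonian with these lengths and angles, $W_H$ its monodromy matrix, and $\rho_H$ the order of $W_H$. Assume that we have $\psi\in\mathbb R$ and $\delta_l,\delta_\phi,\gamma_l,\gamma_\phi\ge0$ such that, for $j,N\in\mathbb N$, $$l_j\lesssim j^{-\delta_l},\quad|\sin(\phi_{j+1}-\phi_j)|\lesssim j^{-\delta_\phi},\quad\sum_{j=N+1}^\infty l_j\lesssim N^{-\gamma_l},\quad\sum_{j=N+1}^\infty l_j\sin^2(\phi_j-\psi)\lesssim N^{-\gamma_\phi}.$$ Set $\delta:=\delta_l+\delta_\phi$, $\gamma:=\frac12(\gamma_l+\gamma_\phi)$ and assume $\delta>0$, $\gamma>0$. For a constant $c\in(0,1]$ put $d_l(t)=ct^{-\delta_l}$, $d_\phi(t)=ct^{-\delta_\phi}$, $c_l(t)=ct^{-\gamma_l}$, $c_\phi(t)=ct^{-\gamma_\phi}$, and let $T(R)$ be the unique solution $t$ of $\mathfrak g(t,R)=R(c_lc_\phi)^{1/2}(t)$, with $\mathfrak g$ as in the context. Write $M(R):=\max_{|z|=R}\|W_H(z)\|$. Then for sufficiently large $R$: (1) If $\delta<1+\gamma$: $T(R)\asymp\big(\frac R{\log R}\big)^{\frac1{1+\gamma}}$, $\log M(R)\lesssim R^{\frac1{1+\gamma}}(\log R)^{\frac\gamma{1+\gamma}}$, and $\rho_H\le\frac1{1+\gamma}$. (2) If $\delta=1+\gamma$: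 $T(R)\asymp R^{\frac1\delta}$, $\log M(R)\lesssim R^{\frac1\delta}$, and $\rho_H\le\frac1\delta$. (3) If $1+\gamma<\delta$ and $\delta>2$: $T(R)\asymp R^{\frac{\delta-1}{\gamma\delta}}$, $\log M(R)\lesssim R^{\frac1\delta}$, and $\rho_H\le\frac1\delta$. (4) If $1+\gamma<\delta$ and $\delta=2$: $T(R)\asymp\big(\frac{R^{1/2}}{\log R}\big)^{\frac1\gamma}$, $\log M(R)\lesssim R^{\frac12}\log R$, and $\rho_H\le\frac12$. (5) If $1+\gamma<\delta<2$ and $\delta_l\le1+\gamma$: $T(R)\asymp R^{\frac1{2-\delta+2\gamma}}$, $\log M(R)\lesssim R^{\frac{2-\delta+\gamma}{2-\delta+2\gamma}}$, and $\rho_H\le\frac{2-\delta+\gamma}{2-\delta+2\gamma}$. (6) If $1+\gamma<\delta<2$ and $1+\gamma<\delta_l$: $T(R)\asymp R^{\frac{\delta_l-1}{\gamma(\delta_l-\delta_\phi)}}$, $\log M(R)\lesssim R^{\frac{1-\delta_\phi}{\delta_l-\delta_\phi}}$, and $\rho_H\le\frac{1-\delta_\phi}{\delta_l-\delta_\phi}$.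
   Context: Hamburger Hamiltonian: for $\phi\in\mathbb R$ let $\xi_\phi:=(\cos\phi,\sin\phi)^T$. Put $x_0:=0$, $x_j:=\sum_{i=1}^jl_i$, $\mathcal L:=\sum_{j=1}^\infty l_j<\infty$. The Hamburger Hamiltonian with lengths $l_j$ and angles $\phi_j$ is $H:(0,\mathcal L)\to\mathbb R^{2\times2}$, $H(t):=\xi_{\phi_j}\xi_{\phi_j}^T$ for $x_{j-1}\le t<x_j$, $j\in\mathbb N=\{1,2,\dots\}$. Monodromy matrix: let $J:=\begin{pmatrix}0&-1\\1&0\end{pmatrix}$. The fundamental solution $W(t;z)$, $t\in[0,\mathcal L]$, $z\in\mathbb C$, is the unique (absolutely continuous in $t$) $2\times2$-matrix solution of $\frac{\partial}{\partial t}W(t;z)J=zW(t;z)H(t)$ for a.e. $t\in(0,\mathcal L)$, $W(0;z)=I$; the monodromy matrix is $W_H(z):=W(\mathcal L;z)$. $\|\cdot\|$ is the operator norm. The order is $\rho_H:=\limsup_{R\to\infty}\frac{\log\log\max_{|z|=R}\|W_H(z)\|}{\log R}$. Notation: $f\lesssim g$ means $f\le\text{const}\cdot g$ on the indicated domain with a constant $>0$; $f\asymp g$ means $f\lesssim g$ and $g\lesssim f$. Functions built from $d_l:[1,\infty)\to(0,\infty)$ and $d_\phi:[1,\infty)\to(0,1]$: $$k(R):=\sup\Big\{t\in[1,\infty):\sup_{1\le s\le t}\frac{2}{R\,d_l(s)d_\phi(s)}\le1\Big\},\qquad h(R):=\sup\Big\{t\in[1,\infty):\sup_{1\le s\le t}\frac{d_\phi(s)}{R\,d_l(s)}\le1\Big\}$$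 (values in $[1,\infty]$, $k(R)\le h(R)$) for $R\ge\frac2{d_l(1)d_\phi(1)}$, and $$g(t,R):=\begin{cases}\log\big(R\,d_l(t)d_\phi(t)\big)&1\le t<k(R),\\ R^{1/2}(d_l(t)d_\phi(t))^{1/2}&k(R)\le t<h(R),\\ R\,d_l(t)&h(R)\le t,\end{cases}\qquad \mathfrak g(t,R):=\int_1^tg(s,R)\,ds.$$
   Formalization: In (4), the upper half of T(R) ≍ (R^{1/2}/log R)^{1/γ} is claimed only for δ_φ > 0, since it fails when δ_φ = 0, δ_l = 2 (there T(R) ≳ R^{1/(2γ)}); the lower half and the bounds on log M(R) and ρ_H are claimed in all cases. *)

(* Defs.v *)
From HB Require Import structures.
From mathcomp Require Import all_boot all_order all_algebra.
From mathcomp Require Import complex.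
From mathcomp Require Import all_classical all_reals all_analysis.

Set Implicit Arguments.
Unset Strict Implicit.
Unset Printing Implicit Defensive.

Import Order.TTheory GRing.Theory Num.Theory.
Import numFieldNormedType.Exports.

Local Open Scope classical_set_scope.
Local Open Scope ring_scope.

(* "lesssim F f g" is f <= const * g along the filter F, with a positive
   constant: F = +oo%R reads "for sufficiently large R", and F = globally D
   reads "on all of D". *)
Definition lesssim (R : realType) (T : Type) (F : set_system T)
    (f g : T -> \bar R) : Prop :=
  exists2 C : R, 0 < C & \forall x \near F, (f x <= C%:E * g x)%E.

Definition asymp (R : realType) (T : Type) (F : set_system T)
    (f g : T -> \bar R) : Prop :=
  lesssim F f g /\ lesssim F g f.

(* Sequences indexed by {1, 2, ...} are functions on nat whose value at 0 is
   never used. *)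
Definition posnat : set nat := [set j | (1 <= j)%N].

Section Hamiltonian.
Context {R : realType}.
Implicit Types (l phi : nat -> R) (t L : R).

Definition xi (a : R) : 'cV[R]_2 := \col_(i < 2) (if i == 0 then cos a else sin a).

Definition node l (j : nat) : R := \sum_(1 <= i < j.+1) l i.

Definition total_length l : R := fine (\sum_(1 <= j <oo) (l j)%:E)%E.

(* The j >= 1 with x_(j-1) <= t < x_j: it exists and is unique for t in
   ]0, total_length l[ when the lengths are positive. *)
Definition interval_index l t : nat :=
  xget 0%N [set j | posnat j /\ node l j.-1 <= t < node l j].

Definition hamburger l phi t : 'M[R]_2 :=
  let v := xi (phi (interval_index l t)) in v *m v^T.

End Hamiltonian.

Section Monodromy.
Context {R : realType}.
Local Notation C := R[i].

Definition Jmx : 'M[C]_2 :=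
  \matrix_(i < 2, j < 2) (if (i < j)%N then -1 else if (j < i)%N then 1 else 0).

Definition abs_continuous_on (a b : R) (f : R -> R) : Prop :=
  forall e : R, 0 < e -> exists2 d : R, 0 < d &
    forall (n : nat) (u v : 'I_n -> R),
      (forall i, a <= u i <= v i /\ v i <= b) ->
      trivIset setT (fun i => `]u i, v i[%classic) ->
      \sum_(i < n) (v i - u i) < d ->
      \sum_(i < n) `|f (v i) - f (u i)| < e.

Definition mx_abs_continuous_on (a b : R) (F : R -> 'M[C]_2) : Prop :=
  forall i j : 'I_2,
    abs_continuous_on a b (fun t => complex.Re (F t i j)) /\
    abs_continuous_on a b (fun t => complex.Im (F t i j)).

Definition mx_is_derive (t : R) (F : R -> 'M[C]_2) (D : 'M[C]_2) : Prop :=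
  forall i j : 'I_2,
    is_derive t 1 (fun s => complex.Re (F s i j)) (complex.Re (D i j)) /\
    is_derive t 1 (fun s => complex.Im (F s i j)) (complex.Im (D i j)).

(* W is the fundamental solution on [0, L] of the canonical system with
   Hamiltonian H; only the values W t z with t in [0, L] matter. *)
Definition fundamental_solution (H : R -> 'M[R]_2) (L : R)
    (W : R -> C -> 'M[C]_2) : Prop :=
  forall z : C,
    [/\ mx_abs_continuous_on 0 L (W^~ z),
        W 0 z = 1%:M &
        {ae lebesgue_measure, forall t : R, 0 < t < L ->
          mx_is_derive t (fun s => W s z *m Jmx)
            (z *: (W t z *m map_mx (real_complex R) (H t)))}].

Definition cV_norm (v : 'cV[C]_2) : R :=
  Num.sqrt (\sum_(i < 2) Normc.normc (v i 0) ^+ 2).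

Definition op_norm (A : 'M[C]_2) : R :=
  sup [set cV_norm (A *m v) | v in [set v | cV_norm v <= 1]].

(* The maximum over the circle |z| = r, written as a supremum in \bar R; it is
   attained when F is continuous. *)
Definition max_modulus (F : C -> 'M[C]_2) (r : R) : \bar R :=
  ereal_sup [set (op_norm (F z))%:E | z in [set z | Normc.normc z = r]].

Definition growth_order (F : C -> 'M[C]_2) : \bar R :=
  limf_esup (fun r : R => (lne (lne (max_modulus F r)) * ((ln r)^-1)%:E)%E)
    (pinfty_nbhs R).

End Monodromy.

Section ComparisonFunctions.
Context {R : realType}.
Variables (dl dphi cl cphi : R -> R).

Definition kfun (r : R) : \bar R :=
  ereal_sup [set t%:E | t in [set t : R | 1 <= t /\
    (ereal_sup [set (2 / (r * dl s * dphi s))%:E | s in `[1%R, t]] <= 1)%E]].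

Definition hfun (r : R) : \bar R :=
  ereal_sup [set t%:E | t in [set t : R | 1 <= t /\
    (ereal_sup [set (dphi s / (r * dl s))%:E | s in `[1%R, t]] <= 1)%E]].

Definition gfun (t r : R) : R :=
  if (t%:E < kfun r)%E then ln (r * dl t * dphi t)
  else if (t%:E < hfun r)%E then Num.sqrt r * Num.sqrt (dl t * dphi t)
  else r * dl t.

Definition gfrak (t r : R) : \bar R :=
  (\int[lebesgue_measure]_(s in `[1%R, t]) (gfun s r)%:E)%E.

Definition Tfun (r : R) : R :=
  xget 1 [set t : R | 1 <= t /\
    gfrak t r = (r * Num.sqrt (cl t * cphi t))%:E].

End ComparisonFunctions.

(* Main.v *)
Require Import Defs.
From HB Require Import structures.
From mathcomp Require Import all_boot all_order all_algebra.
From mathcomp Require Import complex.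
From mathcomp Require Import all_classical all_reals all_analysis.
From mathcomp Require Import measurable_realfun.
From mathcomp Require Import ring lra.

Set Implicit Arguments.
Unset Strict Implicit.
Unset Printing Implicit Defensive.

Import Order.TTheory GRing.Theory Num.Theory.
Import numFieldNormedType.Exports.

Local Open Scope classical_set_scope.
Local Open Scope ring_scope.

(** Write [d = dl + dp] for the decay exponent of lengths and angle increments
    together, [gm] for that of the tails, and [g(t, r)] for the comparison
    function. Two facts carry the proof: [log M(r)] is at most a constant times
    [area(t) + r * t `^ (- gm) + ln r], where [area(t)] is the integral of
    [g(s, r)] over [1 <= s <= t], for every [t] of polynomial size in [r]; and in
    each of the six ranges of the exponents there is an explicit [tau r] such that
    [area(tau r)] is comparable with [r * tau r `^ (- gm)], where only the upper
    bound holds if [d = 2] and [dp = 0].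

    For the first fact, an absolutely continuous function is determined by its
    derivative almost everywhere ([ac_ae_derive0]), so on an interval where the
    Hamiltonian is constant the fundamental solution is multiplied by an explicit
    shear; the monodromy matrix is the limit of the products of these shears
    ([fundamental_solution_node], [op_norm_monodromy_le]). The products are
    estimated in the norms [frame_norm a B]: the first coordinate is taken along
    the direction of angle [a], the second one across it, and the second has
    weight [B]. A shear of length [len] and angle [p] multiplies such a norm by at
    most [1 + 2 |z| len (B sin^2 (p - a) + 1 / B)]; turning the frame costs a
    factor [1 + B |sin|] if [1 <= B]. Three choices of frames are used one after
    another.
    Up to the index where [j `^ (dl - dp)] reaches [r], the frame follows the
    angle [phi j] with the weight that balances both costs, so that a factor costs
    the logarithm of [1 + O(sqrt r * j `^ (- (d / 2)))] ([head_bound]). Then a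
    fixed frame of weight [1] costs [r * l j] per factor ([middle_bound]). In the
    tail a fixed frame at [psi], with weight [N `^ ((gp - gl) / 2)], costs
    [O(r * N `^ (- gm))] altogether ([tail_bound]). The costs per factor are
    bounded by multiples of [g(j, r)] ([near_step_cost], [far_step_cost]), and
    since [g] is nearly decreasing in [t], sums of its values are bounded by its
    integral ([log_max_modulus_le]).

    For the second fact, [g] has a closed form with a logarithmic, a middle and a
    far regime ([growth_density]), and [g(t, r)] never exceeds the value
    [c * sqrt r * t `^ (- (d / 2))] of the middle regime. Bounds for its integral
    follow by comparison with powers, the dominant regime depending on the
    exponents ([area_upper_log] to [area_lower_far]).

    Since the area increases with [t] and [r * c * t `^ (- gm)] decreases, the
    upper bound for [area(tau r)] puts the point [T(r)] where they agree beyond a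
    multiple of [tau r], and the lower bound puts it before one
    ([balance_point_lower], [balance_point_upper]). By the first fact, the upper
    bound also gives [log M(r) = O(r * tau r `^ (- gm))], which is the claimed
    growth and bounds the order ([conclusions]). *)

(** * Absolutely continuous functions with prescribed derivative *)

Section AbsolutelyContinuous.
Context {R : realType}.
Implicit Types (a b c d e k m x y : R) (f g : R -> R) (U : set R) (s : seq (R * R)).
Local Notation mu := (@lebesgue_measure R).

(** The list runs from right to left, so that the intervals of the tail lie to
    the left of the head and a new interval can be pushed on the right. *)
Fixpoint packed U a x s : Prop :=
  if s is p :: s' then
    [/\ p.1 <= p.2 <= x, `[p.1, p.2]%classic `<=` U, a <= p.1 & packed U a p.1 s']
  else True.

Lemma packedW U a x y s : x <= y -> packed U a x s -> packed U a y s.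
Proof.
case: s => //= p s xy [/andP[p12 p2x] pU ap ps]; split => //.
by rewrite p12 (le_trans p2x).
Qed.

Lemma packed_mem U a x s p : packed U a x s -> p \in s ->
  [/\ a <= p.1, p.1 <= p.2 & p.2 <= x].
Proof.
elim: s x => //= q s IH x [/andP[q12 q2x] qU aq qs].
rewrite inE => /predU1P[->//|/(IH _ qs)[ap p12 p2q]]; split => //.
by rewrite (le_trans p2q)// (le_trans q12).
Qed.

Lemma packed_length U a x s : open U -> packed U a x s ->
  ((\sum_(p <- s) (p.2 - p.1))%:E <= mu (U `&` `]-oo, x]))%E.
Proof.
move=> oU; have mU : measurable U by exact: open_measurable.
elim: s x => [|p s IH] x /=; first by rewrite big_nil.
move=> [/andP[p12 p2x] pU ap ps]; rewrite big_cons EFinD addeC.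
apply: (@le_trans _ _ (mu ((U `&` `]-oo, p.1]) `|` `]p.1, p.2]))); last first.
  apply: le_measure; rewrite ?inE.
  - by apply: measurableU => //; apply: measurableI.
  - exact: measurableI.
  move=> t [[Ut]|]; rewrite /= in_itv/=.
    by move=> tp; split; rewrite //= in_itv/= (le_trans tp)// (le_trans p12).
  move=> /andP[pt tp]; split; last by rewrite /= in_itv/= (le_trans tp).
  by apply: pU; rewrite /= in_itv/= tp ltW.
rewrite measureU//; first last.
- rewrite -subset0 => t [[_]] /=; rewrite !in_itv/= => tp /andP[pt _].
  by move: (lt_le_trans pt tp); rewrite ltxx.
- exact: measurableI.
apply: leeD; first exact: IH.
rewrite [leRHS](lebesgue_measure_itv `]p.1, p.2])/= lte_fin.
by case: ltP => // p21; rewrite lee_fin subr_le0.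
Qed.

Lemma packed_trivIset U a x s : packed U a x s ->
  trivIset setT (fun i : 'I_(size s) =>
    `](nth (0, 0) s i).1, (nth (0, 0) s i).2[%classic).
Proof.
move=> ps; apply/trivIsetP => i j _ _; wlog ij : i j / (i < j)%N.
  move=> H ij; move: (ij); rewrite -val_eqE /= neq_ltn => /orP[]?; first exact: H.
  by rewrite setIC; apply: H => //; rewrite eq_sym.
move=> _; rewrite -subset0 => t [] /=; rewrite !in_itv/= => /andP[t1 _] /andP[_ t2].
suff H : forall m n : nat, (m < n < size s)%N -> (nth (0, 0) s n).2 <= (nth (0, 0) s m).1.
  have ijs : (i < j < size s)%N by rewrite ij ltn_ord.
  by move: (lt_trans t2 (le_lt_trans (H _ _ ijs) t1)); rewrite ltxx.
clear i j ij t t1 t2; elim: s x ps => [|p s IH] x /=; first by move=> _ m n; rewrite ltn0 andbF.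
move=> [/andP[p12 p2x] pU ap ps] [|m] [|n]//=; rewrite !ltnS; last exact: IH ps _ _.
by move=> ns; have [] := packed_mem ps (mem_nth (0, 0) ns).
Qed.

(** A packed list of intervals inside an open set of measure below [d] is an
    admissible family in the definition of absolute continuity. *)
Lemma packed_small U a b s f e d : open U -> (mu U < d%:E)%E ->
  (forall (n : nat) (u v : 'I_n -> R),
      (forall i, a <= u i <= v i /\ v i <= b) ->
      trivIset setT (fun i => `]u i, v i[%classic) ->
      \sum_(i < n) (v i - u i) < d ->
      \sum_(i < n) `|f (v i) - f (u i)| < e) ->
  packed U a b s -> \sum_(p <- s) `|f p.2 - f p.1| < e.
Proof.
move=> oU mUd ac ps; rewrite (big_nth (0, 0)) big_mkord.
apply: (ac _ (fun i => (nth (0, 0) s i).1) (fun i => (nth (0, 0) s i).2)).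
- by move=> i; have [-> -> ->] := packed_mem ps (mem_nth (0, 0) (ltn_ord i)).
- exact: packed_trivIset ps.
- rewrite -(big_mkord xpredT (fun i => (nth (0, 0) s i).2 - (nth (0, 0) s i).1)).
  rewrite -(big_nth (0, 0) xpredT (fun p => p.2 - p.1)) -lte_fin.
  apply: le_lt_trans (packed_length oU ps) _; apply: le_lt_trans mUd.
  by apply: le_measure; rewrite ?inE//; [apply: measurableI => //|]; exact: open_measurable.
Qed.

(** The supremum of the points where [P] holds satisfies [P] and, unless it is
    [b], can be passed. *)
Lemma real_induction (a b : R) (P : R -> Prop) : a <= b -> P a ->
  (forall c, a <= c <= b -> exists2 d, 0 < d &
     forall x y, a <= x -> x <= c -> c <= y -> y <= b -> c - d < x -> y < c + d -> P x -> P y) ->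
  P b.
Proof.
move=> ab Pa step; pose S := [set x | a <= x <= b /\ P x].
have hS : has_sup S.
  by split; [exists a; rewrite /S /= lexx ab|exists b => x [/andP[]]].
have [ac cb] : a <= sup S /\ sup S <= b.
  split; first by apply: ub_le_sup; [case: hS|rewrite /S /= lexx ab].
  by apply: ge_sup; [case: hS|move=> x [/andP[]]].
set c := sup S in ac cb.
have [|d d0 dP] := step c; first by rewrite ac cb.
have [x [/andP[ax xb] Px] cx] := sup_adherent d0 hS.
have xc : x <= c by apply: ub_le_sup; [case: hS|rewrite /S /= ax xb].
have [bc|cb'] := leP b (c + d / 2).
  by apply: (dP x b) => //; lra.
have : S (c + d / 2).
  split; first by apply/andP; split; lra.
  by apply: (dP x) => //; lra.
by move=> /(ub_le_sup (proj2 hS)); rewrite -/c; lra.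
Qed.

Lemma is_derive0_near f c e : 0 < e -> is_derive c 1 f 0 ->
  exists2 d, 0 < d & forall y, `|y - c| < d -> `|f y - f c| <= e * `|y - c|.
Proof.
move=> e0 [df f0].
have := df; rewrite /derivable => /cvg_ex[l hl].
have l0 : l = 0 by rewrite -f0 /derive; apply/esym/cvg_lim.
move: hl; rewrite l0 => /cvgrPdist_le/(_ e e0).
rewrite /dnbhs /within /= => /nbhs_ballP[d /= d0 dP].
exists d => // y yc; have [->|yc0] := eqVneq y c; first by rewrite !subrr normr0 mulr0.
have := dP (y - c); rewrite /ball /= sub0r normrN subr_eq0 => /(_ yc yc0).
rewrite scaler1 subrK sub0r normrN normrM normfV.
by rewrite -ler_pdivlMl ?invr_gt0 ?normr_gt0 ?subr_eq0// invrK mulrC.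
Qed.

(** Each point of differentiability is the tag of short intervals on which
    [f] varies by at most [e] times the length; the exceptional null set lies in
    an open set of small measure, where absolute continuity bounds the variation.
    Real induction pastes these intervals together, as in Cousin's lemma. *)
Lemma ac_ae_derive0 a b f : a <= b -> abs_continuous_on a b f ->
  {ae mu, forall t, a < t < b -> is_derive t 1 f 0} -> f b = f a.
Proof.
move=> ab fac [N [mN N0 sN]]; apply/eqP; rewrite -subr_eq0 -normr_le0.
apply/ler_addgt0Pr => e e0; rewrite add0r.
have [e1 e10 e1e] : exists2 e1, 0 < e1 & e1 * (b - a) + e1 <= e.
  exists (e / (1 + (b - a))); first by apply: divr_gt0 => //; lra.
  have h : e / (1 + (b - a)) * (1 + (b - a)) = e by rewrite divfK// gt_eqF//; lra.
  by rewrite -[leRHS]h [leRHS]mulrDr mulr1 addrC.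
have [d d0 dP] := fac _ e10.
pose N' := N `|` [set a] `|` [set b].
have mN' : measurable N' by do 2 apply: measurableU => //.
have N'0 : mu N' = 0%E.
  apply/negligibleP => //; apply: negligibleU; [apply: negligibleU|].
  - exact/negligibleP.
  - apply/negligibleP; [exact: measurable_set1|exact: lebesgue_measure_set1].
  - apply/negligibleP; [exact: measurable_set1|exact: lebesgue_measure_set1].
have N'y : (mu N' < +oo)%E by rewrite N'0.
have [U [oU N'U UN]] := lebesgue_regularity_outer mN' N'y d0.
have mU : measurable U by exact: open_measurable.
have mUd : (mu U < d%:E)%E.
  have -> : (mu U = mu N' + mu (U `\` N'))%E.
    by rewrite -measureU ?setDUK ?setDIK//; exact: measurableD.
  by rewrite N'0 add0e; exact: UN.
pose P x := exists2 s, packed U a x s &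
  `|f x - f a| <= e1 * (x - a) + \sum_(p <- s) `|f p.2 - f p.1|.
suff [s ps] : P b.
  move=> /le_trans; apply; apply: le_trans e1e; rewrite lerD2l ltW//.
  exact: packed_small mUd dP ps.
apply: (@real_induction a b P ab).
  by exists [::] => //; rewrite big_nil !subrr normr0 mulr0 addr0.
move=> c /andP[ac cb]; have [Uc|Uc] := pselect (U c).
  have [r /= r0 rU] : exists2 r : R, 0 < r & ball c r `<=` U.
    by apply/nbhs_ballP; exact: open_nbhs_nbhs.
  exists r => // x y ax xc cy yb cx yc [s ps fs].
  exists ((x, y) :: s).
    split => //=; first by rewrite (le_trans xc cy) lexx.
    move=> t /=; rewrite in_itv/= => /andP[xt ty]; apply: rU.
    by rewrite /ball /= ltr_norml; clear -xt ty cx yc; apply/andP; split; lra.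
  rewrite big_cons /=.
  have : `|f y - f a| <= `|f y - f x| + `|f x - f a|.
    by rewrite (le_trans _ (ler_normD _ _))// addrA subrK.
  have : e1 * (x - a) <= e1 * (y - a) by rewrite ler_pM2l//; lra.
  lra.
have acb : a < c < b.
  rewrite !lt_neqAle ac cb !andbT; apply/andP; split; apply/eqP => h; apply: Uc.
    by apply: N'U; left; right.
  by apply: N'U; right.
have dc : is_derive c 1 f 0.
  apply: contrapT => nd; apply: Uc; apply: N'U; left; left; apply: sN => /=.
  by move=> /(_ acb).
have [r r0 rP] := is_derive0_near e10 dc.
exists r => // x y ax xc cy yb cx yc [s ps fs].
exists s; first by apply: packedW ps; exact: le_trans xc cy.
have hy : `|f y - f c| <= e1 * (y - c).
  by have := rP y; rewrite ger0_norm ?subr_ge0//; apply; lra.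
have hx : `|f x - f c| <= e1 * (c - x).
  by have := rP x; rewrite distrC ger0_norm ?subr_ge0//; apply; lra.
have -> : f y - f a = (f y - f c) + ((f c - f x) + (f x - f a)) by ring.
apply: le_trans (ler_normD _ _) _; rewrite distrC in hx.
have := ler_normD (f c - f x) (f x - f a); clear -hx hy fs; lra.
Qed.

Lemma abs_continuous_onW a b c d f : a <= c -> d <= b ->
  abs_continuous_on a b f -> abs_continuous_on c d f.
Proof.
move=> ac db fac e e0; have [r r0 rP] := fac e e0; exists r => // n u v uv.
apply: rP => i; have [/andP[cu ->] vd] := uv i.
by rewrite (le_trans ac cu) (le_trans vd db).
Qed.

Lemma abs_continuous_lin a b f g k m :
  abs_continuous_on a b f -> abs_continuous_on a b g ->
  abs_continuous_on a b (fun t => k * f t + m * g t).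
Proof.
move=> fac gac e e0; pose e1 := e / (`|k| + `|m| + 1).
have h0 : 0 < `|k| + `|m| + 1 by rewrite ltr_wpDl// addr_ge0.
have e10 : 0 < e1 by rewrite divr_gt0.
have [df df0 dfP] := fac e1 e10; have [dg dg0 dgP] := gac e1 e10.
exists (Num.min df dg); first by rewrite lt_min df0.
move=> n u v uv tI; rewrite lt_min => /andP[/(dfP _ _ _ uv tI) hf /(dgP _ _ _ uv tI) hg].
apply: (@le_lt_trans _ _ (`|k| * \sum_(i < n) `|f (v i) - f (u i)|
    + `|m| * \sum_(i < n) `|g (v i) - g (u i)|)).
  rewrite !mulr_sumr -big_split /=; apply: ler_sum => i _.
  rewrite -!normrM; apply: le_trans (ler_normD _ _).
  by rewrite le_eqVlt; apply/orP; left; apply/eqP; congr (`| _ |); ring.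
have -> : e = `|k| * e1 + `|m| * e1 + e1.
  by rewrite -mulrDl -[X in _ + X]mul1r -mulrDl mulrC divfK// gt_eqF.
have := ler_wpM2l (normr_ge0 k) (ltW hf); have := ler_wpM2l (normr_ge0 m) (ltW hg).
lra.
Qed.

Lemma abs_continuous_id a b : abs_continuous_on a b (fun t : R => t).
Proof.
move=> e e0; exists e => // n u v uv _ h; apply: le_lt_trans h.
apply: ler_sum => i _; have [/andP[_ uvi] _] := uv i.
by rewrite ger0_norm// subr_ge0.
Qed.

Lemma ac_ae_derive_cst a b f m : a <= b -> abs_continuous_on a b f ->
  {ae mu, forall t, a < t < b -> is_derive t 1 f m} -> f b = f a + m * (b - a).
Proof.
move=> ab fac fd.
have := @ac_ae_derive0 a b (fun t => 1 * f t + (- m) * t) ab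
  (abs_continuous_lin 1 (- m) fac (@abs_continuous_id a b)).
rewrite !mul1r => H; suff : f b + - m * b = f a + - m * a by lra.
apply: H; apply: negligibleS fd => t; apply: contra_not => H /H {}H.
have -> : (fun t => 1 * f t + - m * t) = (1 \*: f) + ((- m) \*: (@id R)).
  by apply/funext.
have -> : 0 = 1 *: m + - m *: (1 : R) by rewrite scale1r /GRing.scale /= mulr1 subrr.
exact: (is_deriveD (is_deriveZ 1 H) (is_deriveZ (- m) (is_derive_id t 1))).
Qed.

End AbsolutelyContinuous.

Section ScalarComplexFunctions.
Context {R : realType}.
Local Notation C := R[i].
Local Notation mu := (@lebesgue_measure R).
Local Notation "x %:C" := (real_complex R x) (format "x %:C") : ring_scope.
Implicit Types (a b t k m : R) (v w : R -> C) (d e z : C).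

Definition complex_ac a b w :=
  abs_continuous_on a b (fun t => complex.Re (w t)) /\
  abs_continuous_on a b (fun t => complex.Im (w t)).

Definition complex_is_derive t w d :=
  is_derive t 1 (fun s => complex.Re (w s)) (complex.Re d) /\
  is_derive t 1 (fun s => complex.Im (w s)) (complex.Im d).

Lemma Re_lin k m d e :
  complex.Re (k%:C * d + m%:C * e) = k * complex.Re d + m * complex.Re e.
Proof. by case: d e => [? ?] [? ?]; simpc. Qed.

Lemma Im_lin k m d e :
  complex.Im (k%:C * d + m%:C * e) = k * complex.Im d + m * complex.Im e.
Proof. by case: d e => [? ?] [? ?]; simpc. Qed.

Lemma complex_ac_lin a b v w k m : complex_ac a b v -> complex_ac a b w ->
  complex_ac a b (fun t => k%:C * v t + m%:C * w t).
Proof.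
move=> [rv iv] [rw iw]; split.
  have := abs_continuous_lin k m rv rw; congr abs_continuous_on.
  by apply/funext => t; rewrite Re_lin.
have := abs_continuous_lin k m iv iw; congr abs_continuous_on.
by apply/funext => t; rewrite Im_lin.
Qed.

Lemma is_derive_lin t (f g : R -> R) k m (p q : R) :
  is_derive t 1 f p -> is_derive t 1 g q ->
  is_derive t 1 (fun s => k * f s + m * g s) (k * p + m * q).
Proof.
move=> df dg; have -> : (fun s => k * f s + m * g s) = (k \*: f) + (m \*: g).
  by apply/funext.
exact: (is_deriveD (is_deriveZ k df) (is_deriveZ m dg)).
Qed.

Lemma complex_is_derive_lin t v w d e k m :
  complex_is_derive t v d -> complex_is_derive t w e ->
  complex_is_derive t (fun t => k%:C * v t + m%:C * w t) (k%:C * d + m%:C * e).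
Proof.
move=> [rv iv] [rw iw]; split.
  rewrite Re_lin; have -> : (fun s => complex.Re (k%:C * v s + m%:C * w s)) =
    (fun s => k * complex.Re (v s) + m * complex.Re (w s)).
    by apply/funext => s; rewrite Re_lin.
  exact: is_derive_lin.
rewrite Im_lin; have -> : (fun s => complex.Im (k%:C * v s + m%:C * w s)) =
  (fun s => k * complex.Im (v s) + m * complex.Im (w s)).
  by apply/funext => s; rewrite Im_lin.
exact: is_derive_lin.
Qed.

Lemma complex_ac_derive_cst a b w d : a <= b -> complex_ac a b w ->
  {ae mu, forall t, a < t < b -> complex_is_derive t w d} ->
  w b = w a + (b - a)%:C * d.
Proof.
move=> ab [rw iw] dw.
have hr : complex.Re (w b) = complex.Re (w a) + complex.Re d * (b - a).
  apply: (@ac_ae_derive_cst _ a b (fun t => complex.Re (w t))) => //.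
  by apply: negligibleS dw => t /=; apply: contra_not => H /H [].
have hi : complex.Im (w b) = complex.Im (w a) + complex.Im d * (b - a).
  apply: (@ac_ae_derive_cst _ a b (fun t => complex.Im (w t))) => //.
  by apply: negligibleS dw => t /=; apply: contra_not => H /H [].
move: hr hi; case: (w b) (w a) d {dw} => [? ?] [? ?] [? ?] /= -> ->.
by simpc; congr Complex; ring.
Qed.

(** On an interval where the Hamiltonian has the constant angle [a], the
    component of the row [(w0, w1)] along [xi a] is constant, so that the system
    integrates explicitly. *)
Lemma constant_angle_system (s t a : R) z (w0 w1 : R -> C) : s <= t ->
  complex_ac s t w0 -> complex_ac s t w1 ->
  let kappa u := (cos a)%:C * w0 u + (sin a)%:C * w1 u in
  {ae mu, forall u, s < u < t ->
    complex_is_derive u w1 (z * kappa u * (cos a)%:C) /\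
    complex_is_derive u w0 (- (z * kappa u * (sin a)%:C))} ->
  w0 t = w0 s - z * (t - s)%:C * kappa s * (sin a)%:C /\
  w1 t = w1 s + z * (t - s)%:C * kappa s * (cos a)%:C.
Proof.
move=> st ac0 ac1 kappa dw.
have ack : complex_ac s t kappa by exact: complex_ac_lin.
have kE u : s <= u <= t -> kappa u = kappa s.
  move=> /andP[su ut]; rewrite (@complex_ac_derive_cst s u kappa 0)//.
  - by rewrite mulr0 addr0.
  - by case: ack => h1 h2; split; apply: abs_continuous_onW (lexx _) ut _.
  apply: negligibleS dw => x /=; apply: contra_not => H /andP[sx xu].
  have [|d1 d0] := H; first by rewrite sx (lt_le_trans xu).
  have := complex_is_derive_lin (cos a) (sin a) d0 d1.
  by congr complex_is_derive; ring.
split.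
  rewrite (@complex_ac_derive_cst s t w0 (- (z * kappa s * (sin a)%:C)))//; first ring.
  apply: negligibleS dw => x /=; apply: contra_not => H sxt.
  have [d1 d0] := H sxt; rewrite -(kE x)//.
  by move: sxt => /andP[/ltW -> /ltW ->].
rewrite (@complex_ac_derive_cst s t w1 (z * kappa s * (cos a)%:C))//; first ring.
apply: negligibleS dw => x /=; apply: contra_not => H sxt.
have [d1 d0] := H sxt; rewrite -(kE x)//.
by move: sxt => /andP[/ltW -> /ltW ->].
Qed.

End ScalarComplexFunctions.

(** * The monodromy matrix as a limit of products *)

Section Nodes.
Context {R : realType}.
Variable l : nat -> R.
Hypothesis l_gt0 : forall j : nat, posnat j -> 0 < l j.
Hypothesis l_summable : (\sum_(1 <= j <oo) (l j)%:E < +oo)%E.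

Lemma node0 : node l 0 = 0.
Proof. by rewrite /node big_geq. Qed.

Lemma nodeS n : node l n.+1 = node l n + l n.+1.
Proof. by rewrite /node big_nat_recr. Qed.

Lemma node_lt : {homo node l : m n / (m < n)%N >-> m < n}.
Proof. by apply: homo_ltn => [|n]; [exact: lt_trans|rewrite nodeS ltrDl l_gt0]. Qed.

Lemma node_le m n : (m <= n)%N -> node l m <= node l n.
Proof. by rewrite leq_eqVlt => /predU1P[->//|/node_lt/ltW]. Qed.

Lemma node_ge0 n : 0 <= node l n.
Proof. by rewrite -node0 node_le. Qed.

Let l_ge0 j : (1 <= j)%N -> xpredT j -> (0 <= (l j)%:E)%E.
Proof. by move=> j1 _; rewrite lee_fin ltW// l_gt0. Qed.

Lemma total_lengthE : (total_length l)%:E = (\sum_(1 <= j <oo) (l j)%:E)%E.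
Proof. by rewrite /total_length fineK// ge0_fin_numE// nneseries_ge0. Qed.

Lemma node_le_total n : node l n <= total_length l.
Proof. by rewrite -lee_fin total_lengthE /node -sumEFin nneseries_lim_ge. Qed.

Lemma node_approx e : 0 < e -> exists n, total_length l - e < node l n.
Proof.
move=> e0; apply: contrapT => /forallNP H.
have : (\sum_(1 <= j <oo) (l j)%:E <= (total_length l - e)%:E)%E.
  apply: lime_le; first exact: is_cvg_nneseries.
  near=> n; rewrite -(@prednK n); last by near: n; exists 1%N.
  by rewrite sumEFin lee_fin leNgt; apply/negP; exact: H.
by rewrite -total_lengthE lee_fin; lra.
Unshelve. all: by end_near. Qed.

Lemma interval_indexE n t : node l n < t < node l n.+1 -> interval_index l t = n.+1.
Proof.
move=> /andP[nt tn]; apply: xget_unique; first by split => //=; rewrite (ltW nt).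
move=> j [j0 /andP[h1 h2]]; apply/eqP; rewrite eqn_leq -ltnS; apply/andP; split.
  rewrite ltnNge; apply/negP => nj; have : node l n.+1 <= node l j.-1.
    by apply: node_le; rewrite -ltnS prednK.
  by move=> h; move: (lt_le_trans tn (le_trans h h1)); rewrite ltxx.
rewrite ltnNge; apply/negP => /node_le h.
by move: (lt_trans nt (lt_le_trans h2 h)); rewrite ltxx.
Qed.

End Nodes.

Section ComplexPairs.
Context {R : realType}.
Local Notation C := R[i].
Local Notation "x %:C" := (real_complex R x) (format "x %:C") : ring_scope.
Local Notation normc := (@Normc.normc R).
Implicit Types (x y z : C) (v w : 'cV[C]_2).

Lemma normc_ge0 z : 0 <= normc z.
Proof. by case: z => a b; exact: sqrtr_ge0. Qed.

Lemma normc_real (k : R) : normc k%:C = `|k|.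
Proof. by rewrite /Normc.normc /= expr0n addr0 sqrtr_sqr. Qed.

Lemma normc_le_ReIm z : normc z <= `|complex.Re z| + `|complex.Im z|.
Proof.
case: z => a b /=; rewrite -[leRHS]ger0_norm ?addr_ge0// -sqrtr_sqr ler_wsqrtr//.
by rewrite sqrrD !real_normK ?num_real// -addrA lerD2l lerDr mulrn_wge0 ?mulr_ge0.
Qed.

Lemma mulmx_col2 (A : 'M[C]_2) v i : (A *m v) i 0 = A i 0 * v 0 0 + A i 1 * v 1 0.
Proof. by rewrite mxE big_ord_recl big_ord1; congr (_ * v _ _ + A _ _ * v _ _); exact/val_inj. Qed.

Lemma mulmx22 (A B : 'M[C]_2) i j : (A *m B) i j = A i 0 * B 0 j + A i 1 * B 1 j.
Proof. by rewrite mxE big_ord_recl big_ord1; congr (_ * B _ _ + A _ _ * B _ _); exact/val_inj. Qed.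

Definition sum_norm v : R := normc (v 0 0) + normc (v 1 0).

Lemma sum_norm_ge0 v : 0 <= sum_norm v.
Proof. by rewrite addr_ge0 ?normc_ge0. Qed.

Lemma sum_normD v w : sum_norm (v + w) <= sum_norm v + sum_norm w.
Proof.
rewrite /sum_norm !mxE.
have := le_normcD (v 0 0) (w 0 0); have := le_normcD (v 1 0) (w 1 0); lra.
Qed.

Lemma cV_normE v : cV_norm v = Num.sqrt (normc (v 0 0) ^+ 2 + normc (v 1 0) ^+ 2).
Proof.
by rewrite /cV_norm big_ord_recl big_ord1; congr (Num.sqrt (_ + normc (v _ _) ^+ 2)); exact/val_inj.
Qed.

Lemma cV_norm_le_sum v : cV_norm v <= sum_norm v.
Proof.
rewrite cV_normE -[leRHS]ger0_norm ?sum_norm_ge0// -sqrtr_sqr ler_wsqrtr//.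
rewrite sqrrD -addrA lerD2l lerDr mulrn_wge0 ?mulr_ge0 ?normc_ge0//.
Qed.

Lemma sum_le_cV_norm v : sum_norm v <= 2 * cV_norm v.
Proof.
have h0 : normc (v 0 0) <= cV_norm v.
  by rewrite cV_normE -[leLHS]ger0_norm ?normc_ge0// -sqrtr_sqr ler_wsqrtr// lerDl sqr_ge0.
have h1 : normc (v 1 0) <= cV_norm v.
  by rewrite cV_normE -[leLHS]ger0_norm ?normc_ge0// -sqrtr_sqr ler_wsqrtr// lerDr sqr_ge0.
by rewrite /sum_norm; lra.
Qed.

Lemma op_norm_le (A : 'M[C]_2) K : 0 <= K ->
  (forall v, sum_norm (A *m v) <= K * sum_norm v) -> op_norm A <= 2 * K.
Proof.
move=> K0 AK; apply: ge_sup.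
  exists (cV_norm (A *m 0)); exists 0 => //=.
  by rewrite cV_normE !mxE Normc.normc0 expr0n/= addr0 sqrtr0 ler01.
move=> _ [v /= v1 <-]; apply: le_trans (cV_norm_le_sum _) _; apply: le_trans (AK v) _.
rewrite mulrC; apply: ler_wpM2r => //; have := sum_le_cV_norm v; lra.
Qed.

End ComplexPairs.

Section Monodromy.
Context {R : realType}.
Local Notation C := R[i].
Local Notation "x %:C" := (real_complex R x) (format "x %:C") : ring_scope.
Implicit Types (z : C) (v w : 'cV[C]_2) (a len : R).

(** The exponential of the nilpotent matrix [- z * len * xi a * (xi a)^T * J]. *)
Definition transfer z len a : 'M[C]_2 :=
  \matrix_(i < 2, j < 2) ((i == j)%:R + z * len%:C *
    (if i == 0 then cos a else sin a)%:C * (if j == 0 then - sin a else cos a)%:C).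

Fixpoint transfer_prod z (l phi : nat -> R) (n : nat) : 'M[C]_2 :=
  if n is m.+1 then transfer_prod z l phi m *m transfer z (l n) (phi n) else 1%:M.

Lemma J_col0 (A : 'M[C]_2) i : (A *m Jmx) i 0 = A i 1.
Proof. by rewrite mulmx22 !mxE /= mulr0 add0r mulr1. Qed.

Lemma J_col1 (A : 'M[C]_2) i : (A *m Jmx) i 1 = - A i 0.
Proof. by rewrite mulmx22 !mxE /= mulr0 addr0 mulrN mulr1. Qed.

Variables (l phi : nat -> R).
Hypothesis l_gt0 : forall j : nat, posnat j -> 0 < l j.
Hypothesis l_summable : (\sum_(1 <= j <oo) (l j)%:E < +oo)%E.
Variable (W : R -> C -> 'M[C]_2).
Hypothesis W_sol : fundamental_solution (hamburger l phi) (total_length l) W.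

(** On each interval the rows of the solution obey a system with constant angle,
    whose explicit solution is right multiplication by a transfer matrix. *)
Lemma fundamental_solution_node z n : W (node l n) z = transfer_prod z l phi n.
Proof.
have [Wac W0 dW] := W_sol z.
elim: n => [|n IH]; first by rewrite node0 W0.
rewrite /= -IH; set a := phi n.+1.
have nn : node l n <= node l n.+1 by rewrite node_le.
have ac i k : complex_ac (node l n) (node l n.+1) (fun t => W t z i k).
  have [h1 h2] := Wac i k.
  by split; apply: abs_continuous_onW (node_ge0 l_gt0 _) (node_le_total l_gt0 l_summable _) _.
have step i : W (node l n.+1) z i 0 = W (node l n) z i 0 - z * (l n.+1)%:C *
      ((cos a)%:C * W (node l n) z i 0 + (sin a)%:C * W (node l n) z i 1) * (sin a)%:C /\
    W (node l n.+1) z i 1 = W (node l n) z i 1 + z * (l n.+1)%:C *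
      ((cos a)%:C * W (node l n) z i 0 + (sin a)%:C * W (node l n) z i 1) * (cos a)%:C.
  have -> : l n.+1 = node l n.+1 - node l n by rewrite nodeS addrAC subrr add0r.
  apply: (@constant_angle_system _ _ _ a z (fun t => W t z i 0) (fun t => W t z i 1)) => //.
  apply: negligibleS dW => t /=; apply: contra_not => H nt.
  have tL : 0 < t < total_length l.
    case/andP: nt => h1 h2; rewrite (le_lt_trans (node_ge0 l_gt0 n) h1).
    by rewrite (lt_le_trans h2)// node_le_total.
  have HE k : (z *: (W t z *m map_mx (real_complex R) (hamburger l phi t))) i k =
    z * ((cos a)%:C * W t z i 0 + (sin a)%:C * W t z i 1) * (if k == 0 then cos a else sin a)%:C.
    rewrite /hamburger (interval_indexE l_gt0 nt) -/a mxE mulmx22 !mxE !big_ord1 !mxE /=.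
    by rewrite !rmorphM /=; ring.
  split.
    have [] := H tL i 0; rewrite HE eqxx => hr hi; split.
      by move: hr; congr is_derive; apply/funext => s; rewrite J_col0.
    by move: hi; congr is_derive; apply/funext => s; rewrite J_col0.
  have [] := H tL i 1; rewrite HE => hr hi; split.
    move: (is_deriveN hr); rewrite -raddfN; congr is_derive; apply/funext => s /=.
    by rewrite opprfctE J_col1 raddfN opprK.
  move: (is_deriveN hi); rewrite -raddfN; congr is_derive; apply/funext => s /=.
  by rewrite opprfctE J_col1 raddfN opprK.
apply/matrixP => i k; rewrite mulmx22 !mxE.
have [h0 h1] := step i.
have [->|->] : k = 0 \/ k = 1.
- by case: k => -[|[|//]] hk; [left|right]; exact/val_inj.
- by rewrite h0 /= rmorphN /= -/a; ring.
by rewrite h1 /= -/a; ring.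
Qed.

Lemma abs_continuous_left b (f : R -> R) e : abs_continuous_on 0 b f -> 0 < e ->
  exists2 d, 0 < d & forall t, 0 <= t <= b -> b - d < t -> `|f b - f t| < e.
Proof.
move=> fac e0; have [d d0 dP] := fac e e0; exists d => // t tb bt.
have := dP 1%N (fun=> t) (fun=> b); rewrite !big_ord1; apply => //.
- by move=> i j _ _ _; rewrite (ord1 i) (ord1 j).
- by lra.
Qed.

Lemma fundamental_solution_left z i k e : 0 < e ->
  exists2 d, 0 < d & forall n, total_length l - d < node l n ->
    Normc.normc ((W (total_length l) z - W (node l n) z) i k) <= e.
Proof.
move=> e0; have [/(_ i k)[hr hi] _ _] := W_sol z.
have e2 : 0 < e / 2 by lra.
have [d d0 dP] := abs_continuous_left hr e2.
have [d' d'0 d'P] := abs_continuous_left hi e2.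
exists (Num.min d d'); first by rewrite lt_min d0.
move=> n dn; apply: le_trans (normc_le_ReIm _) _; rewrite !mxE !raddfB /=.
have nl : 0 <= node l n <= total_length l by rewrite (node_ge0 l_gt0) node_le_total.
have m1 : Num.min d d' <= d by rewrite ge_min lexx.
have m2 : Num.min d d' <= d' by rewrite ge_min lexx orbT.
have h1 := dP _ nl; have h2 := d'P _ nl.
have : `|complex.Re (W (total_length l) z i k) - complex.Re (W (node l n) z i k)| < e / 2.
  by apply: h1; lra.
have : `|complex.Im (W (total_length l) z i k) - complex.Im (W (node l n) z i k)| < e / 2.
  by apply: h2; lra.
lra.
Qed.

(** Absolute continuity makes the solution left-continuous at the right end, so
    a bound for all long products passes to the monodromy matrix. *)
Lemma op_norm_monodromy_le z K N : 0 <= K ->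
  (forall n v, (N <= n)%N -> sum_norm (transfer_prod z l phi n *m v) <= K * sum_norm v) ->
  op_norm (W (total_length l) z) <= 2 * K.
Proof.
move=> K0 PK; apply: op_norm_le => // v; apply/ler_addgt0Pr => e e0.
have s0 := sum_norm_ge0 v; set s := sum_norm v in s0 *.
pose e1 := e / (4 * (s + 1)).
have e10 : 0 < e1 by rewrite divr_gt0//; lra.
have e1e : e1 * (4 * (s + 1)) = e by rewrite divfK// gt_eqF//; lra.
have [d0 d00 P0] := fundamental_solution_left z 0 0 e10.
have [d1 d10 P1] := fundamental_solution_left z 0 1 e10.
have [d2 d20 P2] := fundamental_solution_left z 1 0 e10.
have [d3 d30 P3] := fundamental_solution_left z 1 1 e10.
pose d := Num.min (Num.min d0 d1) (Num.min d2 d3).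
have dpos : 0 < d by rewrite !lt_min d00 d10 d20.
have [n0 n0d] := node_approx l_gt0 l_summable dpos.
pose n := maxn n0 N; have nd := lt_le_trans n0d (node_le l_gt0 (leq_maxl n0 N)).
have dle : [/\ d <= d0, d <= d1, d <= d2 & d <= d3].
  by rewrite /d !ge_min !lexx !orbT.
case: dle => le0 le1 le2 le3.
have {}P0 := P0 n (le_lt_trans (lerB (lexx _) le0) nd).
have {}P1 := P1 n (le_lt_trans (lerB (lexx _) le1) nd).
have {}P2 := P2 n (le_lt_trans (lerB (lexx _) le2) nd).
have {}P3 := P3 n (le_lt_trans (lerB (lexx _) le3) nd).
rewrite -/n in P0 P1 P2 P3; set D := W (total_length l) z - W (node l n) z in P0 P1 P2 P3.
have -> : W (total_length l) z *m v = transfer_prod z l phi n *m v + D *m v.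
  by rewrite -mulmxDl /D -fundamental_solution_node addrC subrK.
apply: le_trans (sum_normD _ _) _; apply: lerD; first by apply: PK; exact: leq_maxr.
have hD i : Normc.normc ((D *m v) i 0) <= Normc.normc (D i 0) * Normc.normc (v 0 0)
    + Normc.normc (D i 1) * Normc.normc (v 1 0).
  by rewrite mulmx_col2; apply: le_trans (le_normcD _ _) _; rewrite !Normc.normcM.
have := hD 0; have := hD 1; rewrite /sum_norm.
have v0 := normc_ge0 (v 0 0); have v1 := normc_ge0 (v 1 0).
have sE : s = Normc.normc (v 0 0) + Normc.normc (v 1 0) by [].
have := ler_wpM2r v0 P0; have := ler_wpM2r v1 P1.
have := ler_wpM2r v0 P2; have := ler_wpM2r v1 P3.
nra.
Qed.

End Monodromy.

(** * Weighted frames *)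

Section Frames.
Context {R : realType}.
Local Notation C := R[i].
Local Notation "x %:C" := (real_complex R x) (format "x %:C") : ring_scope.
Local Notation normc := (@Normc.normc R).
Implicit Types (a b p B len : R) (z : C) (v w : 'cV[C]_2).

(** Coordinates in the orthonormal frame [xi a], [xi (a + pi / 2)]: a transfer
    matrix with angle [a] adds a multiple of the second one to the first. *)
Definition along a v : C := (cos a)%:C * v 0 0 + (sin a)%:C * v 1 0.
Definition across a v : C := - (sin a)%:C * v 0 0 + (cos a)%:C * v 1 0.

(** A large weight [B] makes the shears with angle [a] cheap and rotations of
    the frame expensive. *)
Definition frame_norm a B v : R := normc (along a v) + B * normc (across a v).

Lemma frame_norm_ge0 a B v : 0 <= B -> 0 <= frame_norm a B v.
Proof. by move=> B0; rewrite addr_ge0 ?mulr_ge0 ?normc_ge0. Qed.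

Lemma cos2Dsin2C a : (cos a)%:C * (cos a)%:C + (sin a)%:C * (sin a)%:C = 1 :> C.
Proof. by rewrite -!rmorphM -rmorphD -!expr2 cos2Dsin2. Qed.

Lemma along_rot a b v : along a v =
  (cos (b - a))%:C * along b v - (sin (b - a))%:C * across b v.
Proof.
rewrite /along /across cosB sinB !rmorphD !rmorphN !rmorphM /=.
rewrite -[LHS]mulr1 -(cos2Dsin2C b); ring.
Qed.

Lemma across_rot a b v : across a v =
  (sin (b - a))%:C * along b v + (cos (b - a))%:C * across b v.
Proof.
rewrite /along /across cosB sinB !rmorphD !rmorphN !rmorphM /=.
rewrite -[LHS]mulr1 -(cos2Dsin2C b); ring.
Qed.

Lemma along_transfer z len p a v : along a (transfer z len p *m v) =
  along a v + z * (len * cos (p - a))%:C * across p v.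
Proof.
rewrite /along /across !mulmx_col2 !mxE /= cosB !rmorphM !rmorphD !rmorphN !rmorphM /=.
by ring.
Qed.

Lemma across_transfer z len p a v : across a (transfer z len p *m v) =
  across a v + z * (len * sin (p - a))%:C * across p v.
Proof.
rewrite /along /across !mulmx_col2 !mxE /= sinB !rmorphM !rmorphD !rmorphN !rmorphM /=.
by ring.
Qed.

(** The shear adds to the coordinates multiples of the component across [xi p],
    and [(|cos| + B |sin|) ^ 2 <= 2 (cos ^ 2 + (B sin) ^ 2)]. *)
Lemma frame_norm_transfer z len p a B v : 0 < B -> 0 <= len ->
  frame_norm a B (transfer z len p *m v) <=
  (1 + 2 * normc z * len * (B * sin (p - a) ^+ 2 + B^-1)) * frame_norm a B v.
Proof.
move=> B0 len0; rewrite /frame_norm along_transfer across_transfer.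
have -> : across p v = (cos (p - a))%:C * across a v - (sin (p - a))%:C * along a v.
  by rewrite (across_rot p a) -(opprB p a) sinN cosN rmorphN mulNr addrC.
set c := cos (p - a); set s := sin (p - a).
have cs : c ^+ 2 + s ^+ 2 = 1 by rewrite cos2Dsin2.
set x := along a v; set y := across a v; set g := _ - _.
have x0 := normc_ge0 x; have y0 := normc_ge0 y; have z0 := normc_ge0 z.
have g0 := normc_ge0 g.
have hg : normc g <= `|c| * normc y + `|s| * normc x.
  by apply: le_trans (le_normcD _ _) _; rewrite normcN !Normc.normcM !normc_real.
have h1 : normc (x + z * (len * c)%:C * g) <= normc x + normc z * len * `|c| * normc g.
  apply: le_trans (le_normcD _ _) _; rewrite !Normc.normcM normc_real normrM.
  by rewrite (ger0_norm len0) mulrA.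
have h2 : normc (y + z * (len * s)%:C * g) <= normc y + normc z * len * `|s| * normc g.
  apply: le_trans (le_normcD _ _) _; rewrite !Normc.normcM normc_real normrM.
  by rewrite (ger0_norm len0) mulrA.
have c2 : `|c| ^+ 2 = c ^+ 2 by rewrite real_normK ?num_real.
have s2 : `|s| ^+ 2 = s ^+ 2 by rewrite real_normK ?num_real.
have c0 := normr_ge0 c; have s0 := normr_ge0 s.
have BV : B * B^-1 = 1 by rewrite mulfV// gt_eqF.
have Bi : 0 < B^-1 by rewrite invr_gt0.
move: (B^-1) BV Bi => w BV w0.
pose k := 2 * (B * s ^+ 2 + w).
have sq : 0 <= (B * `|s| - `|c|) ^+ 2 by exact: sqr_ge0.
have Bk : B * k = 2 * (B ^+ 2 * s ^+ 2 + 1) by move: BV; rewrite /k; lra.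
have s2' := sqr_ge0 s; have Bs2 : 0 <= B ^+ 2 * s ^+ 2 by rewrite mulr_ge0 ?sqr_ge0.
have k2 : (`|c| + B * `|s|) * `|c| <= B * k by rewrite Bk -s2; nra.
have k1 : (`|c| + B * `|s|) * `|s| <= k.
  have -> : (`|c| + B * `|s|) * `|s| = w * (B * ((`|c| + B * `|s|) * `|s|)).
    by rewrite mulrA [w * B]mulrC BV mul1r.
  have -> : k = w * (B * k) by rewrite mulrA [w * B]mulrC BV mul1r.
  rewrite ler_pM2l// Bk -s2; nra.
have hk : (`|c| + B * `|s|) * normc g <= k * (normc x + B * normc y).
  apply: le_trans (ler_wpM2l _ hg) _; first by rewrite addr_ge0// mulr_ge0// ltW.
  have := ler_wpM2r y0 k2; have := ler_wpM2r x0 k1; clear; lra.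
have zl : 0 <= normc z * len by rewrite mulr_ge0.
have := ler_wpM2l zl hk; have := ler_wpM2l (ltW B0) h2; rewrite /k; clear -h1; lra.
Qed.

Lemma frame_norm_rot a b B v : 1 <= B ->
  frame_norm a B v <= (1 + B * `|sin (b - a)|) * frame_norm b B v.
Proof.
move=> B1; rewrite /frame_norm (along_rot a b) (across_rot a b).
set c := cos _; set s := sin _; set x := along b v; set y := across b v.
have x0 := normc_ge0 x; have y0 := normc_ge0 y.
have c1 : `|c| <= 1 by rewrite ler_norml cos_geN1 cos_le1.
have s0 := normr_ge0 s.
have h1 : normc (c%:C * x - s%:C * y) <= `|c| * normc x + `|s| * normc y.
  by apply: le_trans (le_normcD _ _) _; rewrite normcN !Normc.normcM !normc_real.
have h2 : normc (s%:C * x + c%:C * y) <= `|s| * normc x + `|c| * normc y.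
  by apply: le_trans (le_normcD _ _) _; rewrite !Normc.normcM !normc_real.
have B0 : 0 <= B by lra.
have cx := ler_wpM2r x0 c1; have cy := ler_wpM2l B0 (ler_wpM2r y0 c1).
have sy : 0 <= `|s| * normc y by rewrite mulr_ge0.
have BB : 1 <= B * B by nra.
have := ler_wpM2r sy BB; have := ler_wpM2l B0 h2; lra.
Qed.

Lemma frame_norm_weight a B B' E v : 1 <= E -> B' <= E * B ->
  frame_norm a B' v <= E * frame_norm a B v.
Proof.
move=> E1 BB; rewrite /frame_norm mulrDr; apply: lerD.
  by rewrite -[leLHS]mul1r ler_wpM2r// normc_ge0.
by rewrite mulrA ler_wpM2r// normc_ge0.
Qed.

Lemma frame_norm1_le a b v : frame_norm a 1 v <= 2 * frame_norm b 1 v.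
Proof.
apply: le_trans (frame_norm_rot a b v (lexx 1)) _.
apply: ler_wpM2r; first exact: frame_norm_ge0.
by rewrite mul1r (_ : 2 = 1 + 1)// lerD2l ler_norml sin_geN1 sin_le1.
Qed.

Lemma frame_norm01 v : frame_norm 0 1 v = sum_norm v.
Proof.
rewrite /frame_norm /along /across cos0 sin0 /sum_norm rmorph1 rmorph0 oppr0.
by rewrite !mul0r !mul1r addr0 add0r.
Qed.

Lemma transfer_prodD z (l phi : nat -> R) m n :
  transfer_prod z l phi (m + n) = transfer_prod z l phi m *m
    transfer_prod z (fun j => l (m + j)%N) (fun j => phi (m + j)%N) n.
Proof.
elim: n => [|n IH]; first by rewrite addn0 /= mulmx1.
by rewrite addnS /= IH addnS mulmxA.
Qed.

Lemma frame_norm_prod z (l phi a B K : nat -> R) n :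
  (forall j, (j < n)%N -> 0 <= K j) ->
  (forall j v, (j < n)%N -> frame_norm (a j) (B j) (transfer z (l j.+1) (phi j.+1) *m v) <=
     K j * frame_norm (a j.+1) (B j.+1) v) ->
  forall v, frame_norm (a 0%N) (B 0%N) (transfer_prod z l phi n *m v) <=
    (\prod_(j < n) K j) * frame_norm (a n) (B n) v.
Proof.
elim: n => [|n IH] K0 H v; first by rewrite big_ord0 mul1r mul1mx.
rewrite big_ord_recr /= -mulmxA.
apply: le_trans (IH _ _ _) _ => [j jn|j w jn|]; [exact: K0 (ltnW jn)|exact: H (ltnW jn)|].
rewrite -mulrA; apply: ler_wpM2l; last exact: H.
by apply: prodr_ge0 => j _; apply: K0; rewrite ltnW// ltnS.
Qed.

(** With one frame throughout, the norm grows at most exponentially in the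
    weighted trace of the Hamiltonian. *)
Lemma frame_norm_prod_fixed z (l phi : nat -> R) n a B v : 0 < B ->
  (forall j, (j < n)%N -> 0 <= l j.+1) ->
  frame_norm a B (transfer_prod z l phi n *m v) <=
    expR (2 * normc z * \sum_(j < n) l j.+1 * (B * sin (phi j.+1 - a) ^+ 2 + B^-1)) *
    frame_norm a B v.
Proof.
move=> B0 l0; have B1 : 0 <= B^-1 by rewrite invr_ge0 ltW.
pose x j := 2 * normc z * l j.+1 * (B * sin (phi j.+1 - a) ^+ 2 + B^-1).
have x0 j : (j < n)%N -> 0 <= x j.
  by move=> jn; rewrite !mulr_ge0 ?normc_ge0 ?l0// addr_ge0// mulr_ge0 ?sqr_ge0// ltW.
apply: le_trans (@frame_norm_prod z l phi (fun=> a) (fun=> B) (fun j => 1 + x j) n _ _ v) _.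
- by move=> j jn; rewrite addr_ge0// x0.
- by move=> j w jn; apply: frame_norm_transfer => //; exact: l0.
apply: ler_wpM2r; first by rewrite frame_norm_ge0// ltW.
rewrite mulr_sumr (expR_sum); apply: ler_prod => j _.
rewrite addr_ge0 ?x0//=; apply: le_trans (expR_ge1Dx _) _.
by rewrite ler_expR /x !mulrA.
Qed.

End Frames.

(** * The three regimes of the product *)

Lemma powR_ge1 (R : realType) (x a : R) : 1 <= x -> 0 <= a -> 1 <= x `^ a.
Proof. by move=> x1 a0; rewrite -(powRr0 x) ler_powR. Qed.

Section ProductBound.
Context {R : realType}.
Local Notation normc := (@Normc.normc R).
Variables (l phi : nat -> R) (psi dl dp gl gp K : R).
Hypotheses (dl0 : 0 <= dl) (dp0 : 0 <= dp) (gl0 : 0 <= gl) (gp0 : 0 <= gp) (K0 : 0 < K).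
Hypothesis l_ge0 : forall j, (1 <= j)%N -> 0 <= l j.
Hypothesis l_le : forall j, (1 <= j)%N -> l j <= K * j%:R `^ (- dl).
Hypothesis phi_le : forall j, (1 <= j)%N ->
  `|sin (phi j.+1 - phi j)| <= K * j%:R `^ (- dp).
Hypothesis l_tail : forall N k, (1 <= N)%N ->
  \sum_(j < k) l (N + j.+1)%N <= K * N%:R `^ (- gl).
Hypothesis phi_tail : forall N k, (1 <= N)%N ->
  \sum_(j < k) l (N + j.+1)%N * sin (phi (N + j.+1)%N - psi) ^+ 2 <= K * N%:R `^ (- gp).
Implicit Types (z : R[i]) (v : 'cV[R[i]]_2) (m n N : nat) (r : R).

(** This weight balances the cost [r * l n / B] of a shear against the cost
    [B * |sin|] of a rotation. *)
Definition weight r n : R := Num.sqrt r * n%:R `^ ((dp - dl) / 2).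

Definition amplitude r n : R := 2 * K * Num.sqrt r * n%:R `^ (- ((dl + dp) / 2)).

Lemma prod_ratio (f : nat -> R) n : (forall j, f j != 0) ->
  \prod_(j < n) (f j.+1 / f j) = f n / f 0%N.
Proof.
move=> f0; elim: n => [|n IH]; first by rewrite big_ord0 divff.
by rewrite big_ord_recr /= IH mulrC mulrA divfK.
Qed.

Lemma weight_gt0 r n : 0 < r -> (0 < n)%N -> 0 < weight r n.
Proof. by move=> r0 n0; rewrite mulr_gt0 ?sqrtr_gt0// powR_gt0// ltr0n. Qed.

Lemma amplitude_ge0 r n : 0 <= amplitude r n.
Proof. by rewrite !mulr_ge0 ?powR_ge0 ?sqrtr_ge0// ltW. Qed.

Lemma weight_length r n : 0 < r -> (0 < n)%N ->
  2 * r * l n * (weight r n)^-1 <= amplitude r n.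
Proof.
move=> r0 n0; rewrite ler_pdivrMr ?weight_gt0//.
apply: (@le_trans _ _ (2 * r * (K * n%:R `^ (- dl)))).
  by rewrite ler_wpM2l ?l_le// mulr_ge0// ltW.
rewrite /amplitude /weight le_eqVlt; apply/orP; left; apply/eqP.
have -> : n%:R `^ (- dl) = n%:R `^ (- ((dl + dp) / 2)) * n%:R `^ ((dp - dl) / 2).
  by rewrite -powRD ?pnatr_eq0 -?lt0n ?n0 ?implybT//; congr powR; lra.
set s := Num.sqrt r; have -> : r = s * s by rewrite -expr2 sqr_sqrtr// ltW.
by ring.
Qed.

Lemma weight_angle r n : 0 < r -> (0 < n)%N ->
  weight r n * `|sin (phi n.+1 - phi n)| <= amplitude r n.
Proof.
move=> r0 n0; apply: (@le_trans _ _ (weight r n * (K * n%:R `^ (- dp)))).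
  by rewrite ler_wpM2l ?phi_le// ltW// weight_gt0.
rewrite /amplitude /weight.
have -> : - ((dl + dp) / 2) = (dp - dl) / 2 + - dp by lra.
rewrite powRD ?pnatr_eq0 -?lt0n ?n0 ?implybT//.
have : 0 <= K * Num.sqrt r * (n%:R `^ ((dp - dl) / 2) * n%:R `^ (- dp)).
  by rewrite !mulr_ge0 ?powR_ge0 ?sqrtr_ge0// ltW.
lra.
Qed.

(** The factor on the right telescopes along the product. *)
Lemma weight_ratio r n : (0 < n)%N ->
  weight r n <= n.+1%:R `^ ((dl + dp) / 2) / n%:R `^ ((dl + dp) / 2) * weight r n.+1.
Proof.
move=> n0; have n0' : 0 < n%:R :> R by rewrite ltr0n.
rewrite mulrAC ler_pdivlMr ?powR_gt0// /weight -!mulrA [in leRHS]mulrCA.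
have nz : n%:R != 0 :> R by rewrite gt_eqF.
have nz1 : n.+1%:R != 0 :> R by rewrite pnatr_eq0.
rewrite ler_wpM2l ?sqrtr_ge0// -!powRD ?nz ?nz1 ?implybT//.
have -> : (dp - dl) / 2 + (dl + dp) / 2 = dp by lra.
have -> : (dl + dp) / 2 + (dp - dl) / 2 = dp by lra.
by rewrite ge0_ler_powR ?nnegrE ?ler_nat.
Qed.

(** In the frame of the angle [phi j] with weight [weight r j], a shear
    and a rotation both cost at most [1 + amplitude r j]; the change of weight
    telescopes. *)
Lemma head_bound z m v : 0 < normc z ->
  (forall j, (1 <= j <= m)%N -> 1 <= weight (normc z) j) ->
  frame_norm (phi 1%N) (weight (normc z) 1) (transfer_prod z l phi m *m v) <=
  (\prod_(j < m) (1 + amplitude (normc z) j.+1) ^+ 2) * m.+1%:R `^ ((dl + dp) / 2) *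
  frame_norm (phi m.+1) (weight (normc z) m.+1) v.
Proof.
set r := normc z => r0 w1.
pose f n : R := n.+1%:R `^ ((dl + dp) / 2).
have f0 n : 0 < f n by rewrite powR_gt0// ltr0n.
have -> : m.+1%:R `^ ((dl + dp) / 2) = \prod_(j < m) (f j.+1 / f j).
  by rewrite prod_ratio ?{2}/f ?powR1 ?divr1// => j; rewrite gt_eqF.
rewrite -big_split /=.
apply: (@frame_norm_prod _ z l phi (fun j => phi j.+1) (fun j => weight r j.+1)
  (fun j => (1 + amplitude r j.+1) ^+ 2 * (f j.+1 / f j))).
  by move=> j jm; rewrite mulr_ge0 ?sqr_ge0// divr_ge0 ?powR_ge0.
move=> j w jm; have wj := w1 j.+1 jm.
have wp : 0 < weight r j.+1 by exact: weight_gt0.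
have a0 := amplitude_ge0 r j.+1.
apply: le_trans (frame_norm_transfer _ _ _ _ wp (l_ge0 _)) _ => //.
rewrite subrr sin0 expr0n /= mulr0 add0r expr2 -!mulrA -/r !mulrA.
have n1 : 0 <= frame_norm (phi j.+1) (weight r j.+1) w by rewrite frame_norm_ge0// ltW.
apply: (@le_trans _ _ ((1 + amplitude r j.+1) *
  frame_norm (phi j.+1) (weight r j.+1) w)).
  by rewrite ler_wpM2r// lerD2l weight_length.
rewrite -!mulrA ler_wpM2l ?addr_ge0//.
apply: le_trans (frame_norm_rot _ (phi j.+2) _ wj) _.
apply: ler_pM.
- by rewrite addr_ge0// mulr_ge0// ltW.
- by rewrite frame_norm_ge0// ltW.
- by rewrite lerD2l weight_angle.
rewrite mulrA; apply: frame_norm_weight; last exact: weight_ratio.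
by rewrite ler_pdivlMr// mul1r ge0_ler_powR ?nnegrE ?ler_nat// divr_ge0 ?addr_ge0.
Qed.

(** One fixed frame with weight [1] costs the trace of the Hamiltonian, which is
    the cheaper choice once the angles matter less than the lengths. *)
Lemma middle_bound z m n a v : 
  frame_norm a 1 (transfer_prod z (fun j => l (m + j)%N) (fun j => phi (m + j)%N) n *m v) <=
  expR (4 * normc z * \sum_(j < n) l (m + j.+1)%N) * frame_norm a 1 v.
Proof.
have l0 j : 0 <= l (m + j.+1)%N by rewrite l_ge0// addnS.
apply: le_trans (frame_norm_prod_fixed _ _ _ _ ltr01 _) _ => //.
rewrite ler_wpM2r ?frame_norm_ge0// ler_expR (_ : 4 = 2 * 2); last by ring.
rewrite -!mulrA ler_wpM2l// [leRHS]mulrCA ler_wpM2l ?normc_ge0// mulr_sumr ler_sum// => j _.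
rewrite mulrC ler_wpM2r// invr1 mul1r (_ : 2 = 1 + 1)// lerD2r.
by rewrite -[leRHS](cos2Dsin2 (phi (m + j.+1)%N - a)) lerDr sqr_ge0.
Qed.

(** The weight [N `^ ((gp - gl) / 2)] balances the two tail hypotheses. *)
Lemma tail_bound z N n v : (1 <= N)%N ->
  frame_norm psi 1 (transfer_prod z (fun j => l (N + j)%N) (fun j => phi (N + j)%N) n *m v) <=
  N%:R `^ (gl + gp) * expR (4 * normc z * (K * N%:R `^ (- ((gl + gp) / 2)))) *
  frame_norm psi 1 v.
Proof.
move=> N1; have N0 : 0 < N%:R :> R by rewrite ltr0n.
have N1' : 1 <= N%:R :> R by rewrite ler1n.
have Nz : N%:R != 0 :> R by rewrite gt_eqF.
pose B : R := N%:R `^ ((gp - gl) / 2).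
have B0 : 0 < B by rewrite powR_gt0.
pose E : R := N%:R `^ ((gl + gp) / 2).
have E1 : 1 <= E by rewrite powR_ge1// divr_ge0// addr_ge0.
have EB : B <= E * 1 by rewrite mulr1 ler_powR//; have := gl0; lra.
have BE : 1 <= E * B.
  have -> : E * B = N%:R `^ gp by rewrite -powRD ?Nz ?implybT//; congr powR; lra.
  exact: powR_ge1.
have l0 j : 0 <= l (N + j.+1)%N by rewrite l_ge0// addnS.
apply: le_trans (frame_norm_weight _ _ E1 BE) _.
have -> : N%:R `^ (gl + gp) = E * E.
  by rewrite -powRD ?Nz ?implybT//; congr powR; lra.
rewrite -!mulrA ler_wpM2l ?powR_ge0//.
apply: le_trans (frame_norm_prod_fixed _ _ _ _ B0 _) _ => //.
rewrite mulrCA; apply: ler_pM (frame_norm_weight _ _ E1 EB); rewrite ?expR_ge0//.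
  by rewrite frame_norm_ge0// ltW.
rewrite ler_expR (_ : 4 = 2 * 2); last by ring.
rewrite -!mulrA ler_wpM2l// [leRHS]mulrCA ler_wpM2l ?normc_ge0//.
under eq_bigr do rewrite mulrDr mulrCA.
rewrite big_split /= -mulr_sumr -mulr_suml.
have -> : 2 * (K * N%:R `^ (- ((gl + gp) / 2))) =
    B * (K * N%:R `^ (- gp)) + (K * N%:R `^ (- gl)) * B^-1.
  have e1 : B * N%:R `^ (- gp) = N%:R `^ (- ((gl + gp) / 2)).
    by rewrite -powRD ?Nz ?implybT//; congr powR; lra.
  have e2 : N%:R `^ (- gl) * B^-1 = N%:R `^ (- ((gl + gp) / 2)).
    by rewrite -powRN -powRD ?Nz ?implybT//; congr powR; lra.
  by rewrite [B * _]mulrCA e1 -[K * _ * B^-1]mulrA e2; lra.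
apply: lerD; first by rewrite ler_wpM2l ?phi_tail// ltW.
by rewrite ler_wpM2r ?l_tail// invr_ge0 ltW.
Qed.

(** The exponent of the bound when the balanced frames are used for the first
    [m] factors, a fixed frame up to [N], and the weighted fixed frame beyond. *)
Definition log_cost r m N : R := \sum_(j < m) 2 * ln (1 + amplitude r j.+1) +
  4 * r * \sum_(j < N - m) l (m + j.+1)%N + 4 * r * (K * N%:R `^ (- ((gl + gp) / 2))).

(** The polynomial factor pays for the changes of frame and of weight between
    the three segments. *)
Lemma transfer_prod_bound z m N n v : 1 <= normc z -> (m <= N)%N -> (1 <= N)%N -> (N <= n)%N ->
  (forall j, (1 <= j <= m)%N -> 1 <= weight (normc z) j) ->
  sum_norm (transfer_prod z l phi n *m v) <=
  8 * Num.sqrt (normc z) * N.+1%:R `^ (dl + dp + (gl + gp)) * expR (log_cost (normc z) m N) *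
  sum_norm v.
Proof.
move=> r1 mN N1 Nn w1; set r := normc z in r1 w1 *.
have r0 : 0 < r by lra.
have s1 : 1 <= Num.sqrt r by rewrite -sqrtr1 ler_wsqrtr.
have -> : n = (m + ((N - m) + (n - N)))%N by rewrite addnA subnKC// subnKC.
rewrite transfer_prodD transfer_prodD -!mulmxA.
pose l' j := l (m + j)%N; pose phi' j := phi (m + j)%N.
rewrite -/l' -/phi'.
have -> : (fun j => l' (N - m + j)%N) = (fun j => l (N + j)%N).
  by apply/funext => j; rewrite /l' addnA subnKC.
have -> : (fun j => phi' (N - m + j)%N) = (fun j => phi (N + j)%N).
  by apply/funext => j; rewrite /phi' addnA subnKC.
set u := transfer_prod z (fun j => l (N + j)%N) _ _ *m v.
have hu : frame_norm psi 1 u <= _ := tail_bound z (n - N) v N1.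
have hm : frame_norm psi 1 (transfer_prod z l' phi' (N - m) *m u) <= _ :=
  middle_bound z m (N - m) psi u.
set w := transfer_prod z l' phi' (N - m) *m u in hm *.
have hh := head_bound w r0 w1; rewrite -/r in hu hm hh.
rewrite -2!frame_norm01.
apply: le_trans (frame_norm1_le 0 (phi 1%N) _) _.
have hw1 : frame_norm (phi 1%N) 1 (transfer_prod z l phi m *m w) <=
    frame_norm (phi 1%N) (weight r 1) (transfer_prod z l phi m *m w).
  rewrite -[leRHS]mul1r; apply: frame_norm_weight => //.
  by rewrite mul1r /weight powR1 mulr1.
pose A := N.+1%:R `^ ((dl + dp) / 2) : R.
have N1' : 1 <= N.+1%:R :> R by rewrite ler1n.
have Age1 : 1 <= A by rewrite powR_ge1// divr_ge0// addr_ge0.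
have mA : m.+1%:R `^ ((dl + dp) / 2) <= A.
  by rewrite ge0_ler_powR ?nnegrE ?ler_nat// divr_ge0// addr_ge0.
have hw2 : frame_norm (phi m.+1) (weight r m.+1) w <= Num.sqrt r * A * frame_norm (phi m.+1) 1 w.
  apply: frame_norm_weight; first by rewrite -[1]mulr1 ler_pM.
  rewrite mulr1 /weight ler_wpM2l ?sqrtr_ge0//; apply: le_trans mA.
  by rewrite ler_powR ?ler1n//; have := dl0; lra.
have hw3 := frame_norm1_le (phi m.+1) psi w.
have hv := frame_norm1_le psi 0 v.
set F0 := frame_norm 0 1 v in hv *.
have F00 : 0 <= F0 by rewrite frame_norm_ge0.
set Pr := \prod_(j < m) _ in hh.
have Pr0 : 0 <= Pr by apply: prodr_ge0 => j _; exact: sqr_ge0.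
have PrE : Pr = expR (\sum_(j < m) 2 * ln (1 + amplitude r j.+1)).
  rewrite expR_sum; apply: eq_bigr => j _.
  have a1 : 0 < 1 + amplitude r j.+1 by rewrite ltr_pwDl// amplitude_ge0.
  by rewrite mulrC expRM lnK// powR_mulrn// ltW.
have -> : expR (log_cost r m N) = Pr * (expR (4 * r * \sum_(j < N - m) l (m + j.+1)%N) *
   expR (4 * r * (K * N%:R `^ (- ((gl + gp) / 2))))) by rewrite PrE -!expRD addrA.
set X1 := expR _ in hm *; set X2 := expR _ in hu *.
have X10 : 0 <= X1 by exact: expR_ge0.
have X20 : 0 <= X2 by exact: expR_ge0.
pose G := N.+1%:R `^ (gl + gp) : R.
have NG : N%:R `^ (gl + gp) <= G by rewrite ge0_ler_powR ?nnegrE ?ler_nat// addr_ge0.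
have -> : N.+1%:R `^ (dl + dp + (gl + gp)) = A * A * G.
  have nz : N.+1%:R != 0 :> R by rewrite pnatr_eq0.
  by rewrite -powRD ?nz ?implybT// -powRD ?nz ?implybT//; congr powR; rewrite -splitr.
have h1 : frame_norm psi 1 u <= G * X2 * (2 * F0).
  apply: le_trans hu _; apply: ler_pM => //.
  - by rewrite mulr_ge0 ?powR_ge0.
  - by rewrite frame_norm_ge0.
  - by rewrite ler_wpM2r.
have h2 : frame_norm psi 1 w <= X1 * (G * X2 * (2 * F0)).
  by apply: le_trans hm _; rewrite ler_wpM2l.
have h3 : frame_norm (phi m.+1) (weight r m.+1) w <=
    Num.sqrt r * A * (2 * (X1 * (G * X2 * (2 * F0)))).
  apply: le_trans hw2 _; rewrite ler_wpM2l ?mulr_ge0 ?sqrtr_ge0 ?powR_ge0//.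
  by apply: le_trans hw3 _; rewrite ler_wpM2l.
have h4 : frame_norm (phi 1%N) (weight r 1) (transfer_prod z l phi m *m w) <=
    Pr * A * (Num.sqrt r * A * (2 * (X1 * (G * X2 * (2 * F0))))).
  apply: le_trans hh _; apply: ler_pM h3.
  - by rewrite mulr_ge0 ?powR_ge0.
  - by rewrite frame_norm_ge0// ltW// weight_gt0.
  - by rewrite ler_wpM2l.
apply: le_trans (ler_wpM2l _ (le_trans hw1 h4)) _ => //.
rewrite le_eqVlt; apply/orP; left; apply/eqP; ring.
Qed.

End ProductBound.

(** * The comparison function in closed form *)

Lemma ln_leB1 (R : realType) (x : R) : 0 < x -> ln x <= x - 1.
Proof.
move=> x0; have := @le_ln1Dx _ (x - 1); rewrite (_ : 1 + (x - 1) = x); last by ring.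
by apply; lra.
Qed.

Section ClosedForm.
Context {R : realType}.
Local Notation mu := (@lebesgue_measure R).
Variables (dl dp c : R).
Hypotheses (dl0 : 0 <= dl) (dp0 : 0 <= dp) (d0 : 0 < dl + dp) (c0 : 0 < c) (c1 : c <= 1).
Implicit Types (r s t a b : R).

Let Dl t : R := c * t `^ (- dl).
Let Dp t : R := c * t `^ (- dp).

(** The function [gfun] for powers [d_l] and [d_phi], where [t < k(r)] and
    [t < h(r)] can be solved for. *)
Definition growth_density r t : R :=
  if t `^ (dl + dp) < r * c ^+ 2 / 2 then ln (r * c ^+ 2 * t `^ (- (dl + dp)))
  else if t `^ (dl - dp) < r then c * (Num.sqrt r * t `^ (- ((dl + dp) / 2)))
  else r * (c * t `^ (- dl)).

Lemma itv_sup_le1 (f : R -> R) t :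
  (ereal_sup [set (f s)%:E | s in `[1%R, t]] <= 1)%E <->
  (forall s, 1 <= s <= t -> f s <= 1).
Proof.
split=> [H s st|H].
  rewrite -lee_fin; apply: le_trans H; apply: ereal_sup_ubound; by exists s.
apply: ge_ereal_sup => _ [s /= + <-]; rewrite in_itv/= => st.
by rewrite lee_fin; apply: H.
Qed.

(** The quantity under the supremum increases with [s], so that [k(r)] is the
    point where it reaches [1]. *)
Lemma lt_kfun r t : 1 <= t -> 2 < r * c ^+ 2 ->
  (t%:E < kfun Dl Dp r)%E = (t `^ (dl + dp) < r * c ^+ 2 / 2).
Proof.
move=> t1 rc; have r0 : 0 < r by rewrite -(pmulr_lgt0 _ (_ : 0 < c ^+ 2)) ?exprn_gt0//; lra.
have fE s : 1 <= s -> (2 / (r * Dl s * Dp s) <= 1) = (s `^ (dl + dp) <= r * c ^+ 2 / 2).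
  move=> s1; have s0 : 0 < s by lra.
  have -> : r * Dl s * Dp s = r * c ^+ 2 / s `^ (dl + dp).
    rewrite /Dl /Dp !powRN powRD ?(gt_eqF s0) ?implybT// invfM; ring.
  have sd : 0 < s `^ (dl + dp) by exact: powR_gt0.
  have rc0 : 0 < r * c ^+ 2 by rewrite mulr_gt0// exprn_gt0.
  rewrite ler_pdivrMr ?divr_gt0// mul1r ler_pdivlMr// ler_pdivlMr//.
  by rewrite mulrC.
have d0' := ltW d0.
apply/idP/idP => [/ereal_sup_gt[_ [y [y1 /itv_sup_le1 H] <-]]|H].
  rewrite lte_fin => ty; apply: lt_le_trans (_ : _ < y `^ (dl + dp)) _.
    by apply: gt0_ltr_powR; rewrite ?nnegrE//; lra.
  by rewrite -fE//; apply: H; rewrite y1 lexx.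
pose y := (r * c ^+ 2 / 2) `^ (dl + dp)^-1.
have X0 : 1 <= r * c ^+ 2 / 2 by lra.
have yE : y `^ (dl + dp) = r * c ^+ 2 / 2.
  by rewrite -powRrM mulVf ?gt_eqF// powRr1//; lra.
have ty : t < y.
  rewrite ltNge; apply/negP => yt; suff : r * c ^+ 2 / 2 <= t `^ (dl + dp) by lra.
  by rewrite -yE; apply: ge0_ler_powR => //; rewrite nnegrE ?powR_ge0//; lra.
apply: lt_le_trans (_ : _ < y%:E)%E _; first by rewrite lte_fin.
apply: ereal_sup_ubound; exists y => //; split; first lra.
apply/itv_sup_le1 => s /andP[s1 sy]; rewrite fE// -yE.
by apply: ge0_ler_powR => //; rewrite nnegrE; lra.
Qed.

(** If [dl <= dp], the quantity under the supremum stays below [1], and [h(r)] is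
    infinite; the right-hand side then holds too, since [1 < r]. *)
Lemma lt_hfun r t : 1 <= t -> 1 < r ->
  (t%:E < hfun Dl Dp r)%E = (t `^ (dl - dp) < r).
Proof.
move=> t1 r1.
have fE s : 1 <= s -> (Dp s / (r * Dl s) <= 1) = (s `^ (dl - dp) <= r).
  move=> s1; have s0 : 0 < s by lra.
  rewrite /Dl /Dp ler_pdivrMr ?mulr_gt0 ?powR_gt0//; last lra.
  rewrite mul1r mulrCA ler_pM2l// [s `^ (- dl)]powRN ler_pdivlMr ?powR_gt0//.
  by rewrite -powRD ?(gt_eqF s0) ?implybT//; congr (_ `^ _ <= _); lra.
apply/idP/idP => [/ereal_sup_gt[_ [y [y1 /itv_sup_le1 H] <-]]|H].
  rewrite lte_fin => ty; have [e0|e0] := ltP 0 (dl - dp).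
    apply: lt_le_trans (_ : _ < y `^ (dl - dp)) _.
      by apply: gt0_ltr_powR; rewrite ?nnegrE//; lra.
    by rewrite -fE//; apply: H; rewrite y1 lexx.
  by apply: le_lt_trans r1; rewrite -(powRr0 t) ler_powR.
suff [y ty yP] : exists2 y, t < y & forall s, 1 <= s <= y -> s `^ (dl - dp) <= r.
  apply: lt_le_trans (_ : _ < y%:E)%E _; first by rewrite lte_fin.
  apply: ereal_sup_ubound; exists y => //; split; first lra.
  by apply/itv_sup_le1 => s sy; rewrite fE ?yP//; case/andP: sy.
have [e0|e0] := ltP 0 (dl - dp); last first.
  exists (t + 1); first lra.
  by move=> s /andP[s1 _]; apply: le_trans (ltW r1); rewrite -(powRr0 s) ler_powR.
pose y := r `^ (dl - dp)^-1.
have yE : y `^ (dl - dp) = r by rewrite -powRrM mulVf ?gt_eqF// powRr1//; lra.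
exists y.
  rewrite ltNge; apply/negP => yt; suff : r <= t `^ (dl - dp) by lra.
  by rewrite -{1}yE; apply: ge0_ler_powR; rewrite ?nnegrE ?powR_ge0//; lra.
move=> s /andP[s1 sy]; rewrite -yE.
by apply: ge0_ler_powR; rewrite ?nnegrE ?powR_ge0//; lra.
Qed.

Lemma rc2_gt1 r : 2 < r * c ^+ 2 -> 2 < r.
Proof.
move=> rc; have c2 : 0 < c ^+ 2 by exact: exprn_gt0.
have c21 : c ^+ 2 <= 1 by rewrite expr_le1// ltW.
have r0 : 0 < r by rewrite -(pmulr_lgt0 _ c2); lra.
nra.
Qed.

Lemma sqrt_powR t (e : R) : 0 < t -> Num.sqrt (t `^ e) = t `^ (e / 2).
Proof. by move=> t0; rewrite -powR12_sqrt ?powR_ge0// -powRrM. Qed.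

Lemma gfun_closed r t : 1 <= t -> 2 < r * c ^+ 2 -> gfun Dl Dp t r = growth_density r t.
Proof.
move=> t1 rc; have r2 := rc2_gt1 rc; have t0 : 0 < t by lra.
have r1 : 1 < r by lra.
rewrite /gfun [X in if X then _ else _](lt_kfun t1 rc).
rewrite [X in if _ then _ else if X then _ else _](lt_hfun t1 r1) /growth_density.
have DlDp : Dl t * Dp t = c ^+ 2 * t `^ (- (dl + dp)).
  have -> : t `^ (- (dl + dp)) = t `^ (- dl) * t `^ (- dp).
    by rewrite -powRD ?(gt_eqF t0) ?implybT//; congr powR; lra.
  by rewrite /Dl /Dp; ring.
case: ifP => _; first by rewrite -mulrA DlDp mulrA.
case: ifP => // _; rewrite DlDp sqrtrM ?sqr_ge0// sqrtr_sqr (ger0_norm (ltW c0)).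
by rewrite sqrt_powR// mulNr; ring.
Qed.

(** With [q] the right-hand side, the logarithmic regime has [2 ln q <= q]; in
    the far regime [r <= t `^ (dl - dp)] trades [r] for [sqrt r]. *)
Lemma growth_density_le r t : 1 <= t -> 2 < r * c ^+ 2 ->
  growth_density r t <= c * (Num.sqrt r * t `^ (- ((dl + dp) / 2))).
Proof.
move=> t1 rc; have r2 := rc2_gt1 rc; have t0 : 0 < t by lra.
rewrite /growth_density; case: ifP => [_|_].
  set q := c * _.
  have q0 : 0 < q by rewrite !mulr_gt0 ?powR_gt0 ?sqrtr_gt0//; lra.
  have -> : r * c ^+ 2 * t `^ (- (dl + dp)) = q ^+ 2.
    rewrite /q !exprMn sqr_sqrtr; last lra.
    have -> : t `^ (- (dl + dp)) = t `^ (- ((dl + dp) / 2)) ^+ 2.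
      by rewrite expr2 -powRD ?(gt_eqF t0) ?implybT//; congr powR; lra.
    by ring.
  rewrite lnXn// mulr2n; have [q1|q1] := leP q 1; first by have := ln_le0 q1; lra.
  (* [ln x <= x - 1] at [x = q / 2] and at [x = 2] gives [2 ln q <= q] *)
  have h2 : 0 < q / 2 by lra.
  have := ln_leB1 h2; rewrite ln_div ?posrE//.
  by have := @ln_leB1 _ 2 ltac:(lra); lra.
case: ifP => [_//|/negbT]; rewrite -leNgt => h; rewrite mulrCA ler_pM2l//.
have s0 : 0 < Num.sqrt r by rewrite sqrtr_gt0; lra.
have sr : Num.sqrt r * Num.sqrt r = r by rewrite -expr2 sqr_sqrtr//; lra.
rewrite -{1}sr -mulrA ler_pM2l//.
have : Num.sqrt r <= Num.sqrt (t `^ (dl - dp)) by rewrite ler_wsqrtr.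
rewrite sqrt_powR// => h'; apply: le_trans (ler_wpM2r _ h') _; first exact: powR_ge0.
rewrite -powRD ?(gt_eqF t0) ?implybT// le_eqVlt; apply/orP; left; apply/eqP; congr powR; lra.
Qed.

Lemma growth_density_head r t : 1 <= t -> 2 < r * c ^+ 2 ->
  t `^ (dl + dp) < r * c ^+ 2 / 2 -> 2^-1 <= growth_density r t.
Proof.
move=> t1 rc h; have t0 : 0 < t by lra.
rewrite /growth_density h.
have : 2 <= r * c ^+ 2 * t `^ (- (dl + dp)).
  by rewrite powRN ler_pdivlMr ?powR_gt0//; lra.
move=> h2; apply: (@le_trans _ _ (ln 2)); last by rewrite ler_ln// posrE; lra.
have := @ln_leB1 _ (2^-1) ltac:(lra).
by rewrite lnV ?posrE//; lra.
Qed.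

Lemma growth_density_gt0 r t : 1 <= t -> 2 < r * c ^+ 2 -> 0 < growth_density r t.
Proof.
move=> t1 rc; have r2 := rc2_gt1 rc; have t0 : 0 < t by lra.
have [h|h] := ltP (t `^ (dl + dp)) (r * c ^+ 2 / 2).
  by apply: lt_le_trans (growth_density_head t1 rc h); lra.
rewrite /growth_density (le_gtF h); case: ifP => _; rewrite !mulr_gt0 ?powR_gt0 ?sqrtr_gt0//; lra.
Qed.

(** The density does not increase inside a regime; it jumps up only where the
    logarithmic regime ends, from [ln 2] to at most [sqrt 2], and the constant
    absorbs this jump. *)
Lemma growth_density_quasi_decr r s t : 1 <= s -> s <= t -> 2 < r * c ^+ 2 ->
  growth_density r t <= 3 * growth_density r s.
Proof.
move=> s1 st rc; have r2 := rc2_gt1 rc; have s0 : 0 < s by lra.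
have t0 : 0 < t by lra. have t1 : 1 <= t by lra.
have pst e : 0 <= e -> s `^ e <= t `^ e.
  by move=> e0; apply: ge0_ler_powR => //; rewrite nnegrE ltW.
have st' e : 0 <= e -> t `^ (- e) <= s `^ (- e).
  by move=> e0; rewrite !powRN lef_pV2 ?posrE ?powR_gt0// pst.
have s0g := growth_density_gt0 s1 rc.
have [hs|hs] := ltP (s `^ (dl + dp)) (r * c ^+ 2 / 2); last first.
  suff : growth_density r t <= growth_density r s by lra.
  have ht : t `^ (dl + dp) < r * c ^+ 2 / 2 = false.
    apply/negbTE; rewrite -leNgt; apply: le_trans hs _; apply: pst.
    exact: ltW.
  rewrite {2}/growth_density (le_gtF hs); case: ifP => [_|/negbT].
    apply: le_trans (growth_density_le t1 rc) _.
    by rewrite !ler_pM2l ?st' ?sqrtr_gt0//; [have := d0; lra|lra].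
  rewrite -leNgt => hs'; rewrite /growth_density ht.
  have ht' : t `^ (dl - dp) < r = false.
    apply/negbTE; rewrite -leNgt; apply: (le_trans hs').
    apply: pst; rewrite leNgt; apply/negP => /ltW e0.
    have : s `^ (dl - dp) <= 1 by rewrite -(powRr0 s) ler_powR.
    by lra.
  by rewrite ht' !ler_pM2l ?st'//; lra.
have [ht|ht] := ltP (t `^ (dl + dp)) (r * c ^+ 2 / 2).
  suff : growth_density r t <= growth_density r s by lra.
  rewrite /growth_density hs ht ler_ln ?posrE ?mulr_gt0 ?powR_gt0 ?exprn_gt0//; [|lra|lra].
  by rewrite ler_pM2l ?mulr_gt0 ?exprn_gt0 ?st'//; [exact: ltW|lra].
apply: le_trans (growth_density_le t1 rc) _.
have : c * (Num.sqrt r * t `^ (- ((dl + dp) / 2))) <= 3 / 2.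
  set q := c * _.
  have q0 : 0 < q by rewrite !mulr_gt0 ?powR_gt0 ?sqrtr_gt0//; lra.
  have : q ^+ 2 <= 2.
    rewrite /q !exprMn sqr_sqrtr; last lra.
    have -> : t `^ (- ((dl + dp) / 2)) ^+ 2 = t `^ (- (dl + dp)).
      by rewrite expr2 -powRD ?(gt_eqF t0) ?implybT//; congr powR; lra.
    rewrite powRN mulrA ler_pdivrMr ?powR_gt0//; lra.
  nra.
have := growth_density_head s1 rc hs; lra.
Qed.

Lemma measurable_growth_density r (D : set R) : measurable D ->
  measurable_fun D (growth_density r).
Proof.
move=> mD; apply: (@measurable_funS _ _ _ _ setT) => //.
have mP (e k : R) : measurable_fun [set: R] (fun t => k * t `^ e).
  by apply: measurable_funM => //; exact: measurable_powR.
have mL (e k : R) : measurable_fun [set: R] (fun t => t `^ e < k).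
  by apply: measurable_fun_ltr => //; exact: measurable_powR.
apply: measurable_fun_ifT => //.
  by apply: measurableT_comp => //; exact: measurable_ln.
apply: measurable_fun_ifT => //; last first.
  by apply: measurable_funM => //; exact: mP.
by apply: measurable_funM => //; exact: mP.
Qed.

End ClosedForm.

(** * The area under a density and its balance point *)

Section Area.
Context {R : realType}.
Local Notation mu := (@lebesgue_measure R).
Variables (g : R -> R) (M : R).
Hypothesis mg : measurable_fun [set: R] g.
Hypothesis g_gt0 : forall t, 1 <= t -> 0 < g t.
Hypothesis g_le : forall t, 1 <= t -> g t <= M.
Implicit Types (a b t x m : R) (f F : R -> R).

Definition area t : R := fine (\int[mu]_(s in `[1%R, t]) (g s)%:E)%E.

Let mgE (D : set R) : measurable_fun D (fun s => (g s)%:E).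
Proof. by apply/measurable_EFinP; exact: measurable_funS mg. Qed.

Let g_ge0 a b s : 1 <= a -> `[a, b]%classic s -> (0 <= (g s)%:E)%E.
Proof.
by move=> a1 /=; rewrite in_itv/= => /andP[h _]; rewrite lee_fin ltW// g_gt0// (le_trans a1).
Qed.

Lemma integral_itv_cst a b m : a <= b ->
  (\int[mu]_(s in `[a, b]) m%:E = (m * (b - a))%:E)%E.
Proof.
move=> ab; rewrite integral_cst// [X in (_ * X)%E](lebesgue_measure_itv `[a, b])/= lte_fin.
rewrite EFinM; case: ltP => // ba; have -> : b = a by apply/eqP; rewrite eq_le ba ab.
by rewrite subrr !mule0.
Qed.

Lemma integral_primitive a b f F : 0 < a -> a <= b ->
  (forall x, 0 < x -> is_derive x 1 F (f x)) -> (forall x, 0 < x -> derivable f x 1) ->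
  measurable_fun `[a, b] f /\
  (\int[mu]_(s in `[a, b]) (f s)%:E = (F b - F a)%:E)%E.
Proof.
move=> a0 ab dF df.
have cf : {within `[a, b], continuous f}.
  apply: derivable_within_continuous => x; rewrite in_itv/= => /andP[ax _].
  by apply: df; lra.
split; first exact: subspace_continuous_measurable_fun.
move: ab; rewrite le_eqVlt => /predU1P[<-|ab].
  by rewrite set_itv1 integral_set1 subrr.
have cF x : 0 < x -> F y @[y --> x] --> F x.
  move=> x0; apply: differentiable_continuous; rewrite -derivable1_diffP.
  by have [] := dF x x0.
rewrite (@continuous_FTC2 _ f F)//.
- split; first by move=> x; rewrite in_itv/= => /andP[ax _]; have [] := dF x (lt_trans a0 ax).
    by apply: cvg_at_right_filter; exact: cF.
  by apply: cvg_at_left_filter; apply: cF; lra.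
- move=> x; rewrite in_itv/= => /andP[ax _]; rewrite derive1E.
  by have [_] := dF x (lt_trans a0 ax).
Qed.

Lemma integral_le a b f : 1 <= a -> measurable_fun `[a, b] f ->
  (forall s, a <= s <= b -> g s <= f s) ->
  (\int[mu]_(s in `[a, b]) (g s)%:E <= \int[mu]_(s in `[a, b]) (f s)%:E)%E.
Proof.
move=> a1 mf gf; apply: ge0_le_integral => //.
- by move=> s; exact: g_ge0.
- exact: mgE.
- exact/measurable_EFinP.
Qed.

Lemma integral_ge a b f : 1 <= a -> measurable_fun `[a, b] f ->
  (forall s, a <= s <= b -> 0 <= f s <= g s) ->
  (\int[mu]_(s in `[a, b]) (f s)%:E <= \int[mu]_(s in `[a, b]) (g s)%:E)%E.
Proof.
move=> a1 mf gf; apply: ge0_le_integral => //.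
- by move=> s /=; rewrite in_itv/= lee_fin => /gf/andP[].
- exact/measurable_EFinP.
- exact: mgE.
- by move=> s /=; rewrite in_itv/= lee_fin => /gf/andP[].
Qed.

Lemma integral_fin a b : 1 <= a -> (\int[mu]_(s in `[a, b]) (g s)%:E)%E \is a fin_num.
Proof.
move=> a1; have [ab|ba] := leP a b; last by rewrite set_itv_ge ?integral_set0// bnd_simp -ltNge.
rewrite ge0_fin_numE; last by apply: integral_ge0 => s; exact: g_ge0.
apply: (@le_lt_trans _ _ (M * (b - a))%:E); last exact: ltry.
rewrite -integral_itv_cst//; apply: integral_le => // s /andP[h _].
by apply: g_le; exact: le_trans h.
Qed.

Lemma areaE t : (\int[mu]_(s in `[1%R, t]) (g s)%:E)%E = (area t)%:E.
Proof. by rewrite /area fineK// integral_fin. Qed.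

Lemma area_split a b : 1 <= a -> a <= b ->
  (area b - area a)%:E = (\int[mu]_(s in `[a, b]) (g s)%:E)%E.
Proof.
move=> a1 ab; rewrite EFinB -!areaE.
rewrite (@itv_bndbnd_setU _ _ (BLeft 1) (BRight a) (BRight b)) ?bnd_simp//.
rewrite ge0_integral_setU//=.
- rewrite integral_itv_obnd_cbnd// addeAC subee ?integral_fin// add0e//.
- exact: mgE.
- move=> x [] /=; rewrite in_itv/= => /andP[h _]; rewrite lee_fin ltW// g_gt0//.
  by rewrite ltW// (le_lt_trans a1).
- apply/disj_setPLR => x /=; rewrite !in_itv/= => /andP[h1 h2] /andP[h3 _].
  by move: (le_lt_trans h2 h3); rewrite ltxx.
Qed.

Lemma area1 : area 1 = 0.
Proof. by rewrite /area set_itv1 integral_set1. Qed.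

Lemma area_le_primitive a b f F : 1 <= a -> a <= b ->
  (forall x, 0 < x -> is_derive x 1 F (f x)) -> (forall x, 0 < x -> derivable f x 1) ->
  (forall s, a <= s <= b -> g s <= f s) -> area b - area a <= F b - F a.
Proof.
move=> a1 ab dF df gf; have a0 : 0 < a by lra.
have [mf fE] := integral_primitive a0 ab dF df.
by rewrite -lee_fin area_split// -fE integral_le.
Qed.

Lemma area_ge_primitive a b f F : 1 <= a -> a <= b ->
  (forall x, 0 < x -> is_derive x 1 F (f x)) -> (forall x, 0 < x -> derivable f x 1) ->
  (forall s, a <= s <= b -> 0 <= f s <= g s) -> F b - F a <= area b - area a.
Proof.
move=> a1 ab dF df gf; have a0 : 0 < a by lra.
have [mf fE] := integral_primitive a0 ab dF df.
by rewrite -lee_fin area_split// -fE integral_ge.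
Qed.

Lemma area_le_cst a b m : 1 <= a -> a <= b -> (forall s, a <= s <= b -> g s <= m) ->
  area b - area a <= m * (b - a).
Proof.
by move=> a1 ab gm; rewrite -lee_fin area_split// -integral_itv_cst// integral_le.
Qed.

Lemma area_ge_cst a b m : 1 <= a -> a <= b -> 0 <= m ->
  (forall s, a <= s <= b -> m <= g s) -> m * (b - a) <= area b - area a.
Proof.
move=> a1 ab m0 gm; rewrite -lee_fin area_split// -integral_itv_cst// integral_ge// => s sab.
by rewrite m0 gm.
Qed.

Lemma area_le a b : 1 <= a -> a <= b -> area a <= area b.
Proof.
move=> a1 ab; rewrite -subr_ge0 -(mul0r (b - a)); apply: area_ge_cst => // s /andP[h _].
by rewrite ltW// g_gt0// (le_trans a1).
Qed.

Lemma area_ge0 t : 1 <= t -> 0 <= area t.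
Proof. by move=> t1; rewrite -area1 area_le. Qed.

Hypothesis g_quasi : forall s t, 1 <= s -> s <= t -> g t <= 3 * g s.

Lemma area_gt0 t : 1 < t -> 0 < area t.
Proof.
move=> t1; have gt := g_gt0 (ltW t1).
have : g t / 3 * (t - 1) <= area t - area 1.
  apply: area_ge_cst; rewrite ?(ltW t1)//; first lra.
  by move=> s /andP[s1 st]; have := g_quasi s1 st; lra.
rewrite area1 subr0; apply: lt_le_trans; rewrite mulr_gt0//; lra.
Qed.

(** On [[n, n + 1]] the density is at least a third of its value at [n + 1]. *)
Lemma sum_le_area n : (1 <= n)%N -> \sum_(1 <= j < n) g j.+1%:R <= 3 * area n%:R.
Proof.
elim: n => // n IH _; have [->|n0] := eqVneq n 0%N; first by rewrite big_geq// mulr_ge0// area_ge0.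
rewrite big_nat_recr/= ?lt0n//; have {IH} := IH ltac:(by rewrite lt0n).
have n1 : 1 <= n%:R :> R by rewrite ler1n lt0n.
have nn : n%:R <= n.+1%:R :> R by rewrite ler_nat.
have : g n.+1%:R / 3 * (n.+1%:R - n%:R) <= area n.+1%:R - area n%:R.
  apply: area_ge_cst => //; first by rewrite divr_ge0// ltW// g_gt0// (le_trans n1).
  by move=> s /andP[ns sn]; have := g_quasi (le_trans n1 ns) sn; lra.
rewrite -natrB// subSnn mulr1; lra.
Qed.

Lemma area_continuous b : {within `[1, b], continuous area}.
Proof.
apply/subspace_continuousP => x /=; rewrite in_itv/= => /andP[x1 xb].
apply/cvgrPdist_le => e e0; have M0 : 0 < M by exact: lt_le_trans (g_gt0 (lexx 1)) (g_le (lexx 1)).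
have eM : 0 < e / M by rewrite divr_gt0.
rewrite /within /=; apply/nbhs_ballP; exists (e / M) => //= y xy.
rewrite in_itv/= => /andP[y1 yb].
have lip u v : 1 <= u -> u <= v -> area v - area u <= M * (v - u).
  by move=> u1 uv; apply: area_le_cst => // s /andP[us _]; apply: g_le; exact: le_trans us.
have dM : M * `|x - y| <= e.
  by move: xy; rewrite /ball /= ltr_pdivlMr// mulrC => /ltW.
apply: le_trans dM; have [h|h] := leP x y.
  by rewrite distrC ger0_norm ?subr_ge0 ?area_le// distrC ger0_norm ?subr_ge0//; exact: lip.
by rewrite ger0_norm ?subr_ge0 ?area_le ?(ltW h)// ger0_norm ?subr_ge0 ?(ltW h)// lip// ltW.
Qed.

(** The left-hand side increases strictly from [0], the right-hand side
    decreases to [0]. *)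
Lemma area_balance_exists k e : 0 < k -> 0 < e ->
  exists2 t, 1 <= t & area t = k * t `^ (- e).
Proof.
move=> k0 e0; have a2 : 0 < area 2 by apply: area_gt0; lra.
pose b := Num.max 2 ((k / area 2) `^ e^-1).
have b2 : 2 <= b by rewrite le_max lexx.
have b1 : 1 <= b by lra.
have kb : k * b `^ (- e) <= area b.
  apply: (@le_trans _ _ (area 2)); last by apply: area_le => //; lra.
  have b0 : 0 < b by lra.
  rewrite powRN ler_pdivrMr ?powR_gt0//.
  rewrite mulrC -ler_pdivrMr//.
  have -> : k / area 2 = ((k / area 2) `^ e^-1) `^ e.
    by rewrite -powRrM mulVf ?gt_eqF// powRr1// divr_ge0// ltW.
  by apply: ge0_ler_powR; rewrite ?nnegrE ?powR_ge0 ?(ltW e0)//; [lra|rewrite le_max lexx orbT].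
pose f t := area t + (- k) * t `^ (- e).
have cf : {within `[1, b], continuous f}.
  apply/subspace_continuousP => x xb; apply: cvgD.
    by move/subspace_continuousP: (@area_continuous b); apply.
  apply: cvgM; first exact: cvg_cst.
  have x0 : 0 < x by move: xb; rewrite /= in_itv/= => /andP[x1 _]; lra.
  pose F t : R := t `^ (- e); have hc : F y @[y --> x] --> F x.
    apply: differentiable_continuous; rewrite -derivable1_diffP.
    by have [] := is_derive1_powR (- e) x0.
  exact: cvg_within_filter hc.
have [|t] := IVT b1 cf (v := 0).
  rewrite /f area1 powR1 add0r mulr1 ge_min le_max oppr_le0 (ltW k0) /=.
  by rewrite mulNr subr_ge0 kb orbT.
rewrite in_itv/= => /andP[t1 _] ft; exists t => //; move: ft; rewrite /f; lra.
Qed.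

Lemma area_balance_ge k e t u : 0 < k -> 0 < e -> 1 <= t -> 1 <= u ->
  area t = k * t `^ (- e) -> area u <= k * u `^ (- e) -> u <= t.
Proof.
move=> k0 e0 t1 u1 tE uE; rewrite leNgt; apply/negP => tu.
have := area_le t1 (ltW tu).
suff : k * u `^ (- e) < k * t `^ (- e) by lra.
rewrite ltr_pM2l// !powRN ltf_pV2 ?posrE ?powR_gt0//; [|lra|lra].
by apply: gt0_ltr_powR; rewrite ?nnegrE//; lra.
Qed.

Lemma area_balance_le k e t u : 0 < k -> 0 < e -> 1 <= t -> 1 <= u ->
  area t = k * t `^ (- e) -> k * u `^ (- e) <= area u -> t <= u.
Proof.
move=> k0 e0 t1 u1 tE uE; rewrite leNgt; apply/negP => tu.
have := area_le u1 (ltW tu).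
suff : k * t `^ (- e) < k * u `^ (- e) by lra.
rewrite ltr_pM2l// !powRN ltf_pV2 ?posrE ?powR_gt0//; [|lra|lra].
by apply: gt0_ltr_powR; rewrite ?nnegrE//; lra.
Qed.

End Area.

(** * Powers and logarithms for large arguments *)

Section LargeArguments.
Context {R : realType}.
Implicit Types (p K r : R).

Lemma near_gt K : \forall r \near +oo, K < r.
Proof. by apply: nbhs_pinfty_gt; exact: num_real. Qed.

Lemma half_le r : 0 <= r -> r / 2 <= r.
Proof. lra. Qed.

Lemma near_powR_gt p K : 0 < p -> \forall r \near +oo, K < r `^ p.
Proof.
move=> p0; near=> r.
have r1 : Num.max 1 K `^ p^-1 < r by near: r; exact: near_gt.
have m0 : 0 <= Num.max 1 K by rewrite le_max ler01.
apply: (@le_lt_trans _ _ (Num.max 1 K)); first by rewrite le_max lexx orbT.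
have -> : Num.max 1 K = (Num.max 1 K `^ p^-1) `^ p.
  by rewrite -powRrM mulVf ?gt_eqF// powRr1.
by apply: gt0_ltr_powR => //; rewrite nnegrE ?powR_ge0.
Unshelve. all: by end_near. Qed.

Lemma near_powR_lt p q K : p < q -> \forall r \near +oo, K * r `^ p < r `^ q.
Proof.
move=> pq; near=> r.
have r0 : 0 < r by near: r; exact: near_gt.
have : K < r `^ (q - p) by near: r; apply: near_powR_gt; lra.
have -> : r `^ q = r `^ (q - p) * r `^ p.
  by rewrite -powRD ?(gt_eqF r0) ?implybT// subrK.
by rewrite ltr_pM2r// powR_gt0.
Unshelve. all: by end_near. Qed.

(** [ln x <= x - 1] at [x = r `^ p]. *)
Lemma ln_le_powR p r : 0 < p -> 0 < r -> ln r <= p^-1 * r `^ p.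
Proof.
move=> p0 r0; rewrite -ler_pdivrMl ?invr_gt0// invrK -ln_powR.
have := @ln_leB1 _ (r `^ p) (powR_gt0 _ r0); lra.
Qed.

Lemma near_ln_lt p K : 0 < p -> \forall r \near +oo, K * ln r < r `^ p.
Proof.
move=> p0; near=> r.
have r1 : 1 < r by near: r; exact: near_gt.
have p2 : 0 < p / 2 by lra.
have h : `|K| * (p / 2)^-1 * r `^ (p / 2) < r `^ p.
  by near: r; apply: near_powR_lt; lra.
apply: le_lt_trans h; apply: (@le_trans _ _ (`|K| * ln r)).
  by rewrite ler_wpM2r ?ler_norm// ln_ge0// ltW.
by rewrite -mulrA ler_wpM2l// ln_le_powR//; lra.
Unshelve. all: by end_near. Qed.

Lemma near_ln_gt K : \forall r \near +oo, K < ln r.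
Proof.
near=> r; have h : expR K < r by near: r; exact: near_gt.
by rewrite -[K]expRK ltr_ln ?posrE ?expR_gt0// (lt_trans _ h)// expR_gt0.
Unshelve. all: by end_near. Qed.

Lemma near_mulr_gt c K : 0 < c -> \forall r \near +oo, K < r * c.
Proof.
move=> c0; near=> r; have : K / c < r by near: r; exact: near_gt.
by rewrite ltr_pdivrMr.
Unshelve. all: by end_near. Qed.

End LargeArguments.

Section Primitives.
Context {R : realType}.
Implicit Types (p K x : R).

Lemma derivable_powR_scale K p x : 0 < x -> derivable (fun s => K * s `^ p) x 1.
Proof.
move=> x0; have [d _] := is_derive1_powR p x0.
exact: (@derivableZ _ _ _ (fun s => s `^ p) K x 1 d).
Qed.

Lemma is_derive_powR_primitive K p x : p != 1 -> 0 < x ->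
  is_derive x 1 (fun s => K / (1 - p) * s `^ (1 - p)) (K * x `^ (- p)).
Proof.
move=> p1 x0; have d := is_derive1_powR (1 - p) x0.
have -> : (fun s => K / (1 - p) * s `^ (1 - p)) = (K / (1 - p)) \*: (fun s => s `^ (1 - p)).
  by apply/funext.
apply: is_derive_eq; rewrite /GRing.scale /= mulrA divfK ?subr_eq0 1?eq_sym//.
by congr (_ * _ `^ _); lra.
Qed.

Lemma is_derive_ln_scale K x : 0 < x -> is_derive x 1 (fun s => K * ln s) (K * x `^ (-1)).
Proof.
move=> x0; have d := is_derive1_ln x0.
have -> : (fun s => K * ln s) = K \*: (@ln R) by apply/funext.
by apply: is_derive_eq; rewrite /GRing.scale /= powR_inv1// ltW.
Qed.

End Primitives.

Section GrowthArea.
Context {R : realType}.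
Variables (dl dp c : R).
Hypotheses (dl0 : 0 <= dl) (dp0 : 0 <= dp) (d0 : 0 < dl + dp) (c0 : 0 < c) (c1 : c <= 1).
Implicit Types (r s t a b : R).
Local Notation d := (dl + dp).
Local Notation g := (growth_density dl dp c).

Definition growth_area r t : R := area (growth_density dl dp c r) t.
Local Notation A := growth_area.

Lemma growth_density_bounded r t : 1 <= t -> 2 < r * c ^+ 2 -> g r t <= c * Num.sqrt r.
Proof.
move=> t1 rc; apply: le_trans (growth_density_le _ _ c0 c1 t1 rc) _.
rewrite ler_pM2l// ler_piMr ?sqrtr_ge0// powRN invf_le1 ?powR_gt0//; last lra.
by apply: powR_ge1 => //; have := d0; lra.
Qed.

Section FixedR.
Variable r : R.
Hypothesis rc : 2 < r * c ^+ 2.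

Let mg : measurable_fun [set: R] (g r).
Proof. exact: measurable_growth_density. Qed.
Let g_gt0 t : 1 <= t -> 0 < g r t.
Proof. by move=> t1; exact: growth_density_gt0. Qed.
Let g_le t : 1 <= t -> g r t <= c * Num.sqrt r.
Proof. by move=> t1; exact: growth_density_bounded. Qed.
Let g_quasi s t : 1 <= s -> s <= t -> g r t <= 3 * g r s.
Proof. by move=> s1 st; exact: growth_density_quasi_decr. Qed.

Lemma growth_area_le s t : 1 <= s -> s <= t -> A r s <= A r t.
Proof. exact: (area_le mg g_gt0 g_le). Qed.

Lemma growth_area_ge0 t : 1 <= t -> 0 <= A r t.
Proof. exact: (area_ge0 mg g_gt0 g_le). Qed.

Lemma growth_area_le_cst a b m : 1 <= a -> a <= b -> (forall s, a <= s <= b -> g r s <= m) ->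
  A r b - A r a <= m * (b - a).
Proof. exact: (area_le_cst mg g_gt0 g_le). Qed.

Lemma growth_area_ge_cst a b m : 1 <= a -> a <= b -> 0 <= m ->
  (forall s, a <= s <= b -> m <= g r s) ->
  m * (b - a) <= A r b - A r a.
Proof. exact: (area_ge_cst mg g_gt0 g_le). Qed.

Lemma growth_density_sum_le n : (1 <= n)%N -> \sum_(1 <= j < n) g r j.+1%:R <= 3 * A r n%:R.
Proof. exact: (sum_le_area mg g_gt0 g_le g_quasi). Qed.

Lemma growth_area_balance k e : 0 < k -> 0 < e -> exists2 t, 1 <= t & A r t = k * t `^ (- e).
Proof. exact: (area_balance_exists mg g_gt0 g_le g_quasi). Qed.

Lemma growth_area_balance_ge k e t u : 0 < k -> 0 < e -> 1 <= t -> 1 <= u ->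
  A r t = k * t `^ (- e) -> A r u <= k * u `^ (- e) -> u <= t.
Proof. exact: (area_balance_ge mg g_gt0 g_le). Qed.

Lemma growth_area_balance_le k e t u : 0 < k -> 0 < e -> 1 <= t -> 1 <= u ->
  A r t = k * t `^ (- e) -> k * u `^ (- e) <= A r u -> t <= u.
Proof. exact: (area_balance_le mg g_gt0 g_le). Qed.

Lemma growth_area1 : A r 1 = 0. Proof. exact: area1. Qed.

Lemma gfrakE t : gfrak (fun t => c * t `^ (- dl)) (fun t => c * t `^ (- dp)) t r = (A r t)%:E.
Proof.
rewrite -(areaE mg g_gt0 g_le); apply: eq_integral => s; rewrite inE /= in_itv/= => /andP[s1 _].
by rewrite gfun_closed.
Qed.

Lemma growth_area_le_powR a b K p : p != 1 -> 1 <= a -> a <= b ->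
  (forall s, a <= s <= b -> g r s <= K * s `^ (- p)) ->
  A r b - A r a <= K / (1 - p) * (b `^ (1 - p) - a `^ (1 - p)).
Proof.
move=> p1 a1 ab gK; rewrite mulrBr.
apply: (area_le_primitive mg g_gt0 g_le a1 ab (F := fun s => K / (1 - p) * s `^ (1 - p)) _ _ gK).
  by move=> x x0; exact: is_derive_powR_primitive.
by move=> x x0; exact: derivable_powR_scale.
Qed.

Lemma growth_area_le_ln a b K : 1 <= a -> a <= b ->
  (forall s, a <= s <= b -> g r s <= K * s `^ (- 1)) ->
  A r b - A r a <= K * (ln b - ln a).
Proof.
move=> a1 ab gK; rewrite mulrBr.
apply: (area_le_primitive mg g_gt0 g_le a1 ab (F := fun s => K * ln s) _ _ gK).
  by move=> x x0; exact: is_derive_ln_scale.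
by move=> x x0; exact: derivable_powR_scale.
Qed.

Lemma growth_area_ge_ln a b K : 1 <= a -> a <= b -> 0 <= K ->
  (forall s, a <= s <= b -> K * s `^ (- 1) <= g r s) ->
  K * (ln b - ln a) <= A r b - A r a.
Proof.
move=> a1 ab K0 gK; rewrite mulrBr.
apply: (area_ge_primitive mg g_gt0 g_le a1 ab
  (f := fun s => K * s `^ (- 1)) (F := fun s => K * ln s)).
- by move=> x x0; exact: is_derive_ln_scale.
- by move=> x x0; exact: derivable_powR_scale.
- by move=> s sab; rewrite gK// andbT mulr_ge0// powR_ge0.
Qed.

End FixedR.

End GrowthArea.

(** * Bounds for the area *)

Section AreaAsymptotics.
Context {R : realType}.
Variables (dl dp c gm : R).
Hypotheses (dl0 : 0 <= dl) (dp0 : 0 <= dp) (d0 : 0 < dl + dp) (c0 : 0 < c) (c1 : c <= 1).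
Hypothesis gm0 : 0 < gm.
Implicit Types (r s t a b : R).
Local Notation d := (dl + dp).
Local Notation g := (growth_density dl dp c).
Local Notation A := (growth_area dl dp c).

Definition head_cst : R := (c ^+ 2 / 4) `^ d^-1.
Local Notation k0 := head_cst.

(** The logarithmic regime ends where [s `^ d = r * c ^+ 2 / 2]; the constant [4]
    in [head_cst] keeps the closed interval up to this point inside it. *)
Definition head_end r : R := k0 * r `^ d^-1.

Lemma head_cst_gt0 : 0 < k0.
Proof. by rewrite powR_gt0// divr_gt0// exprn_gt0. Qed.

Lemma head_cst_le1 : k0 <= 1.
Proof.
have h : c ^+ 2 <= 1 by rewrite expr_le1// ltW.
have : k0 <= 1 `^ d^-1.
  apply: ge0_ler_powR; rewrite ?nnegrE// ?invr_ge0 ?(ltW d0)//; last lra.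
  by rewrite divr_ge0// sqr_ge0.
by rewrite powR1.
Qed.

Lemma head_end_pow r : 0 < r -> head_end r `^ d = r * c ^+ 2 / 4.
Proof.
move=> r0; rewrite powRM ?powR_ge0// -!powRrM mulVf ?gt_eqF// !powRr1 ?(ltW r0)//; first ring.
by rewrite divr_ge0// sqr_ge0.
Qed.

Lemma near_head_end K : \forall r \near +oo, K < head_end r.
Proof.
near=> r; have h : K / k0 < r `^ d^-1 by near: r; apply: near_powR_gt; rewrite invr_gt0.
by move: h; rewrite ltr_pdivrMr ?head_cst_gt0// mulrC.
Unshelve. all: by end_near. Qed.

Section Pointwise.
Variable r : R.
Hypothesis rc : 2 < r * c ^+ 2.

Let r0 : 0 < r. Proof. by have := rc2_gt1 c0 c1 rc; lra. Qed.

Let rc2_le : r * c ^+ 2 <= r.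
Proof. by rewrite ler_piMr ?(ltW r0)// expr_le1// ltW. Qed.

Lemma powR_mono s t (e : R) : 0 < s -> s <= t -> 0 <= e -> s `^ e <= t `^ e.
Proof. by move=> s0 st e0; apply: ge0_ler_powR => //; rewrite nnegrE; lra. Qed.

Lemma powR_smono s t (e : R) : 0 < s -> s < t -> 0 < e -> s `^ e < t `^ e.
Proof. by move=> s0 st e0; apply: gt0_ltr_powR => //; rewrite nnegrE; lra. Qed.

Lemma powR_anti s t (e : R) : 0 < s -> s <= t -> 0 <= e -> t `^ (- e) <= s `^ (- e).
Proof.
move=> s0 st e0; have t0 := lt_le_trans s0 st.
by rewrite !powRN lef_pV2 ?posrE ?powR_gt0// powR_mono.
Qed.

Lemma head_lt s : 0 < s -> s <= head_end r -> s `^ d < r * c ^+ 2 / 2.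
Proof.
move=> s0 sk; have := powR_mono s0 sk (ltW d0); rewrite head_end_pow//.
have := rc; lra.
Qed.

Lemma area_head_lower : 1 <= head_end r -> (head_end r - 1) / 2 <= A r (head_end r).
Proof.
move=> k1; have := @growth_area_ge_cst _ dl dp c d0 c0 c1 r rc 1 (head_end r) 2^-1 (lexx 1) k1 _ _.
rewrite growth_area1 subr0 mulrC; apply; first by rewrite invr_ge0.
move=> s /andP[s1 sk]; apply: growth_density_head => //.
by apply: head_lt => //; lra.
Qed.

(** Since [ln x] is at most a multiple of [x `^ (2 * d)^-1], the density is at
    most a multiple of [r `^ (2 * d)^-1 * s `^ (- 2^-1)]. *)
Lemma area_head_upper : 1 <= head_end r -> A r (head_end r) <= 4 * d * r `^ d^-1.
Proof.
move=> k1; pose K := 2 * d * r `^ (2 * d)^-1.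
have dd : 0 < 2 * d by rewrite mulr_gt0.
have K0 : 0 <= K by rewrite !mulr_ge0 ?powR_ge0 ?(ltW d0).
have h2 : 2^-1 != 1 :> R by rewrite lt_eqF//; lra.
have := @growth_area_le_powR _ dl dp c d0 c0 c1 r rc 1 (head_end r) K 2^-1 h2 (lexx 1) k1 _.
rewrite growth_area1 subr0 powR1 => H.
have -> : 4 * d * r `^ d^-1 = K / (1 - 2^-1) * r `^ (2 * d)^-1.
  have -> : r `^ d^-1 = r `^ (2 * d)^-1 * r `^ (2 * d)^-1.
    rewrite -powRD ?(gt_eqF r0) ?implybT//; congr powR.
    by rewrite invfM; move: (d^-1) => x; lra.
  by rewrite /K; field.
apply: le_trans (H _) _.
  move=> s /andP[s1 sk]; have s0 : 0 < s by lra.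
  rewrite /growth_density head_lt//.
  have x0 : 0 < r * c ^+ 2 * s `^ (- d) by rewrite !mulr_gt0 ?powR_gt0 ?exprn_gt0.
  have dd' : 0 < (2 * d)^-1 by rewrite invr_gt0.
  apply: le_trans (ln_le_powR dd' x0) _; rewrite invrK /K -!mulrA ler_pM2l// ler_pM2l//.
  have -> : r `^ (2 * d)^-1 * s `^ (- 2^-1) = (r * s `^ (- d)) `^ (2 * d)^-1.
    rewrite powRM ?powR_ge0 ?(ltW r0)// -powRrM; congr (_ * _ `^ _).
    by rewrite invfM mulNr mulrCA divff ?gt_eqF// mulr1.
  apply: ge0_ler_powR; rewrite ?nnegrE ?invr_ge0 ?(ltW dd)//.
  - by rewrite !mulr_ge0 ?powR_ge0 ?(ltW r0) ?(ltW c0).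
  - by rewrite mulr_ge0 ?(ltW r0)// powR_ge0.
  rewrite ler_pM2l// mulrA -[leRHS]mul1r ler_wpM2r ?powR_ge0//.
  by rewrite -expr2 expr_le1// ltW.
rewrite ler_wpM2l//; first by rewrite divr_ge0//; lra.
have -> : 1 - 2^-1 = 2^-1 :> R by lra.
have : head_end r `^ 2^-1 <= r `^ (2 * d)^-1.
  rewrite powRM ?powR_ge0// -[leRHS]mul1r -powRrM.
  have -> : d^-1 / 2 = (2 * d)^-1 by rewrite invfM mulrC.
  rewrite ler_wpM2r ?powR_ge0//; have := powR_mono head_cst_gt0 head_cst_le1 (_ : 0 <= 2^-1).
  by rewrite powR1; apply; rewrite invr_ge0.
lra.
Qed.

Lemma density_amplitude s : 1 <= s -> g r s <= c * Num.sqrt r * s `^ (- (d / 2)).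
Proof. by move=> s1; rewrite -mulrA growth_density_le. Qed.

Lemma density_middle s : 1 <= s -> r / 2 <= s `^ d -> s `^ (dl - dp) < r ->
  g r s = c * Num.sqrt r * s `^ (- (d / 2)).
Proof.
move=> s1 h1 h2; rewrite /growth_density h2 ifF ?mulrA//; apply/negbTE; rewrite -leNgt.
by apply: (le_trans _ h1); have := rc2_le; lra.
Qed.

Lemma middle_interval a b s : 1 <= a -> a <= s <= b -> r / 2 <= a `^ d ->
  b `^ (dl - dp) < r -> r / 2 <= s `^ d /\ s `^ (dl - dp) < r.
Proof.
move=> a1 /andP[sa sb] h1 h2; have a0 : 0 < a by lra.
split; first by apply: le_trans h1 _; apply: powR_mono => //; exact: ltW.
have [e0|e0] := leP 0 (dl - dp).
  by apply: le_lt_trans h2; apply: powR_mono => //; lra.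
have s1 : 1 <= s by lra.
have := rc2_gt1 c0 c1 rc; suff : s `^ (dl - dp) <= 1 by lra.
by rewrite -(powRr0 s) ler_powR// ltW.
Qed.

Lemma area_middle_lower a b : 1 <= a -> a <= b -> r / 2 <= a `^ d -> b `^ (dl - dp) < r ->
  c * Num.sqrt r * b `^ (- (d / 2)) * (b - a) <= A r b.
Proof.
move=> a1 ab h1 h2; have s0 := sqrtr_ge0 r.
have cs0 : 0 <= c * Num.sqrt r by rewrite mulr_ge0// ltW.
apply: (@le_trans _ _ (A r b - A r a)); last first.
  by rewrite gerBl growth_area_ge0.
apply: growth_area_ge_cst => //; first by rewrite mulr_ge0// powR_ge0.
move=> s sab; have [h3 h4] := middle_interval a1 sab h1 h2.
case/andP: sab => sa sb; rewrite density_middle//; last lra.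
rewrite ler_wpM2l//; apply: powR_anti => //; [lra|have := d0; lra].
Qed.

Lemma area_middle_lower_ln a b : d = 2 -> 1 <= a -> a <= b -> r / 2 <= a `^ d ->
  b `^ (dl - dp) < r -> c * Num.sqrt r * (ln b - ln a) <= A r b.
Proof.
move=> d2 a1 ab h1 h2; have s0 := sqrtr_ge0 r.
have cs0 : 0 <= c * Num.sqrt r by rewrite mulr_ge0// ltW.
apply: (@le_trans _ _ (A r b - A r a)); last first.
  by rewrite gerBl growth_area_ge0.
apply: growth_area_ge_ln => // s sab; have [h3 h4] := middle_interval a1 sab h1 h2.
case/andP: sab => sa sb; have s1 : 1 <= s by lra.
by rewrite (density_middle s1 h3 h4) d2 divff.
Qed.

Lemma area_le_amplitude a b : d != 2 -> 1 <= a -> a <= b ->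
  A r b <= A r a + c * Num.sqrt r / (1 - d / 2) * (b `^ (1 - d / 2) - a `^ (1 - d / 2)).
Proof.
move=> d2 a1 ab; rewrite addrC -lerBlDr; apply: growth_area_le_powR => //.
  by apply: contra d2 => /eqP h; apply/eqP; lra.
by move=> s /andP[sa _]; apply: density_amplitude => //; lra.
Qed.

Lemma area_le_amplitude_ln t : d = 2 -> 1 <= t -> A r t <= c * Num.sqrt r * ln t.
Proof.
move=> d2 t1.
have := @growth_area_le_ln _ dl dp c d0 c0 c1 r rc 1 t (c * Num.sqrt r) (lexx 1) t1 _.
rewrite growth_area1 ln1 !subr0; apply=> s /andP[s1 _].
by have := density_amplitude s1; rewrite d2 divff.
Qed.

(** The two conditions on [a] place [[a, b]] in the far regime, where the density
    is [r * c * s `^ (- dl)]. *)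
Lemma area_le_far a b : 1 < dl -> 1 <= a -> a <= b ->
  r <= a `^ (dl - dp) -> 0 <= dl - dp -> r / 2 <= a `^ d ->
  A r b <= A r a + r * c / (dl - 1) * a `^ (1 - dl).
Proof.
move=> dl1 a1 ab h1 e0 h2; rewrite addrC -lerBlDr.
apply: (@le_trans _ _ (r * c / (1 - dl) * (b `^ (1 - dl) - a `^ (1 - dl)))).
  apply: growth_area_le_powR => //; first by rewrite gt_eqF.
  move=> s /andP[sa sb]; rewrite /growth_density !ifF ?mulrA//.
    by apply/negbTE; rewrite -leNgt; apply: le_trans h1 _; apply: powR_mono => //; lra.
  apply/negbTE; rewrite -leNgt; apply: (@le_trans _ _ (r / 2)).
    by have := rc2_le; lra.
  by apply: le_trans h2 _; apply: powR_mono; [lra|done|exact: ltW].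
have -> : r * c / (1 - dl) = - (r * c / (dl - 1)).
  by rewrite -[1 - dl]opprB invrN mulrN.
have k0 : 0 <= r * c / (dl - 1) by rewrite !mulr_ge0 ?invr_ge0 ?(ltW c0) ?(ltW r0)//; lra.
have := mulr_ge0 k0 (powR_ge0 b (1 - dl)); lra.
Qed.

End Pointwise.

Lemma powR_half r : 0 <= r -> Num.sqrt r = r `^ 2^-1.
Proof. by move=> r0; rewrite powR12_sqrt. Qed.

Lemma powR_balance r (x : R) : 0 < r -> r * (r `^ x) `^ (- gm) = r `^ (1 - x * gm).
Proof.
move=> r0; rewrite -powRrM powRD ?(gt_eqF r0) ?implybT// powRr1 ?(ltW r0)//.
by rewrite mulrN.
Qed.

(** [r * t `^ (- gm)] is the contribution of the tail beyond [t] to the exponent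
    of the growth, up to a constant. *)
Definition area_upper (tau : R -> R) := exists2 K, 0 < K &
  \forall r \near +oo, A r (tau r) <= K * (r * tau r `^ (- gm)).

Definition area_lower (tau : R -> R) := exists2 K, 0 < K &
  \forall r \near +oo, K * (r * tau r `^ (- gm)) <= A r (tau r).

Definition tends_to_infty (tau : R -> R) := forall K, \forall r \near +oo, K < tau r.

Lemma near_admissible : \forall r \near +oo, 2 < r * c ^+ 2.
Proof. by apply: near_mulr_gt; rewrite exprn_gt0. Qed.

Lemma power_tends_to_infty (x : R) : 0 < x -> tends_to_infty (fun r => r `^ x).
Proof. by move=> x0 K; exact: near_powR_gt. Qed.

Lemma power_div_ln_tends_to_infty (x y : R) : 0 < x -> 0 < y ->
  tends_to_infty (fun r => (r `^ x / ln r) `^ y).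
Proof.
move=> x0 y0 K; near=> r.
have r1 : 1 < r by near: r; exact: near_gt.
have r0 : 0 < r by lra.
have l0 : 0 < ln r by rewrite ln_gt0.
have h : 1 * ln r < r `^ (x / 2) by near: r; apply: near_ln_lt; lra.
have : K < r `^ (x / 2 * y) by near: r; apply: near_powR_gt; rewrite mulr_gt0//; lra.
move/lt_le_trans; apply; rewrite powRrM; apply: powR_mono (ltW y0).
  by rewrite powR_gt0.
rewrite ler_pdivlMr//; have -> : r `^ x = r `^ (x / 2) * r `^ (x / 2).
  by rewrite -powRD ?(gt_eqF r0) ?implybT//; congr powR; lra.
by rewrite ler_pM2l ?powR_gt0//; lra.
Unshelve. all: by end_near. Qed.

Section LogarithmicRegime.
Hypothesis hd : d < 1 + gm.
Let tau r : R := (r / ln r) `^ (1 / (1 + gm)).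

Lemma tau_log_infty : tends_to_infty tau.
Proof.
have h : 0 < 1 / (1 + gm) by rewrite divr_gt0//; have := gm0; lra.
move=> K; have H := power_div_ln_tends_to_infty ltr01 h K; near=> r.
have r0 : 0 < r by near: r; exact: near_gt.
have : K < (r `^ 1 / ln r) `^ (1 / (1 + gm)) by near: r.
by rewrite powRr1// ltW.
Unshelve. all: by end_near. Qed.

Lemma tau_log_balance r : 1 < r -> r * tau r `^ (- gm) = tau r * ln r.
Proof.
move=> r1; have r0 : 0 < r by lra. have l0 : 0 < ln r by rewrite ln_gt0.
have t0 : 0 < tau r by rewrite powR_gt0// divr_gt0.
have g1 : 1 + gm != 0 by rewrite gt_eqF//; have := gm0; lra.
have : tau r `^ (1 + gm) = r / ln r.
  by rewrite /tau -powRrM mul1r mulVf// powRr1// divr_ge0// ltW.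
rewrite powRD ?(gt_eqF t0) ?implybT// powRr1 ?(ltW t0)// => h.
have z : tau r `^ gm != 0 by rewrite gt_eqF// powR_gt0.
have z' : ln r != 0 by rewrite gt_eqF.
by apply: (mulIf z); rewrite powRN mulfVK// [RHS]mulrAC h divfK.
Qed.

Lemma tau_log_le r : 1 <= ln r -> 0 < r -> tau r <= r `^ (1 / (1 + gm)).
Proof.
move=> l1 r0; apply: powR_mono; first by rewrite divr_gt0//; lra.
  by rewrite ler_pdivrMr ?ler_peMr//; lra.
by rewrite divr_ge0//; have := gm0; lra.
Qed.

Let eta : R := (1 - d / (1 + gm)) / 2.

Let eta0 : 0 < eta.
Proof.
rewrite divr_gt0// subr_gt0 ltr_pdivrMr ?mul1r//; have := gm0; lra.
Qed.

(** For [d < 1 + gm] the point [tau r] is so far inside the logarithmic regime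
    that the logarithm is comparable with [ln r] throughout. *)
Lemma density_log : \forall r \near +oo, forall s, 1 <= s -> s <= tau r ->
  eta * ln r <= g r s <= ln r.
Proof.
near=> r.
have rc : 2 < r * c ^+ 2 by near: r; exact: near_admissible.
have l1 : 1 < ln r by near: r; exact: near_ln_gt.
have r0 : 0 < r by near: r; exact: near_gt.
have cc : 0 < c ^+ 2 by rewrite exprn_gt0.
have h : 4 / c ^+ 2 * r `^ (1 - 2 * eta) < r `^ (1 - eta).
  by near: r; apply: near_powR_lt; have := eta0; lra.
have r1 : 1 < r by near: r; exact: near_gt.
have h' : r `^ (1 - eta) = r * r `^ (- eta).
  by rewrite powRD ?(gt_eqF r0) ?implybT// powRr1// ltW.
move=> s s1 st; have s0 : 0 < s by lra.
have sd : s `^ d <= r `^ (1 - 2 * eta).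
  apply: le_trans (powR_mono s0 (le_trans st (tau_log_le (ltW l1) r0)) (ltW d0)) _.
  rewrite -powRrM le_eqVlt; apply/orP; left; apply/eqP; congr powR.
  by rewrite /eta mulrCA divff ?mulr1 1?gt_eqF// mul1r mulrC; lra.
have hs : s `^ d * 4 < r * c ^+ 2 * r `^ (- eta).
  have : 4 / c ^+ 2 * s `^ d < r * r `^ (- eta).
    by rewrite -h'; apply: le_lt_trans h; rewrite ler_wpM2l// divr_ge0// ltW.
  rewrite -(ltr_pM2l cc).
  have -> : c ^+ 2 * (4 / c ^+ 2 * s `^ d) = s `^ d * 4 by field; rewrite gt_eqF.
  by rewrite mulrA [c ^+ 2 * r]mulrC.
have e1 : r `^ (- eta) <= 1 by rewrite powRN invf_le1 ?powR_gt0// powR_ge1// ltW.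
have rcc : 0 < r * c ^+ 2 by lra.
have hs2 : s `^ d < r * c ^+ 2 / 2.
  have := ler_wpM2l (ltW rcc) e1; lra.
have x0 : 0 < r * c ^+ 2 * s `^ (- d) by rewrite mulr_gt0// powR_gt0.
rewrite /growth_density hs2 -ln_powR !ler_ln ?posrE ?powR_gt0//; apply/andP; split.
  rewrite [s `^ _]powRN ler_pdivlMr ?powR_gt0//.
  have re : r `^ eta * r `^ (- eta) = 1 by rewrite powRN divff ?gt_eqF ?powR_gt0//.
  have re0 : 0 < r `^ eta by rewrite powR_gt0.
  have := ler_wpM2l (ltW re0) (ltW hs).
  have -> : r `^ eta * (r * c ^+ 2 * r `^ (- eta)) = r * c ^+ 2 by rewrite mulrCA re mulr1.
  have := mulr_ge0 (ltW re0) (powR_ge0 s d); lra.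
rewrite powRN ler_pdivrMr ?powR_gt0//; apply: ler_pM; rewrite ?(ltW r0) ?sqr_ge0//.
apply: (@le_trans _ _ 1); first by rewrite expr_le1// ltW.
by apply: powR_ge1 => //; exact: ltW.
Unshelve. all: by end_near. Qed.

Lemma area_upper_log : area_upper tau.
Proof.
exists 1 => //; near=> r.
have rc : 2 < r * c ^+ 2 by near: r; exact: near_admissible.
have r1 : 1 < r by near: r; exact: near_gt.
have t1 : 1 < tau r by near: r; exact: tau_log_infty.
have l0 : 0 < ln r by rewrite ln_gt0.
have H : forall s, 1 <= s -> s <= tau r -> eta * ln r <= g r s <= ln r.
  by near: r; exact: density_log.
rewrite mul1r tau_log_balance//.
have := @growth_area_le_cst _ dl dp c d0 c0 c1 r rc 1 (tau r) (ln r) (lexx 1) (ltW t1) _.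
rewrite growth_area1 subr0 => h; apply: le_trans (h _) _.
  by move=> s /andP[s1 st]; have /andP[] := H s s1 st.
by rewrite mulrC ler_pM2r//; lra.
Unshelve. all: by end_near. Qed.

Lemma area_lower_log : area_lower tau.
Proof.
exists (eta / 2); first by rewrite divr_gt0.
near=> r.
have rc : 2 < r * c ^+ 2 by near: r; exact: near_admissible.
have r1 : 1 < r by near: r; exact: near_gt.
have t2 : 2 < tau r by near: r; exact: tau_log_infty.
have l0 : 0 < ln r by rewrite ln_gt0.
have H : forall s, 1 <= s -> s <= tau r -> eta * ln r <= g r s <= ln r.
  by near: r; exact: density_log.
rewrite tau_log_balance//.
have t1 : 1 <= tau r by lra.
have el : 0 <= eta * ln r by rewrite mulr_ge0// ltW.
have := @growth_area_ge_cst _ dl dp c d0 c0 c1 r rc 1 (tau r) (eta * ln r) (lexx 1) t1 el _.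
rewrite growth_area1 subr0 => h; apply: le_trans (h _).
  have := ler_wpM2l el (ltW t2); lra.
by move=> s /andP[s1 st]; have /andP[] := H s s1 st.
Unshelve. all: by end_near. Qed.

End LogarithmicRegime.

End AreaAsymptotics.

Section PowerCases.
Context {R : realType}.
Variables (dl dp c gm : R).
Hypotheses (dl0 : 0 <= dl) (dp0 : 0 <= dp) (d0 : 0 < dl + dp) (c0 : 0 < c) (c1 : c <= 1).
Hypothesis gm0 : 0 < gm.
Implicit Types (r s t a b x : R).
Local Notation d := (dl + dp).
Local Notation g := (growth_density dl dp c).
Local Notation A := (growth_area dl dp c).
Local Notation k0 := (head_cst dl dp c).
Local Notation head_end := (head_end dl dp c).
Local Notation area_upper := (area_upper dl dp c gm).
Local Notation area_lower := (area_lower dl dp c gm).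

Let k00 : 0 < k0. Proof. exact: head_cst_gt0. Qed.
Let k01 : k0 <= 1. Proof. exact: head_cst_le1. Qed.

Lemma head_end_le r x : 1 <= r -> d^-1 <= x -> head_end r <= r `^ x.
Proof.
move=> r1 dx; apply: (@le_trans _ _ (r `^ d^-1)); last by rewrite ler_powR.
by rewrite -[leRHS]mul1r ler_wpM2r ?powR_ge0.
Qed.

(** The logarithmic regime alone contributes an area of order [r `^ d^-1]. *)
Lemma area_lower_head x : d^-1 <= x -> 1 - x * gm = d^-1 -> area_lower (fun r => r `^ x).
Proof.
move=> dx xg; exists (k0 / 4); first by rewrite divr_gt0.
near=> r.
have rc : 2 < r * c ^+ 2 by near: r; exact: near_admissible.
have r1 : 1 < r by near: r; exact: near_gt.
have r0 : 0 < r by lra.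
have h2 : 2 < head_end r by near: r; exact: near_head_end.
have h1 : 1 <= head_end r by lra.
rewrite powR_balance// xg; have hx := head_end_le (ltW r1) dx.
have := growth_area_le d0 c0 c1 rc h1 hx; have := area_head_lower d0 c0 c1 rc h1.
have : head_end r = k0 * r `^ d^-1 by [].
lra.
Unshelve. all: by end_near. Qed.

(** Between [head_end r] and [r `^ d^-1] the density is bounded. *)
Lemma area_upper_head x : x = d^-1 -> 1 - x * gm = d^-1 -> area_upper (fun r => r `^ x).
Proof.
move=> xd xg; exists (4 * d + c * k0 `^ (- (d / 2))).
  by rewrite addr_gt0 ?mulr_gt0// powR_gt0.
near=> r.
have rc : 2 < r * c ^+ 2 by near: r; exact: near_admissible.
have r1 : 1 < r by near: r; exact: near_gt.
have r0 : 0 < r by lra.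
have h1 : 1 < head_end r by near: r; exact: near_head_end.
rewrite powR_balance// xg xd.
have hx := head_end_le (ltW r1) (lexx _).
have hs : Num.sqrt r * head_end r `^ (- (d / 2)) = k0 `^ (- (d / 2)).
  rewrite /head_end powRM ?powR_ge0 ?(ltW k00)// -powRrM mulrCA powR_half ?(ltW r0)//.
  have -> : d^-1 * - (d / 2) = - 2^-1 by rewrite mulrN mulrA mulVf ?mul1r// gt_eqF.
  by rewrite -powRD ?(gt_eqF r0) ?implybT// subrr powRr0 mulr1.
have h0 : 0 < head_end r by lra.
have d2 : 0 <= d / 2 by rewrite divr_ge0// ltW.
have := @growth_area_le_cst _ dl dp c d0 c0 c1 r rc (head_end r) (r `^ d^-1)
  (c * k0 `^ (- (d / 2))) (ltW h1) hx _.
move=> H; have {}H := H _.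
have hH : A r (head_end r) <= 4 * d * r `^ d^-1 by apply: area_head_upper => //; exact: ltW.
have : A r (r `^ d^-1) - A r (head_end r) <= c * k0 `^ (- (d / 2)) * (r `^ d^-1 - head_end r).
  apply: H => s /andP[hs1 _]; apply: le_trans (density_amplitude dl dp c0 c1 rc _) _; first lra.
  by rewrite -hs mulrA ler_wpM2l ?mulr_ge0 ?(ltW c0) ?sqrtr_ge0//; exact: powR_anti.
have : 0 <= c * k0 `^ (- (d / 2)) * head_end r by rewrite !mulr_ge0 ?powR_ge0 ?(ltW c0) ?(ltW h0).
lra.
Unshelve. all: by end_near. Qed.

(** For [2 < d] the amplitude is integrable at infinity, and the area is of order
    [r `^ d^-1] however far it extends. *)
Lemma area_upper_summable x : 2 < d -> d^-1 <= x -> 1 - x * gm = d^-1 -> area_upper (fun r => r `^ x).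
Proof.
move=> d2 dx xg; exists (4 * d + c / (d / 2 - 1) * k0 `^ (1 - d / 2)).
  have kk : 0 < k0 `^ (1 - d / 2) by exact: powR_gt0.
  by rewrite addr_gt0 ?mulr_gt0 ?invr_gt0//; lra.
near=> r.
have rc : 2 < r * c ^+ 2 by near: r; exact: near_admissible.
have r1 : 1 < r by near: r; exact: near_gt.
have r0 : 0 < r by lra.
have h1 : 1 < head_end r by near: r; exact: near_head_end.
rewrite powR_balance// xg.
have hx := head_end_le (ltW r1) dx.
have d2' : d != 2 by rewrite gt_eqF.
have hs : Num.sqrt r * head_end r `^ (1 - d / 2) = k0 `^ (1 - d / 2) * r `^ d^-1.
  rewrite /head_end powRM ?powR_ge0 ?(ltW k00)// -powRrM mulrCA powR_half ?(ltW r0)//.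
  rewrite -powRD ?(gt_eqF r0) ?implybT//; congr (_ * _ `^ _).
  by field; rewrite gt_eqF.
have e1 : c * Num.sqrt r / (1 - d / 2) = - (c * Num.sqrt r / (d / 2 - 1)).
  by rewrite -[1 - d / 2]opprB invrN mulrN.
have q0 : 0 <= c * Num.sqrt r / (d / 2 - 1) * (r `^ x) `^ (1 - d / 2).
  by rewrite !mulr_ge0 ?powR_ge0 ?sqrtr_ge0 ?invr_ge0 ?(ltW c0)//; lra.
have e2 : c * Num.sqrt r / (d / 2 - 1) * head_end r `^ (1 - d / 2) =
    c / (d / 2 - 1) * k0 `^ (1 - d / 2) * r `^ d^-1.
  by rewrite -[RHS]mulrA -hs; ring.
apply: le_trans (area_le_amplitude d0 c0 c1 rc d2' (ltW h1) hx) _.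
rewrite [leRHS]mulrDl; apply: lerD; first exact: (area_head_upper d0 c0 c1 rc (ltW h1)).
by rewrite e1 mulNr -mulrN opprB mulrBr e2 gerBl.
Unshelve. all: by end_near. Qed.

Section CriticalRegime.
Hypothesis d2 : d = 2.
Hypothesis hd : 1 + gm < d.
Let tau r : R := (r `^ 2^-1 / ln r) `^ (1 / gm).

Lemma tau_critical_infty : tends_to_infty tau.
Proof. by apply: power_div_ln_tends_to_infty; rewrite ?divr_gt0. Qed.

Lemma tau_critical_balance r : 1 < r -> r * tau r `^ (- gm) = r `^ 2^-1 * ln r.
Proof.
move=> r1; have r0 : 0 < r by lra. have l0 : 0 < ln r by rewrite ln_gt0.
have s0 : 0 < r `^ 2^-1 by rewrite powR_gt0.
have g0 : gm != 0 by rewrite gt_eqF.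
rewrite /tau -powRrM mulrN mul1r mulVf// powRN powRr1 ?divr_ge0 ?(ltW s0) ?(ltW l0)//.
rewrite invf_div mulrA mulrAC; congr (_ * _).
rewrite -powRN -[X in X * _](powRr1 (ltW r0)) -powRD ?(gt_eqF r0) ?implybT//.
by congr powR; lra.
Qed.

Lemma area_upper_critical : area_upper tau.
Proof.
exists (c / (2 * gm)); first by rewrite divr_gt0// mulr_gt0.
near=> r.
have rc : 2 < r * c ^+ 2 by near: r; exact: near_admissible.
have r1 : 1 < r by near: r; exact: near_gt.
have r0 : 0 < r by lra.
have l1 : 1 < ln r by near: r; exact: near_ln_gt.
have t1 : 1 < tau r by near: r; exact: tau_critical_infty.
rewrite tau_critical_balance//; apply: le_trans (area_le_amplitude_ln d0 c0 c1 rc d2 (ltW t1)) _.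
have s0 : 0 < r `^ 2^-1 by rewrite powR_gt0.
have lt : ln (tau r) <= (2 * gm)^-1 * ln r.
  have -> : (2 * gm)^-1 * ln r = 1 / gm * (2^-1 * ln r) by field; rewrite gt_eqF.
  rewrite /tau ln_powR ler_pM2l ?divr_gt0//.
  rewrite -ln_powR ler_ln ?posrE ?divr_gt0//; last lra.
  by rewrite ler_pdivrMr ?ler_peMr//; lra.
rewrite powR_half ?(ltW r0)//.
have -> : c / (2 * gm) * (r `^ 2^-1 * ln r) = c * r `^ 2^-1 * ((2 * gm)^-1 * ln r) by ring.
by rewrite ler_wpM2l// mulr_ge0// ltW.
Unshelve. all: by end_near. Qed.

(** If [0 < dp], the middle regime reaches beyond [r `^ (2^-1 + eps)], and its part
    between [r `^ 2^-1] and that point has area of order [sqrt r * ln r]. *)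
Lemma area_lower_critical : 0 < dp -> area_lower tau.
Proof.
move=> dp1; pose eps := Num.min ((gm^-1 - 1) / 4) (dp / 4).
have gm1 : gm < 1 by have := hd; rewrite d2; lra.
have gi : 1 < gm^-1 by rewrite invf_gt1.
have eps0 : 0 < eps by rewrite lt_min; apply/andP; split; lra.
have eps1 : eps <= (gm^-1 - 1) / 4 by rewrite ge_min lexx.
have eps2 : eps <= dp / 4 by rewrite ge_min lexx orbT.
have dE : dl - dp = 2 - 2 * dp by have := d2; lra.
(* [r `^ (2^-1 + eps)] is still in the middle regime *)
have e1 : (2^-1 + eps) * (2 - 2 * dp) < 1 by nra.
exists (c * eps); first by rewrite mulr_gt0.
near=> r.
have rc : 2 < r * c ^+ 2 by near: r; exact: near_admissible.
have r1 : 1 < r by near: r; exact: near_gt.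
have r0 : 0 < r by lra.
have l1 : 1 < ln r by near: r; exact: near_ln_gt.
have t1 : 1 < tau r by near: r; exact: tau_critical_infty.
pose b := r `^ (2^-1 + eps); pose a := r `^ 2^-1.
have a1 : 1 <= a by apply: powR_ge1; [exact: ltW|rewrite invr_ge0].
have ab : a <= b by apply: ler_powR; [exact: ltW|rewrite lerDl ltW].
have bt : b <= tau r.
  have h : 1 * ln r < r `^ (2^-1 - gm * (2^-1 + eps)).
    near: r; apply: near_ln_lt.
    have : gm * eps <= gm * ((gm^-1 - 1) / 4) by rewrite ler_wpM2l// ltW.
    have -> : gm * ((gm^-1 - 1) / 4) = (1 - gm) / 4 by field; rewrite gt_eqF.
    by lra.
  have -> : b = (r `^ (gm * (2^-1 + eps))) `^ (1 / gm).
    by rewrite -powRrM; congr powR; field; rewrite gt_eqF.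
  apply: powR_mono; [by rewrite powR_gt0| |by rewrite divr_ge0// ltW].
  rewrite ler_pdivlMr; last exact: lt_trans ltr01 l1.
  have -> : r `^ 2^-1 = r `^ (gm * (2^-1 + eps)) * r `^ (2^-1 - gm * (2^-1 + eps)).
    by rewrite -powRD ?(gt_eqF r0) ?implybT// addrC subrK.
  by rewrite ler_pM2l ?powR_gt0// -[ln r]mul1r ltW.
have h1 : r / 2 <= a `^ d.
  by rewrite d2 -powRrM mulVf// powRr1 ?(ltW r0)// half_le// ltW.
have h2 : b `^ (dl - dp) < r.
  rewrite -powRrM -[ltRHS](powRr1 (ltW r0)).
  rewrite dE.
  have : 1 * r `^ ((2^-1 + eps) * (2 - 2 * dp)) < r `^ 1 by near: r; exact: near_powR_lt.
  by rewrite mul1r.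
rewrite tau_critical_balance//.
have b1 : 1 <= b by exact: le_trans a1 ab.
apply: le_trans (growth_area_le d0 c0 c1 rc b1 bt).
apply: le_trans (area_middle_lower_ln d0 c0 c1 rc d2 a1 ab h1 h2).
rewrite !ln_powR powR_half ?(ltW r0)// le_eqVlt; apply/orP; left; apply/eqP; ring.
Unshelve. all: by end_near. Qed.

End CriticalRegime.

Lemma area_upper_middle x : d < 2 -> 0 < x -> 1 - x * gm = 2^-1 + x * (1 - d / 2) ->
  area_upper (fun r => r `^ x).
Proof.
move=> d2 x0 xg; exists (c / (1 - d / 2)); first by rewrite divr_gt0//; lra.
near=> r.
have rc : 2 < r * c ^+ 2 by near: r; exact: near_admissible.
have r1 : 1 < r by near: r; exact: near_gt.
have r0 : 0 < r by lra.
have t1 : 1 <= r `^ x by apply: powR_ge1; lra.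
rewrite powR_balance// xg.
have d2' : d != 2 by rewrite lt_eqF.
have := area_le_amplitude d0 c0 c1 rc d2' (lexx 1) t1; rewrite growth_area1 add0r powR1.
have -> : r `^ (2^-1 + x * (1 - d / 2)) = Num.sqrt r * (r `^ x) `^ (1 - d / 2).
  by rewrite powRD ?(gt_eqF r0) ?implybT// powRrM powR_half// ltW.
have : 0 <= c * Num.sqrt r / (1 - d / 2).
  by rewrite !mulr_ge0 ?invr_ge0 ?sqrtr_ge0 ?(ltW c0)//; lra.
set u := _ `^ (1 - d / 2); have -> : c / (1 - d / 2) * (Num.sqrt r * u) =
  c * Num.sqrt r / (1 - d / 2) * u by ring.
lra.
Unshelve. all: by end_near. Qed.

(** The interval from [t / 4] to [t / 2], with [t = r `^ x], lies in the middle
    regime; its right end stays off [t], which may be the end of that regime. *)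
Lemma area_lower_middle x : d^-1 < x -> x * (dl - dp) <= 1 ->
  1 - x * gm = 2^-1 + x * (1 - d / 2) -> area_lower (fun r => r `^ x).
Proof.
move=> dx xe xg; have x0 : 0 < x by apply: lt_trans dx; rewrite invr_gt0.
exists (c / 4); first by rewrite divr_gt0.
near=> r.
have rc : 2 < r * c ^+ 2 by near: r; exact: near_admissible.
have r1 : 1 < r by near: r; exact: near_gt.
have r0 : 0 < r by lra.
have t4 : 4 * r `^ d^-1 < r `^ x by near: r; apply: near_powR_lt.
have s1 : 1 <= r `^ d^-1 by apply: powR_ge1; [lra|rewrite invr_ge0 ltW].
set t := r `^ x in t4 *.
pose a := t / 4; pose b := t / 2.
have a1 : 1 <= a by rewrite /a; lra.
have ab : a <= b by rewrite /a /b; lra.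
have b1 : 1 <= b by lra.
have bt : b <= t by rewrite /b; lra.
have t0 : 0 < t by lra.
have h1 : r / 2 <= a `^ d.
  have sa : r `^ d^-1 <= a by rewrite /a; lra.
  have := powR_mono (lt_le_trans ltr01 s1) sa (ltW d0).
  rewrite -powRrM mulVf ?gt_eqF// powRr1 ?(ltW r0)//; apply: le_trans.
  by rewrite half_le// ltW.
have h2 : b `^ (dl - dp) < r.
  have [e0|e0] := ltP 0 (dl - dp).
    apply: (@lt_le_trans _ _ (t `^ (dl - dp))).
      by apply: powR_smono e0; [exact: lt_le_trans b1|rewrite /b; lra].
    rewrite -powRrM -[leRHS](powRr1 (ltW r0)); apply: ler_powR => //; lra.
  by apply: le_lt_trans r1; rewrite -(powRr0 b) ler_powR.
rewrite powR_balance// xg.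
apply: le_trans (growth_area_le d0 c0 c1 rc b1 bt).
apply: le_trans (area_middle_lower d0 c0 c1 rc a1 ab h1 h2).
have -> : r `^ (2^-1 + x * (1 - d / 2)) = Num.sqrt r * (t * t `^ (- (d / 2))).
  rewrite powRD ?(gt_eqF r0) ?implybT// powRrM powR_half ?(ltW r0)// powRD ?(gt_eqF t0) ?implybT//.
  by rewrite powRr1// ltW.
have : t `^ (- (d / 2)) <= b `^ (- (d / 2)).
  by apply: powR_anti bt _; [exact: lt_le_trans b1|rewrite divr_ge0// ltW].
have cs : 0 <= c * Num.sqrt r * (t / 4).
  by rewrite !mulr_ge0 ?sqrtr_ge0 ?(ltW c0) ?invr_ge0 ?(ltW t0).
move=> /(ler_wpM2l cs); rewrite /b /a; set u := t `^ _; set v := (t / 2) `^ _.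
lra.
Unshelve. all: by end_near. Qed.

Section FarRegime.
Hypotheses (d2 : d < 2) (dl1 : 1 < dl).

Let e0 : 0 < dl - dp. Proof. by have := d2; have := dl1; lra. Qed.
(** The far regime begins at this point. *)
Let h r := r `^ (dl - dp)^-1.

Lemma far_pow r : 0 < r -> h r `^ (dl - dp) = r.
Proof. by move=> r0; rewrite -powRrM mulVf ?gt_eqF// powRr1// ltW. Qed.

Lemma far_pow_ge r : 1 < r -> r <= h r `^ d.
Proof.
move=> r1; rewrite -powRrM -[leLHS](powRr1 (_ : 0 <= r)); last lra.
apply: ler_powR; first lra.
by rewrite mulrC ler_pdivlMr// mul1r; have := dp0; lra.
Qed.

Lemma far_value r : 0 < r -> Num.sqrt r * h r `^ (1 - d / 2) = r `^ ((1 - dp) / (dl - dp)).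
Proof.
move=> r0; rewrite powR_half ?(ltW r0)// -powRrM -powRD ?(gt_eqF r0) ?implybT//.
by congr powR; field; rewrite gt_eqF.
Qed.

Lemma far_value2 r : 0 < r -> r * h r `^ (1 - dl) = r `^ ((1 - dp) / (dl - dp)).
Proof.
move=> r0; rewrite -powRrM -[X in X * _](powRr1 (ltW r0)) -powRD ?(gt_eqF r0) ?implybT//.
by congr powR; field; rewrite gt_eqF.
Qed.

(** Both the middle and the far regime contribute areas of order
    [r `^ ((1 - dp) / (dl - dp))], the first at its right end, the second at its
    left end. *)
Lemma area_upper_far x : (dl - dp)^-1 <= x -> 1 - x * gm = (1 - dp) / (dl - dp) ->
  area_upper (fun r => r `^ x).
Proof.
move=> ex xg; exists (c / (1 - d / 2) + c / (dl - 1)).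
  by rewrite addr_gt0 ?divr_gt0//; [have := d2; lra|have := dl1; lra].
near=> r.
have rc : 2 < r * c ^+ 2 by near: r; exact: near_admissible.
have r1 : 1 < r by near: r; exact: near_gt.
have r0 : 0 < r by lra.
have h1 : 1 <= h r by apply: powR_ge1; [lra|rewrite invr_ge0 ltW].
have ht : h r <= r `^ x by apply: ler_powR => //; lra.
rewrite powR_balance// xg.
have d2' : d != 2 by rewrite lt_eqF.
have e1 : r <= h r `^ (dl - dp) by rewrite far_pow.
have e2 : r / 2 <= h r `^ d by have := far_pow_ge r1; lra.
have f1 : c * Num.sqrt r / (1 - d / 2) * h r `^ (1 - d / 2) =
  c / (1 - d / 2) * r `^ ((1 - dp) / (dl - dp)) by rewrite -far_value//; ring.
have f2 : r * c / (dl - 1) * h r `^ (1 - dl) =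
  c / (dl - 1) * r `^ ((1 - dp) / (dl - dp)) by rewrite -far_value2//; ring.
have q0 : 0 <= c * Num.sqrt r / (1 - d / 2).
  by rewrite !mulr_ge0 ?invr_ge0 ?sqrtr_ge0 ?(ltW c0)//; have := d2; lra.
apply: le_trans (area_le_far d0 c0 c1 rc dl1 h1 ht e1 (ltW e0) e2) _.
rewrite f2 [leRHS]mulrDl lerD2r -f1.
have := area_le_amplitude d0 c0 c1 rc d2' (lexx 1) h1; rewrite growth_area1 add0r powR1.
move=> /le_trans; apply; rewrite ler_wpM2l// gerBl; exact: ler01.
Unshelve. all: by end_near. Qed.

Lemma area_lower_far x : (dl - dp)^-1 <= x -> 1 - x * gm = (1 - dp) / (dl - dp) ->
  area_lower (fun r => r `^ x).
Proof.
(* [th] is chosen so that [(th * h r) `^ d >= r / 2] *)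
move=> ex xg; pose th : R := 2^-1 `^ d^-1.
have th0 : 0 < th by rewrite powR_gt0.
have th1 : th < 1.
  have : th < 1 `^ d^-1 by apply: gt0_ltr_powR; rewrite ?nnegrE ?invr_gt0//; lra.
  by rewrite powR1.
exists (c * ((1 - th) / 2)); first by rewrite mulr_gt0// divr_gt0//; lra.
near=> r.
have rc : 2 < r * c ^+ 2 by near: r; exact: near_admissible.
have r1 : 1 < r by near: r; exact: near_gt.
have r0 : 0 < r by lra.
have hb : 1 / th < h r by near: r; apply: near_powR_gt; rewrite invr_gt0.
pose a := th * h r; pose b := (th + 1) / 2 * h r.
have h0 : 0 < h r by rewrite powR_gt0.
have a1 : 1 <= a by move: hb; rewrite ltr_pdivrMr// mulrC => /ltW.
have ab : a <= b by rewrite ler_pM2r//; lra.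
have bh : b < h r by rewrite gtr_pMl//; lra.
have ht : h r <= r `^ x by apply: ler_powR => //; lra.
have b1 : 1 <= b by exact: le_trans a1 ab.
have bt : b <= r `^ x by exact: le_trans (ltW bh) ht.
have q1 : r / 2 <= a `^ d.
  rewrite powRM ?(ltW th0) ?(ltW h0)// -powRrM mulVf ?gt_eqF// powRr1//.
  have := far_pow_ge r1; lra.
have q2 : b `^ (dl - dp) < r.
  by rewrite -[ltRHS]far_pow//; apply: powR_smono bh e0; exact: lt_le_trans b1.
rewrite powR_balance// xg.
apply: le_trans (growth_area_le d0 c0 c1 rc b1 bt).
apply: le_trans (area_middle_lower d0 c0 c1 rc a1 ab q1 q2).
have dd : 0 <= d / 2 by rewrite divr_ge0// ltW.
have : h r `^ (- (d / 2)) <= b `^ (- (d / 2)).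
  by apply: powR_anti (ltW bh) dd; exact: lt_le_trans b1.
have cs : 0 <= c * Num.sqrt r * (b - a).
  by rewrite !mulr_ge0 ?sqrtr_ge0 ?(ltW c0) ?subr_ge0.
have -> : c * Num.sqrt r * b `^ (- (d / 2)) * (b - a) =
  c * Num.sqrt r * (b - a) * b `^ (- (d / 2)) by ring.
move=> /(ler_wpM2l cs); apply: le_trans.
rewrite -far_value// powRD ?(gt_eqF h0) ?implybT// powRr1 ?(ltW h0)//.
rewrite le_eqVlt; apply/orP; left; apply/eqP; rewrite /b /a; field.
Unshelve. all: by end_near. Qed.

End FarRegime.

End PowerCases.

(** * The balance point *)

Section Balance.
Context {R : realType}.
Variables (dl dp c gl gp : R).
Hypotheses (dl0 : 0 <= dl) (dp0 : 0 <= dp) (d0 : 0 < dl + dp) (c0 : 0 < c) (c1 : c <= 1).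
Local Notation gm := (2^-1 * (gl + gp)).
Hypothesis gm0 : 0 < gm.
Implicit Types (r s t a b x : R) (tau : R -> R).
Local Notation A := (growth_area dl dp c).

(** The function [T(r)] for powers [d_l], [d_phi], [c_l] and [c_phi]. *)
Definition balance_point r : R :=
  Tfun (fun t => c * t `^ (- dl)) (fun t => c * t `^ (- dp))
       (fun t => c * t `^ (- gl)) (fun t => c * t `^ (- gp)) r.

Lemma balance_pointP r : 2 < r * c ^+ 2 ->
  1 <= balance_point r /\ A r (balance_point r) = r * c * balance_point r `^ (- gm).
Proof.
move=> rc; have r2 := rc2_gt1 c0 c1 rc.
have rc0 : 0 < r * c by rewrite mulr_gt0//; lra.
have sE t : 1 <= t -> r * Num.sqrt (c * t `^ (- gl) * (c * t `^ (- gp))) = r * c * t `^ (- gm).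
  move=> t1; have t0 : 0 < t by lra.
  have -> : c * t `^ (- gl) * (c * t `^ (- gp)) = c ^+ 2 * (t `^ (- gl) * t `^ (- gp)) by ring.
  rewrite -powRD ?(gt_eqF t0) ?implybT// sqrtrM ?sqr_ge0// sqrtr_sqr ger0_norm ?(ltW c0)//.
  by rewrite sqrt_powR// mulrA; congr (_ * _ `^ _); lra.
have [t t1 tE] := growth_area_balance dl0 d0 c0 c1 rc rc0 gm0.
have : [set t | 1 <= t /\ gfrak (fun t => c * t `^ (- dl)) (fun t => c * t `^ (- dp)) t r =
    (r * Num.sqrt (c * t `^ (- gl) * (c * t `^ (- gp))))%:E] t.
  by split => //; rewrite gfrakE// sE// tE.
move=> /(xgetI 1) []; rewrite -/(balance_point r) => T1; rewrite gfrakE// sE// => -[TE].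
by split.
Qed.

Lemma powR_scale_balance a t r : 0 < a -> 0 < t ->
  r * c * (a * t) `^ (- gm) = c * a `^ (- gm) * (r * t `^ (- gm)).
Proof. by move=> a0 t0; rewrite powRM ?(ltW a0) ?(ltW t0)//; ring. Qed.

(** The scale [a] is chosen so that the tail at [a * tau r] dominates the bound
    for the area up to [tau r], hence the area up to [a * tau r]. *)
Lemma balance_point_lower tau : tends_to_infty tau -> area_upper dl dp c gm tau ->
  lesssim +oo (fun r => (tau r)%:E) (fun r => (balance_point r)%:E).
Proof.
move=> tauy [K K0 KP]; pose a := Num.min 1 ((c / K) `^ gm^-1).
have q0 : 0 < (c / K) `^ gm^-1 by rewrite powR_gt0// divr_gt0.
have a0 : 0 < a by rewrite lt_min ltr01.
have a1 : a <= 1 by rewrite ge_min lexx.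
have aK : K <= c * a `^ (- gm).
  rewrite powRN ler_pdivlMr ?powR_gt0// -ler_pdivlMl//.
  have : a <= (c / K) `^ gm^-1 by rewrite ge_min lexx orbT.
  move=> /(powR_mono a0) /(_ (ltW gm0)).
  by rewrite -powRrM mulVf ?gt_eqF// powRr1 ?divr_ge0 ?(ltW c0) ?(ltW K0)// [K^-1 * c]mulrC.
exists a^-1; first by rewrite invr_gt0.
near=> r.
have rc : 2 < r * c ^+ 2 by near: r; exact: near_admissible.
have r0 : 0 < r by near: r; exact: near_gt.
have t1 : a^-1 < tau r by near: r; exact: tauy.
have KPr : A r (tau r) <= K * (r * tau r `^ (- gm)) by near: r.
have [T1 TE] := balance_pointP rc.
have t0 : 0 < tau r by apply: lt_trans t1; rewrite invr_gt0.
have at1 : 1 <= a * tau r by rewrite -ler_pdivrMl// mulr1 ltW.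
rewrite -EFinM lee_fin ler_pdivlMl//.
have rc0 : 0 < r * c by rewrite mulr_gt0.
apply: (growth_area_balance_ge d0 c0 c1 rc rc0 gm0 T1 at1 TE).
rewrite powR_scale_balance//.
have att : a * tau r <= tau r by rewrite ger_pMl.
apply: le_trans (growth_area_le d0 c0 c1 rc at1 att) _; apply: le_trans KPr _.
by rewrite ler_wpM2r// mulr_ge0 ?powR_ge0// ltW.
Unshelve. all: by end_near. Qed.

Lemma balance_point_upper tau : tends_to_infty tau -> area_lower dl dp c gm tau ->
  lesssim +oo (fun r => (balance_point r)%:E) (fun r => (tau r)%:E).
Proof.
move=> tauy [K K0 KP]; pose a := Num.max 1 ((c / K) `^ gm^-1).
have a1 : 1 <= a by rewrite le_max lexx.
have a0 : 0 < a by lra.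
have aK : c * a `^ (- gm) <= K.
  rewrite powRN ler_pdivrMr ?powR_gt0// -ler_pdivrMl//.
  have q : (c / K) `^ gm^-1 <= a by rewrite le_max lexx orbT.
  have q0 : 0 < (c / K) `^ gm^-1 by rewrite powR_gt0// divr_gt0.
  have := powR_mono q0 q (ltW gm0).
  by rewrite -powRrM mulVf ?gt_eqF// powRr1 ?divr_ge0 ?(ltW c0) ?(ltW K0)// [K^-1 * c]mulrC.
exists a => //.
near=> r.
have rc : 2 < r * c ^+ 2 by near: r; exact: near_admissible.
have r0 : 0 < r by near: r; exact: near_gt.
have t1 : 1 < tau r by near: r; exact: tauy.
have KPr : K * (r * tau r `^ (- gm)) <= A r (tau r) by near: r.
have [T1 TE] := balance_pointP rc.
have t0 : 0 < tau r by lra.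
have att : tau r <= a * tau r by rewrite ler_peMl// ltW.
have at1 : 1 <= a * tau r by lra.
rewrite -EFinM lee_fin.
have rc0 : 0 < r * c by rewrite mulr_gt0.
apply: (growth_area_balance_le d0 c0 c1 rc rc0 gm0 T1 at1 TE).
rewrite powR_scale_balance//.
apply: le_trans (growth_area_le d0 c0 c1 rc (ltW t1) att); apply: le_trans KPr.
by rewrite ler_wpM2r// mulr_ge0 ?powR_ge0// ltW.
Unshelve. all: by end_near. Qed.

End Balance.

Section StepCosts.
Context {R : realType}.
Variables (dl dp c K : R).
Hypotheses (dl0 : 0 <= dl) (dp0 : 0 <= dp) (d0 : 0 < dl + dp) (c0 : 0 < c) (c1 : c <= 1).
Hypothesis K0 : 0 < K.
Implicit Types (r x : R) (n m N i : nat).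
Local Notation d := (dl + dp).
Local Notation g := (growth_density dl dp c).

Definition step_cst : R := 1 + 4 * ln (1 + 2 * K / c) + 4 * K / c.

Let Kc0 : 0 < K / c. Proof. exact: divr_gt0. Qed.

Lemma step_cst_gt0 : 0 < step_cst.
Proof.
rewrite /step_cst -!mulrA; have := Kc0 => h.
have : 0 <= ln (1 + 2 * (K / c)) by rewrite ln_ge0//; lra.
lra.
Qed.

Lemma amplitude_density r n : amplitude dl dp K r n =
  2 * (K / c) * (c * (Num.sqrt r * n%:R `^ (- (d / 2)))).
Proof. by rewrite /amplitude; field; rewrite gt_eqF. Qed.

(** With [k = K / c] and [q] the density of the middle regime, the cost is
    [2 ln (1 + 2 k q)], which is at most [4 k q], and for [1 <= q] at most
    [2 ln (1 + 2 k) + 2 ln q]. *)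
Lemma near_step_cost r n : 2 < r * c ^+ 2 -> (1 <= n)%N -> n%:R `^ (dl - dp) < r ->
  2 * ln (1 + amplitude dl dp K r n) <= step_cst * g r n%:R.
Proof.
move=> rc n1 h; have r2 := rc2_gt1 c0 c1 rc.
have n1' : 1 <= n%:R :> R by rewrite ler1n.
have n0 : 0 < n%:R :> R by lra.
rewrite amplitude_density; set q := c * _.
have q0 : 0 < q by rewrite !mulr_gt0 ?powR_gt0 ?sqrtr_gt0//; lra.
have kc := Kc0; set k := K / c in kc.
have kq : 0 < k * q by rewrite mulr_gt0.
have CE : step_cst = 1 + 4 * ln (1 + 2 * k) + 4 * k.
  by rewrite /step_cst /k !mulrA.
have l0 : 0 <= ln (1 + 2 * k) by rewrite ln_ge0//; lra.
have [hd|hd] := ltP (n%:R `^ d) (r * c ^+ 2 / 2).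
  have g2 := growth_density_head n1' rc hd.
  have gE : g r n%:R = 2 * ln q.
    rewrite /growth_density hd.
    have -> : r * c ^+ 2 * n%:R `^ (- d) = q ^+ 2.
      rewrite /q !exprMn sqr_sqrtr; last lra.
      have -> : n%:R `^ (- d) = n%:R `^ (- (d / 2)) ^+ 2.
        by rewrite expr2 -powRD ?(gt_eqF n0) ?implybT//; congr powR; lra.
      by ring.
    by rewrite lnXn// mulr2n; lra.
  have q1 : 1 <= q.
    rewrite leNgt; apply/negP => q1; have := ln_le0 (ltW q1); move: g2; rewrite gE; lra.
  have : ln (1 + 2 * k * q) <= ln (1 + 2 * k) + ln q.
    rewrite -lnM ?posrE//; last lra.
    rewrite ler_ln ?posrE; [|lra|by apply: mulr_gt0 => //; lra].
    by rewrite mulrDl mul1r; lra.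
  have := mulr_ge0 l0 (_ : 0 <= 2 * g r n%:R - 1).
  have := mulr_ge0 (ltW kc) (_ : 0 <= g r n%:R).
  move=> H1 H2; have {}H1 := H1 ltac:(lra); have {}H2 := H2 ltac:(lra).
  rewrite CE gE in H1 H2 *; lra.
have gE : g r n%:R = q by rewrite /growth_density (le_gtF hd) h.
have h1 : 0 < 1 + 2 * k * q by lra.
have := ln_leB1 h1; rewrite CE gE; have := mulr_ge0 l0 (ltW q0); lra.
Qed.

Lemma far_step_cost r n (len : R) : 2 < r * c ^+ 2 -> (1 <= n)%N -> r <= n%:R `^ (dl - dp) ->
  len <= K * n%:R `^ (- dl) -> 4 * r * len <= step_cst * g r n%:R.
Proof.
move=> rc n1 h hl; have r2 := rc2_gt1 c0 c1 rc.
have r0 : 0 < r by lra.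
have n1' : 1 <= n%:R :> R by rewrite ler1n.
have hd : r * c ^+ 2 / 2 <= n%:R `^ d.
  apply: (@le_trans _ _ r).
    have : r * c ^+ 2 <= r by rewrite ler_piMr ?(ltW r0)// expr_le1// ltW.
    lra.
  by apply: le_trans h _; apply: ler_powR => //; have := dp0; lra.
have gE : g r n%:R = r * (c * n%:R `^ (- dl)).
  by rewrite /growth_density (le_gtF hd) (le_gtF h).
have g0 := growth_density_gt0 dl dp c0 c1 n1' rc.
apply: (@le_trans _ _ (4 * (K / c) * g r n%:R)).
  rewrite gE; have -> : 4 * (K / c) * (r * (c * n%:R `^ (- dl))) = 4 * r * (K * n%:R `^ (- dl)).
    by field; rewrite gt_eqF.
  by rewrite ler_wpM2l// mulr_ge0// ltW.
rewrite ler_wpM2r ?(ltW g0)// /step_cst -!mulrA; have := Kc0 => kc.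
have : 0 <= ln (1 + 2 * (K / c)) by rewrite ln_ge0//; lra.
lra.
Qed.

(** [i%:R `^ (dl - dp)] can exceed [1] only if [dp < dl], and then it increases
    with [i]. *)
Lemma near_segment r N : 1 < r -> exists2 m, (m <= N)%N &
  (forall i, (1 <= i <= m)%N -> i%:R `^ (dl - dp) < r) /\
  (forall i, (m < i <= N)%N -> r <= i%:R `^ (dl - dp)).
Proof.
move=> r1; elim: N => [|N [m mN [H1 H2]]].
  by exists 0%N => //; split => i /andP[]; [case: i|case: i].
have [h|h] := ltP (N.+1%:R `^ (dl - dp)) r.
  move: mN; rewrite leq_eqVlt => /predU1P[mN|mN].
    exists N.+1 => //; split => i /andP[i1 i2].
      by move: i2; rewrite leq_eqVlt => /predU1P[->//|i2]; apply: H1; rewrite i1 mN.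
    by move: (leq_trans i1 i2); rewrite ltnn.
  have hm : r <= m.+1%:R `^ (dl - dp) by apply: H2; rewrite ltnSn.
  suff : m.+1%:R `^ (dl - dp) <= N.+1%:R `^ (dl - dp) by lra.
  have m1 : 1 <= m.+1%:R :> R by rewrite ler1n.
  apply: ge0_ler_powR; rewrite ?nnegrE ?ler_nat//; last exact: (leq_trans mN).
  rewrite leNgt; apply/negP => /ltW e0.
  have : m.+1%:R `^ (dl - dp) <= 1 by apply: le_trans (ler_powR m1 e0) _; rewrite powRr0.
  lra.
exists m; first exact: leq_trans mN _.
split => // i /andP[mi]; rewrite leq_eqVlt => /predU1P[->//|iN].
by apply: H2; rewrite mi.
Qed.

End StepCosts.

(** * Growth of the monodromy matrix *)

Lemma powRVN (R : realType) (x e : R) : 0 <= x -> x^-1 `^ (- e) = x `^ e.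
Proof. by move=> x0; rewrite -(powR_inv1 x0) -powRrM mulN1r opprK. Qed.

Lemma lne_le (R : realType) (x : \bar R) (y : R) : (x <= (expR y)%:E)%E -> (lne x <= y%:E)%E.
Proof.
move=> xy; have [x0|x0] := leP x 0%E; first by rewrite le0_lneNy// leNye.
have e : lne (expR y)%:E = y%:E by rewrite lne_EFin ?expR_gt0// expRK.
by rewrite -e lee_lne// in_itv/= leey andbT ?(ltW x0)// lee_fin expR_ge0.
Qed.

Section GrowthOfMonodromy.
Context {R : realType}.
Variables (l phi : nat -> R) (W : R -> R[i] -> 'M[R[i]]_2).
Variables (psi dl dp gl gp c K : R).
Hypothesis l_gt0 : forall j : nat, posnat j -> 0 < l j.
Hypothesis l_summable : (\sum_(1 <= j <oo) (l j)%:E < +oo)%E.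
Hypothesis W_sol : fundamental_solution (hamburger l phi) (total_length l) W.
Hypotheses (dl0 : 0 <= dl) (dp0 : 0 <= dp) (gl0 : 0 <= gl) (gp0 : 0 <= gp).
Hypotheses (d0 : 0 < dl + dp) (c0 : 0 < c) (c1 : c <= 1) (K0 : 0 < K).
Hypothesis l_le : forall j, (1 <= j)%N -> l j <= K * j%:R `^ (- dl).
Hypothesis phi_le : forall j, (1 <= j)%N ->
  `|sin (phi j.+1 - phi j)| <= K * j%:R `^ (- dp).
Hypothesis l_tail : forall N k, (1 <= N)%N ->
  \sum_(j < k) l (N + j.+1)%N <= K * N%:R `^ (- gl).
Hypothesis phi_tail : forall N k, (1 <= N)%N ->
  \sum_(j < k) l (N + j.+1)%N * sin (phi (N + j.+1)%N - psi) ^+ 2 <= K * N%:R `^ (- gp).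
Local Notation gm := (2^-1 * (gl + gp)).
Hypothesis gm0 : 0 < gm.
Local Notation A := (growth_area dl dp c).
Local Notation g := (growth_density dl dp c).
Local Notation WH := (W (total_length l)).
Implicit Types (r : R) (z : R[i]) (m n N i : nat).

Lemma log_cost_le r m N : 2 < r * c ^+ 2 -> (1 <= N)%N -> (m <= N)%N ->
  (forall i, (1 <= i <= m)%N -> i%:R `^ (dl - dp) < r) ->
  (forall i, (m < i <= N)%N -> r <= i%:R `^ (dl - dp)) ->
  log_cost l dl dp gl gp K r m N <=
  step_cst c K * (ln r + 3 * A r N%:R) + 4 * K * (r * N%:R `^ (- gm)).
Proof.
move=> rc N1 mN H1 H2; have r2 := rc2_gt1 c0 c1 rc.
have r0 : 0 < r by lra.
rewrite /log_cost (_ : (gl + gp) / 2 = gm); last by rewrite mulrC.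
apply: lerD; last by rewrite le_eqVlt; apply/orP; left; apply/eqP; ring.
have C0 : 0 < step_cst c K by exact: step_cst_gt0.
apply: (@le_trans _ _ (step_cst c K * \sum_(j < N) g r j.+1%:R)).
  have -> : \sum_(j < N) g r j.+1%:R =
      \sum_(j < m) g r j.+1%:R + \sum_(j < N - m) g r (m + j).+1%:R.
    rewrite -(big_mkord xpredT (fun j => g r j.+1%:R)) (@big_cat_nat _ _ _ m)//= big_mkord.
    congr (_ + _); have -> : \sum_(m <= j < N) g r j.+1%:R =
        \sum_(0 <= j < N - m) g r (j + m).+1%:R by rewrite -{1}[m]add0n big_addn.
    by rewrite big_mkord; apply: eq_bigr => j _; rewrite addnC.
  rewrite mulrDr; apply: lerD.
    rewrite mulr_sumr; apply: ler_sum => j _.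
    by apply: near_step_cost => //; apply: H1; rewrite /= ltn_ord.
  rewrite !mulr_sumr; apply: ler_sum => j _; rewrite -addnS.
  have jN : (m + j.+1 <= N)%N by rewrite addnS -ltn_subRL ltn_ord.
  apply: far_step_cost => //; first by rewrite addnS.
    by apply: H2; rewrite jN andbT addnS ltnS leq_addr.
  by apply: l_le; rewrite addnS.
rewrite ler_wpM2l ?(ltW C0)//.
rewrite -(big_mkord xpredT (fun j => g r j.+1%:R)) big_ltn//; apply: lerD; last exact: growth_density_sum_le.
have e1 : 1 `^ (dl + dp) < r * c ^+ 2 / 2 by rewrite powR1; lra.
rewrite /growth_density e1 powR1 mulr1 ler_ln ?posrE//; last lra.
by rewrite ler_piMr ?(ltW r0)// expr_le1// ltW.
Qed.

Lemma max_modulus_le r N : 2 < r * c ^+ 2 -> (1 <= N)%N ->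
  (max_modulus WH r <= (16 * Num.sqrt r * N.+1%:R `^ (dl + dp + (gl + gp)) *
   expR (step_cst c K * (ln r + 3 * A r N%:R) + 4 * K * (r * N%:R `^ (- gm))))%:E)%E.
Proof.
move=> rc N1; have r2 := rc2_gt1 c0 c1 rc.
have r1 : 1 < r by lra.
have [m mN [H1 H2]] := near_segment dl dp N r1.
apply: ge_ereal_sup => _ [z /= zr <-]; rewrite lee_fin.
have w1 j : (1 <= j <= m)%N -> 1 <= weight dl dp (Normc.normc z) j.
  move=> jm; have j1 : 1 <= j%:R :> R by case/andP: jm => j1 _; rewrite ler1n.
  have j0 : 0 < j%:R :> R by lra.
  have hj := H1 j jm; rewrite zr /weight.
  have -> : (dp - dl) / 2 = - ((dl - dp) / 2) by lra.
  rewrite powRN ler_pdivlMr ?powR_gt0// mul1r -sqrt_powR//.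
  by rewrite ler_wsqrtr// ltW.
have K1 : 0 <= 8 * Num.sqrt r * N.+1%:R `^ (dl + dp + (gl + gp)) *
   expR (log_cost l dl dp gl gp K r m N).
  by rewrite !mulr_ge0 ?sqrtr_ge0 ?powR_ge0 ?expR_ge0.
have lj j : (1 <= j)%N -> 0 <= l j by move=> j1; rewrite ltW// l_gt0.
have H n v : (N <= n)%N -> sum_norm (transfer_prod z l phi n *m v) <=
    8 * Num.sqrt r * N.+1%:R `^ (dl + dp + (gl + gp)) *
    expR (log_cost l dl dp gl gp K r m N) * sum_norm v.
  move=> Nn; have z1 : 1 <= Normc.normc z by rewrite zr ltW.
  have := transfer_prod_bound dl0 dp0 gl0 gp0 K0 lj l_le phi_le l_tail phi_tail v z1 mN N1 Nn w1.
  by rewrite zr.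
apply: le_trans (op_norm_monodromy_le l_gt0 l_summable W_sol K1 H) _.
have := log_cost_le rc N1 mN H1 H2; rewrite -ler_expR => h.
have P0 : 0 <= 16 * Num.sqrt r * N.+1%:R `^ (dl + dp + (gl + gp)).
  by rewrite !mulr_ge0 ?sqrtr_ge0 ?powR_ge0.
by apply: le_trans (ler_wpM2l P0 h); rewrite le_eqVlt; apply/orP; left; apply/eqP; ring.
Qed.

Definition polynomially_bounded (tau : R -> R) := exists2 p, 0 <= p &
  \forall r \near +oo, tau r <= r `^ p.

(** At [t = tau r] the factors up to [t] cost [A r t], the tail
    costs [r * t `^ (- gm)], and the changes of frame cost [O(ln r)]. *)
Lemma log_max_modulus_le (tau : R -> R) : tends_to_infty tau -> polynomially_bounded tau ->
  area_upper dl dp c gm tau -> (\forall r \near +oo, ln r <= r * tau r `^ (- gm)) ->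
  lesssim +oo (fun r => lne (max_modulus WH r)) (fun r => (r * tau r `^ (- gm))%:E).
Proof.
move=> tauy [p p0 tp] [KU KU0 UP] lnY.
pose P := dl + dp + (gl + gp).
have P0 : 0 <= P by rewrite !addr_ge0.
have C0 : 0 < step_cst c K by exact: step_cst_gt0.
pose C := 2 + (p + 1) * P + step_cst c K * (1 + 3 * KU) + 4 * K * 2 `^ gm.
have C0' : 0 < C.
  have h1 : 0 <= (p + 1) * P by rewrite mulr_ge0// addr_ge0.
  have h2 : 0 < step_cst c K * (1 + 3 * KU) by rewrite mulr_gt0//; lra.
  have h3 : 0 < 4 * K * 2 `^ gm by rewrite !mulr_gt0// powR_gt0.
  by rewrite /C; lra.
exists C => //; near=> r.
have rc : 2 < r * c ^+ 2 by near: r; exact: near_admissible.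
have r16 : 16 < r by near: r; exact: near_gt.
have r1 : 1 < r by near: r; exact: near_gt.
have r0 : 0 < r by exact: lt_trans r1.
have t1 : 1 < tau r by near: r; exact: tauy.
have tpr : tau r <= r `^ p by near: r.
have UPr : A r (tau r) <= KU * (r * tau r `^ (- gm)) by near: r.
have lY : ln r <= r * tau r `^ (- gm) by near: r.
set Y := r * tau r `^ (- gm) in UPr lY *.
have l0 : 0 <= ln r by rewrite ln_ge0//; lra.
pose N := Num.truncn (tau r).
have /andP[Nt tN] : N%:R <= tau r < N.+1%:R by apply: truncn_itv; lra.
have N1 : (1 <= N)%N by rewrite lt0n; apply/eqP => N0; move: tN; rewrite N0; lra.
have N1' : 1 <= N%:R :> R by rewrite ler1n.
rewrite -EFinM; apply: lne_le; apply: le_trans (max_modulus_le rc N1) _; rewrite lee_fin.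
have b1 : 16 <= expR (ln r) by rewrite lnK ?posrE//; lra.
have b2 : Num.sqrt r <= expR (ln r).
  rewrite lnK ?posrE// powR_half ?(ltW r0)//; apply: ler1_powR (ltW r1) _.
  by rewrite invf_le1// ler1n.
have b3 : N.+1%:R `^ P <= expR ((p + 1) * P * ln r).
  have -> : expR ((p + 1) * P * ln r) = (r `^ (p + 1)) `^ P.
    by rewrite -powRrM /powR gt_eqF.
  apply: powR_mono => //.
  rewrite -natr1 powRD ?(gt_eqF r0) ?implybT// powRr1 ?(ltW r0)//; nra.
have b4 : step_cst c K * (ln r + 3 * A r N%:R) <= step_cst c K * (1 + 3 * KU) * Y.
  rewrite -mulrA ler_wpM2l ?(ltW C0)//.
  by have := growth_area_le d0 c0 c1 rc N1' Nt; lra.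
have b5 : 4 * K * (r * N%:R `^ (- gm)) <= 4 * K * 2 `^ gm * Y.
  rewrite -[4 * K * 2 `^ gm * Y]mulrA ler_wpM2l ?mulr_ge0 ?(ltW K0)//.
  rewrite /Y mulrCA ler_pM2l//.
  have -> : 2 `^ gm * tau r `^ (- gm) = (tau r / 2) `^ (- gm).
    rewrite powRM ?invr_ge0 ?(ltW (lt_trans ltr01 t1))//.
    by rewrite powRVN// mulrC.
  apply: powR_anti; [by lra| |exact: ltW].
  by move: tN; rewrite -natr1; lra.
have b6 : (2 + (p + 1) * P) * ln r <= (2 + (p + 1) * P) * Y.
  by rewrite ler_wpM2l// addr_ge0// mulr_ge0// addr_ge0.
set L := _ + 4 * K * _.
have LL : ln r + ln r + (p + 1) * P * ln r + L <= C * Y.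
  by rewrite /L /C; lra.
apply: le_trans (_ : _ <= expR (ln r + ln r + (p + 1) * P * ln r + L)) _; last by rewrite ler_expR.
rewrite !expRD ler_wpM2r ?expR_ge0//.
apply: ler_pM => //; rewrite ?mulr_ge0 ?powR_ge0 ?sqrtr_ge0//.
by apply: ler_pM => //; exact: sqrtr_ge0.
Unshelve. all: by end_near. Qed.

End GrowthOfMonodromy.

Section Order.
Context {R : realType}.
Implicit Types (F : R[i] -> 'M[R[i]]_2) (a : R).

Lemma growth_order_le F (Y : R -> R) a :
  lesssim +oo (fun r => lne (max_modulus F r)) (fun r => (Y r)%:E) ->
  (forall b, a < b -> \forall r \near +oo, Y r <= r `^ b) ->
  (growth_order F <= a%:E)%E.
Proof.
move=> [C C0 CY] YP; apply/lee_addgt0Pr => e e0.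
pose V := [set r : R | (lne (lne (max_modulus F r)) * ((ln r)^-1)%:E <= (a + e)%:E)%E].
rewrite -EFinD; apply: (@le_trans _ _ (ereal_sup [set
  (lne (lne (max_modulus F r)) * ((ln r)^-1)%:E)%E | r in V])); last first.
  by apply: ge_ereal_sup => _ [r /= Vr <-].
apply: ereal_inf_lbound; exists V => //.
near=> r; rewrite /V /=.
have r1 : 1 < r by near: r; exact: near_gt.
have r0 : 0 < r by lra.
have l0 : 0 < ln r by rewrite ln_gt0.
have h1 : (lne (max_modulus F r) <= C%:E * (Y r)%:E)%E by near: r.
have h2 : Y r <= r `^ (a + e / 2) by near: r; apply: YP; lra.
have h3 : C * r `^ (a + e / 2) < r `^ (a + e) by near: r; apply: near_powR_lt; lra.
have h4 : (lne (lne (max_modulus F r)) <= ((a + e) * ln r)%:E)%E.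
  apply: lne_le; apply: (le_trans h1); rewrite -EFinM lee_fin.
  have -> : expR ((a + e) * ln r) = r `^ (a + e) by rewrite /powR gt_eqF.
  by apply: le_trans (ltW h3); rewrite ler_wpM2l// ltW.
apply: (@le_trans _ _ (((a + e) * ln r)%:E * ((ln r)^-1)%:E)%E).
  by rewrite lee_wpmul2r// lee_fin invr_ge0 ltW.
by rewrite -EFinM mulfK// gt_eqF.
Unshelve. all: by end_near. Qed.

End Order.

(** * Conclusions from a comparison of the area with the tail *)

Section Assembly.
Context {R : realType}.
Variables (l phi : nat -> R) (W : R -> R[i] -> 'M[R[i]]_2).
Variables (psi dl dp gl gp c : R).
Hypothesis l_gt0 : forall j : nat, posnat j -> 0 < l j.
Hypothesis l_summable : (\sum_(1 <= j <oo) (l j)%:E < +oo)%E.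
Hypothesis W_sol : fundamental_solution (hamburger l phi) (total_length l) W.
Hypotheses (dl0 : 0 <= dl) (dp0 : 0 <= dp) (gl0 : 0 <= gl) (gp0 : 0 <= gp).
Hypotheses (c0 : 0 < c) (c1 : c <= 1).
Hypothesis l_bound : lesssim (globally posnat)
  (fun j : nat => (l j)%:E) (fun j : nat => (j%:R `^ (- dl))%:E).
Hypothesis phi_bound : lesssim (globally posnat)
  (fun j : nat => (`|sin (phi j.+1 - phi j)|)%:E)
  (fun j : nat => (j%:R `^ (- dp))%:E).
Hypothesis l_tail : lesssim (globally posnat)
  (fun N : nat => (\sum_(N.+1 <= j <oo) (l j)%:E)%E)
  (fun N : nat => (N%:R `^ (- gl))%:E).
Hypothesis phi_tail : lesssim (globally posnat)
  (fun N : nat => (\sum_(N.+1 <= j <oo) (l j * sin (phi j - psi) ^+ 2)%:E)%E)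
  (fun N : nat => (N%:R `^ (- gp))%:E).
Local Notation gm := (2^-1 * (gl + gp)).
Hypotheses (d0 : 0 < dl + dp) (gm0 : 0 < gm).
Local Notation WH := (W (total_length l)).
Local Notation logM := (fun r : R => lne (max_modulus WH r)).
Local Notation T := (fun r : R => (balance_point dl dp c gl gp r)%:E).

Lemma lesssim_real (f : nat -> R) (e : R) :
  lesssim (globally posnat) (fun j => (f j)%:E) (fun j => (j%:R `^ e)%:E) ->
  exists2 K, 0 < K & forall j, (1 <= j)%N -> f j <= K * j%:R `^ e.
Proof.
by move=> [K K0 H]; exists K.
Qed.

Lemma lesssim_tail (f : nat -> R) (e : R) : (forall j, (1 <= j)%N -> 0 <= f j) ->
  lesssim (globally posnat) (fun N => (\sum_(N.+1 <= j <oo) (f j)%:E)%E)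
    (fun j => (j%:R `^ e)%:E) ->
  exists2 K, 0 < K & forall N k, (1 <= N)%N -> \sum_(j < k) f (N + j.+1)%N <= K * N%:R `^ e.
Proof.
move=> f0 [K K0 H]; exists K => // N k N1; rewrite -lee_fin.
have := H N N1; rewrite -EFinM; apply: le_trans.
have -> : (\sum_(j < k) f (N + j.+1)%N)%:E = (\sum_(N.+1 <= j < k + N.+1) (f j)%:E)%E.
  rewrite -sumEFin -{1}[N.+1]add0n big_addn addnK big_mkord.
  by apply: eq_bigr => j _; rewrite addnS addnC addnS.
apply: nneseries_lim_ge => n Nn _; rewrite lee_fin f0//.
exact: leq_trans Nn.
Qed.

Lemma common_constant : exists2 K, 0 < K &
  [/\ forall j, (1 <= j)%N -> l j <= K * j%:R `^ (- dl),
      forall j, (1 <= j)%N -> `|sin (phi j.+1 - phi j)| <= K * j%:R `^ (- dp),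
      forall N k, (1 <= N)%N -> \sum_(j < k) l (N + j.+1)%N <= K * N%:R `^ (- gl) &
      forall N k, (1 <= N)%N ->
        \sum_(j < k) l (N + j.+1)%N * sin (phi (N + j.+1)%N - psi) ^+ 2 <= K * N%:R `^ (- gp)].
Proof.
have l0 j : (1 <= j)%N -> 0 <= l j by move=> j1; rewrite ltW// l_gt0.
have [K1 K10 H1] := lesssim_real l_bound.
have [K2 K20 H2] := lesssim_real phi_bound.
have [K3 K30 H3] := lesssim_tail l0 l_tail.
have ls0 j : (1 <= j)%N -> 0 <= l j * sin (phi j - psi) ^+ 2.
  by move=> j1; rewrite mulr_ge0 ?l0 ?sqr_ge0.
have [K4 K40 H4] := lesssim_tail ls0 phi_tail.
exists (K1 + K2 + K3 + K4); first by rewrite !addr_gt0.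
split.
- by move=> j j1; apply: le_trans (H1 j j1) _; rewrite ler_wpM2r ?powR_ge0//; lra.
- by move=> j j1; apply: le_trans (H2 j j1) _; rewrite ler_wpM2r ?powR_ge0//; lra.
- by move=> N k N1; apply: le_trans (H3 N k N1) _; rewrite ler_wpM2r ?powR_ge0//; lra.
- by move=> N k N1; apply: le_trans (H4 N k N1) _; rewrite ler_wpM2r ?powR_ge0//; lra.
Qed.

Lemma lesssim_near_eq (f : R -> \bar R) (Y Z : R -> R) :
  (\forall r \near +oo, Y r = Z r) ->
  lesssim +oo f (fun r => (Y r)%:E) -> lesssim +oo f (fun r => (Z r)%:E).
Proof.
move=> YZ [K K0 H]; exists K => //; near=> r.
have <- : Y r = Z r by near: r.
by near: r.
Unshelve. all: by end_near. Qed.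

(** An upper bound for the area up to [tau r] by the tail cost
    [r * tau r `^ (- gm)] serves twice: it bounds the exponent of the growth, and
    it puts the balance point beyond a multiple of [tau r]. *)
Lemma conclusions (tau Z : R -> R) (a : R) :
  tends_to_infty tau -> polynomially_bounded tau -> area_upper dl dp c gm tau ->
  (\forall r \near +oo, r * tau r `^ (- gm) = Z r) ->
  (\forall r \near +oo, ln r <= Z r) ->
  (forall b, a < b -> \forall r \near +oo, Z r <= r `^ b) ->
  [/\ lesssim +oo (fun r => (tau r)%:E) T,
      lesssim +oo logM (fun r => (Z r)%:E) & (growth_order WH <= a%:E)%E].
Proof.
move=> tauy taup up YZ lnZ Zb.
have [K K0 [H1 H2 H3 H4]] := common_constant.
have lnY : \forall r \near +oo, ln r <= r * tau r `^ (- gm).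
  near=> r; have -> : r * tau r `^ (- gm) = Z r by near: r.
  by near: r.
have logMZ : lesssim +oo logM (fun r => (Z r)%:E).
  apply: lesssim_near_eq YZ _.
  exact: (log_max_modulus_le l_gt0 l_summable W_sol dl0 dp0 gl0 gp0 d0 c0 c1 K0 H1 H2 H3 H4 gm0).
split => //; first exact: balance_point_lower.
exact: growth_order_le logMZ Zb.
Unshelve. all: by end_near. Qed.

Lemma power_conclusions (x a : R) : 0 < x -> 0 < a -> 1 - x * gm = a ->
  area_upper dl dp c gm (fun r => r `^ x) ->
  [/\ lesssim +oo (fun r => (r `^ x)%:E) T,
      lesssim +oo logM (fun r => (r `^ a)%:E) & (growth_order WH <= a%:E)%E].
Proof.
move=> x0 a0 xa up; apply: conclusions up _ _ _.
- exact: power_tends_to_infty.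
- by exists x; [exact: ltW|near=> r].
- near=> r; have r0 : 0 < r by near: r; exact: near_gt.
  by rewrite powR_balance// xa.
- near=> r; have : 1 * ln r < r `^ a by near: r; exact: near_ln_lt.
  by rewrite mul1r => /ltW.
- move=> b ab; near=> r; have : 1 * r `^ a < r `^ b by near: r; exact: near_powR_lt.
  by rewrite mul1r => /ltW.
Unshelve. all: by end_near. Qed.

(** The equation for [tau] is only asked at positive [r], where [r `^ 1] is [r]. *)
Lemma log_power_conclusions (tau : R -> R) (x y : R) :
  (forall r, 0 < r -> tau r = (r `^ x / ln r) `^ y) -> 0 < x -> 0 < y ->
  area_upper dl dp c gm tau -> x * y * gm < 1 ->
  [/\ lesssim +oo (fun r => (tau r)%:E) T,
      lesssim +oo logM (fun r => (r `^ (1 - x * y * gm) * ln r `^ (y * gm))%:E)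
    & (growth_order WH <= (1 - x * y * gm)%:E)%E].
Proof.
move=> tauE x0 y0 up xy1; have yg : 0 < y * gm by rewrite mulr_gt0.
apply: conclusions up _ _ _.
- move=> K; have H := power_div_ln_tends_to_infty x0 y0 K; near=> r.
  have r0 : 0 < r by near: r; exact: near_gt.
  by rewrite tauE//; near: r.
- exists (x * y); first by rewrite mulr_ge0// ltW.
  near=> r; have r0 : 0 < r by near: r; exact: near_gt.
  have l1 : 1 < ln r by near: r; exact: near_ln_gt.
  rewrite tauE// powRrM; apply: powR_mono (ltW y0); first by rewrite divr_gt0 ?powR_gt0//; lra.
  by rewrite ler_pdivrMr ?ler_peMr ?powR_ge0//; lra.
- near=> r; have r0 : 0 < r by near: r; exact: near_gt.
  have l1 : 1 < ln r by near: r; exact: near_ln_gt.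
  have l0 : 0 <= ln r by lra.
  rewrite tauE// -[(_ `^ y) `^ _]powRrM mulrN powRM ?powR_ge0 ?invr_ge0//.
  rewrite powRVN// -powRrM mulrA; congr (_ * _).
  rewrite -[X in X * _](powRr1 (ltW r0)) -powRD ?(gt_eqF r0) ?implybT//; congr powR; ring.
- near=> r; have r0 : 0 < r by near: r; exact: near_gt.
  have l1 : 1 < ln r by near: r; exact: near_ln_gt.
  have : 1 * ln r < r `^ (1 - x * y * gm) by near: r; apply: near_ln_lt; lra.
  rewrite mul1r => /ltW/le_trans; apply; rewrite ler_peMr ?powR_ge0//.
  by apply: powR_ge1; apply: ltW.
- move=> b ab; near=> r; have r0 : 0 < r by near: r; exact: near_gt.
  have l1 : 1 < ln r by near: r; exact: near_ln_gt.
  pose e := (b - (1 - x * y * gm)) / (y * gm).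
  have h : 1 * ln r < r `^ e.
    by near: r; apply: near_ln_lt; rewrite divr_gt0// subr_gt0.
  have -> : r `^ b = r `^ (1 - x * y * gm) * (r `^ e) `^ (y * gm).
    rewrite -powRrM -powRD ?(gt_eqF r0) ?implybT//; congr powR.
    by rewrite /e divfK ?gt_eqF//; ring.
  rewrite ler_wpM2l ?powR_ge0//; apply: powR_mono (ltW yg); lra.
Unshelve. all: by end_near. Qed.

End Assembly.

Theorem corollary2p5 (R : realType) (l phi : nat -> R)
    (l_gt0 : forall j : nat, posnat j -> 0 < l j)
    (l_summable : (\sum_(1 <= j <oo) (l j)%:E < +oo)%E)
    (W : R -> R[i] -> 'M[R[i]]_2)
    (W_sol : fundamental_solution (hamburger l phi) (total_length l) W)
    (psi deltal deltaphi gammal gammaphi : R)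
    (deltal_ge0 : 0 <= deltal) (deltaphi_ge0 : 0 <= deltaphi)
    (gammal_ge0 : 0 <= gammal) (gammaphi_ge0 : 0 <= gammaphi)
    (l_bound : lesssim (globally posnat)
       (fun j : nat => (l j)%:E)
       (fun j : nat => (j%:R `^ (- deltal))%:E))
    (phi_bound : lesssim (globally posnat)
       (fun j : nat => (`|sin (phi j.+1 - phi j)|)%:E)
       (fun j : nat => (j%:R `^ (- deltaphi))%:E))
    (l_tail : lesssim (globally posnat)
       (fun N : nat => (\sum_(N.+1 <= j <oo) (l j)%:E)%E)
       (fun N : nat => (N%:R `^ (- gammal))%:E))
    (phi_tail : lesssim (globally posnat)
       (fun N : nat => (\sum_(N.+1 <= j <oo) (l j * sin (phi j - psi) ^+ 2)%:E)%E)
       (fun N : nat => (N%:R `^ (- gammaphi))%:E))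
    (c : R) (c_gt0 : 0 < c) (c_le1 : c <= 1) :
  let delta := deltal + deltaphi in
  let gamma := 2^-1 * (gammal + gammaphi) in
  0 < delta -> 0 < gamma ->
  let WH := W (total_length l) in
  let T := fun r : R => (Tfun
    (fun t => c * t `^ (- deltal)) (fun t => c * t `^ (- deltaphi))
    (fun t => c * t `^ (- gammal)) (fun t => c * t `^ (- gammaphi)) r)%:E in
  let logM := fun r : R => lne (max_modulus WH r) in
  let rho := growth_order WH in
  [/\ (delta < 1 + gamma ->
        [/\ asymp +oo T (fun r => ((r / ln r) `^ (1 / (1 + gamma)))%:E),
            lesssim +oo logM
              (fun r => (r `^ (1 / (1 + gamma)) *
                         ln r `^ (gamma / (1 + gamma)))%:E)
          & (rho <= (1 / (1 + gamma))%:E)%E]),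
      (delta = 1 + gamma ->
        [/\ asymp +oo T (fun r => (r `^ (1 / delta))%:E),
            lesssim +oo logM (fun r => (r `^ (1 / delta))%:E)
          & (rho <= (1 / delta)%:E)%E]),
      (1 + gamma < delta -> 2 < delta ->
        [/\ asymp +oo T (fun r => (r `^ ((delta - 1) / (gamma * delta)))%:E),
            lesssim +oo logM (fun r => (r `^ (1 / delta))%:E)
          & (rho <= (1 / delta)%:E)%E]),
      (1 + gamma < delta -> delta = 2 ->
        [/\ lesssim +oo (fun r => ((r `^ 2^-1 / ln r) `^ (1 / gamma))%:E) T,
            (0 < deltaphi ->
              lesssim +oo T (fun r => ((r `^ 2^-1 / ln r) `^ (1 / gamma))%:E)),
            lesssim +oo logM (fun r => (r `^ 2^-1 * ln r)%:E)
          & (rho <= (2^-1)%:E)%E])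
    & (1 + gamma < delta -> delta < 2 -> deltal <= 1 + gamma ->
        [/\ asymp +oo T (fun r => (r `^ (1 / (2 - delta + 2 * gamma)))%:E),
            lesssim +oo logM
              (fun r => (r `^ ((2 - delta + gamma) /
                               (2 - delta + 2 * gamma)))%:E)
          & (rho <= ((2 - delta + gamma) / (2 - delta + 2 * gamma))%:E)%E])
      /\
      (1 + gamma < delta -> delta < 2 -> 1 + gamma < deltal ->
        [/\ asymp +oo T
              (fun r => (r `^ ((deltal - 1) /
                               (gamma * (deltal - deltaphi))))%:E),
            lesssim +oo logM
              (fun r => (r `^ ((1 - deltaphi) / (deltal - deltaphi)))%:E)
          & (rho <= ((1 - deltaphi) / (deltal - deltaphi))%:E)%E])].
Proof.
move=> delta gamma d0 gm0 WH T logM rho.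
have bl := @balance_point_upper _ _ _ _ gammal gammaphi deltal_ge0 d0 c_gt0 c_le1 gm0.
have pc := @power_conclusions _ _ _ _ _ _ _ _ _ _ l_gt0 l_summable W_sol deltal_ge0
  deltaphi_ge0 gammal_ge0 gammaphi_ge0 c_gt0 c_le1 l_bound phi_bound l_tail phi_tail d0 gm0.
have lpc := @log_power_conclusions _ _ _ _ _ _ _ _ _ _ l_gt0 l_summable W_sol deltal_ge0
  deltaphi_ge0 gammal_ge0 gammaphi_ge0 c_gt0 c_le1 l_bound phi_bound l_tail phi_tail d0 gm0.
have dV0 : 0 < delta^-1 by rewrite invr_gt0.
have dn0 : delta != 0 by rewrite gt_eqF.
have gn0 : gamma != 0 by rewrite gt_eqF.
have g10 : 0 < 1 + gamma by lra.
have y0 : 0 < 1 / (1 + gamma) by rewrite divr_gt0.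
split=> [h|h|h h2|h h2|].
- have e2 : 1 / (1 + gamma) * gamma = gamma / (1 + gamma) by ring.
  have e1 : 1 - 1 * (1 / (1 + gamma)) * gamma = 1 / (1 + gamma).
    by field; rewrite gt_eqF.
  have xy1 : 1 * (1 / (1 + gamma)) * gamma < 1 by rewrite -subr_gt0 e1.
  have tauE r : 0 < r -> (r / ln r) `^ (1 / (1 + gamma)) = (r `^ 1 / ln r) `^ (1 / (1 + gamma)).
    by move=> r0; rewrite powRr1// ltW.
  have up := area_upper_log d0 c_gt0 c_le1 gm0 h.
  have [h1 h2 h3] := lpc _ 1 (1 / (1 + gamma)) tauE ltr01 y0 up xy1.
  rewrite e1 e2 in h2 h3; split => //; split => //.
  by apply: bl; [exact: tau_log_infty|exact: area_lower_log].
- have xE : 1 / delta = delta^-1 by rewrite mul1r.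
  have xg : 1 - delta^-1 * gamma = delta^-1.
    by have -> : gamma = delta - 1 by [lra]; field.
  have up := @area_upper_head _ _ _ _ gamma d0 c_gt0 c_le1 _ erefl xg.
  have lo := @area_lower_head _ _ _ _ gamma d0 c_gt0 c_le1 _ (lexx _) xg.
  rewrite xE; have [h1 h2 h3] := pc _ _ dV0 dV0 xg up.
  by split => //; split => //; apply: bl => //; exact: power_tends_to_infty.
- pose x := (delta - 1) / (gamma * delta).
  have xE : 1 / delta = delta^-1 by rewrite mul1r.
  have xg : 1 - x * gamma = delta^-1 by rewrite /x; field; rewrite gn0 dn0.
  have dx : delta^-1 <= x.
    have -> : x = delta^-1 * ((delta - 1) / gamma) by rewrite /x; field; rewrite gn0 dn0.
    by rewrite ler_peMr ?(ltW dV0)// ler_pdivlMr// mul1r; lra.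
  have x0 : 0 < x by exact: lt_le_trans dx.
  have up := area_upper_summable d0 c_gt0 c_le1 h2 dx xg.
  have lo := area_lower_head d0 c_gt0 c_le1 dx xg.
  rewrite xE; have [h1 h3 h4] := pc _ _ x0 dV0 xg up.
  by split => //; split => //; apply: bl => //; exact: power_tends_to_infty.
- have i0 : 0 < 2^-1 :> R by rewrite invr_gt0.
  have gi0 : 0 < 1 / gamma by rewrite divr_gt0.
  have e1 : 1 - 2^-1 * (1 / gamma) * gamma = 2^-1 by field.
  have e2 : 1 / gamma * gamma = 1 by field.
  have xy1 : 2^-1 * (1 / gamma) * gamma < 1 by rewrite -subr_gt0 e1.
  have up := area_upper_critical d0 c_gt0 c_le1 gm0 h2.
  have [h1 h3 h4] := lpc _ 2^-1 (1 / gamma) (fun r _ => erefl) i0 gi0 up xy1.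
  rewrite e1 in h3 h4; split => //; last first.
    apply: (lesssim_near_eq _ h3); near=> r; rewrite e2 powRr1//.
    by apply: ln_ge0; apply: ltW; near: r; exact: near_gt.
  move=> dp1; apply: bl; first exact: tau_critical_infty.
  exact: area_lower_critical.
- split=> [h h2 h3|h h2 h3].
    pose D := 2 - delta + 2 * gamma; pose x := 1 / D.
    have D0 : 0 < D by rewrite /D; lra.
    have x0 : 0 < x by rewrite divr_gt0.
    have Dn0 : D != 0 by rewrite gt_eqF.
    pose a := (2 - delta + gamma) / D.
    have a0 : 0 < a by rewrite divr_gt0//; lra.
    have xa : 1 - x * gamma = a by rewrite /x /a /D; field.
    have xg : 1 - x * gamma = 2^-1 + x * (1 - delta / 2) by rewrite /x /D; field.
    have dx : delta^-1 < x.
      by rewrite /x mul1r ltf_pV2 ?posrE// /D; lra.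
    have xe : x * (deltal - deltaphi) <= 1.
      by rewrite /x mul1r mulrC ler_pdivrMr// mul1r /D /delta; lra.
    have up := area_upper_middle d0 c_gt0 c_le1 h2 x0 xg.
    have lo := area_lower_middle d0 c_gt0 c_le1 dx xe xg.
    have [h4 h5 h6] := pc _ _ x0 a0 xa up.
    by split => //; split => //; apply: bl => //; exact: power_tends_to_infty.
  pose e := deltal - deltaphi.
  have dl1 : 1 < deltal by lra.
  have e0 : 0 < e by move: h2; rewrite /e /delta; lra.
  have en0 : e != 0 by rewrite gt_eqF.
  pose x := (deltal - 1) / (gamma * e); pose a := (1 - deltaphi) / e.
  have xa : 1 - x * gamma = a.
    by rewrite /x /a /e in en0 *; field; rewrite gn0 en0.
  have a0 : 0 < a by rewrite divr_gt0//; move: h2; rewrite /delta; lra.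
  have ex : e^-1 <= x.
    have -> : x = e^-1 * ((deltal - 1) / gamma) by rewrite /x; field; rewrite gn0 en0.
    by rewrite ler_peMr ?invr_ge0 ?(ltW e0)// ler_pdivlMr// mul1r; lra.
  have x0 : 0 < x by apply: lt_le_trans ex; rewrite invr_gt0.
  have up := area_upper_far deltaphi_ge0 d0 c_gt0 c_le1 h2 dl1 ex xa.
  have lo := area_lower_far deltaphi_ge0 d0 c_gt0 c_le1 h2 dl1 ex xa.
  have [h4 h5 h6] := pc _ _ x0 a0 xa up.
  by split => //; split => //; apply: bl => //; exact: power_tends_to_infty.
Unshelve. all: by end_near. Qed.
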